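(* Let $p^*_{\delta,a}=\inf\{\|\ddot q\|_{L^{1,2}(\Omega_\delta\times\Omega_\delta)} : \ddot q\in\overline{\mathbb{Q}}{}^a_\delta(f)\}$. This infimum is attained: there exists $\ddot q^*\in\overline{\mathbb{Q}}{}^a_\delta(f)$ with $\|\ddot q^*\|_{L^{1,2}(\Omega_\delta\times\Omega_\delta)}=p^*_{\delta,a}$.
   Context: Let $n\ge 2$ and let $\Omega\subset\mathbb{R}^n$ be a bounded connected open set with Lipschitz boundary; let $f\in L^2(\Omega)$. Fix $\delta>0$ and put $\Omega_\delta=\bigcup_{x\in\Omega}B(x,\delta)$. Let $K_{2,n}=|\mathbb{S}^{n-1}|^{-1}\int_{\mathbb{S}^{n-1}}|s\cdot e|^2\,ds$ ($e$ any unit vector). Let $\omega_\delta:\mathbb{R}^n\to[0,\infty)$ be a radial measurable function supported in $B(0,\delta)$ with $\int_{\mathbb{R}^n}|z|^2\omega_\delta^2(z)\,dz=K_{2,n}^{-1}$. Functions defined on $\Omega$ are extended by zero outside $\Omega$. The nonlocal gradient is $\mathcal{G}_\delta u(x,x')=[u(x)-u(x')]\omega_\delta(x-x')$ for $(x,x')\in\Omega_\delta\times\Omega_\delta$, and $\mathcal{U}_{\delta,0}=\{u\in L^2(\Omega):\mathcal{G}_\delta u\in L^2(\Omega_\delta\times\Omega_\delta)\}$. The nonlocal divergence $\mathcal{D}_\delta$ is the negative adjoint of $\mathcal{G}_\delta$: its domain $\mathbb{Q}_\delta$ is the set of $\ddot q\in L^2(\Omega_\delta\times\Omega_\delta)$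 for which there is $g\in L^2(\Omega)$ with $\int_\Omega g v\,dx=-\int_{\Omega_\delta}\int_{\Omega_\delta}\ddot q\,\mathcal{G}_\delta v\,dx'\,dx$ for all $v\in\mathcal{U}_{\delta,0}$, and then $\mathcal{D}_\delta\ddot q=g$. For $1\le p,r\le\infty$, $L^{p,r}(\Omega_\delta\times\Omega_\delta)$ is the mixed-norm Lebesgue space with norm $\|\ddot q\|_{L^{p,r}}=\big\|\,\|\ddot q(x,\cdot)\|_{L^r(\Omega_\delta)}\big\|_{L^p(\Omega_\delta,dx)}$; a subscript $a$ denotes the closed subspace of antisymmetric functions ($\ddot q(x,x')=-\ddot q(x',x)$ a.e.). The operator $\mathcal{D}_\delta$, regarded as an unbounded operator from $L^{1,2}(\Omega_\delta\times\Omega_\delta)$ to $L^2(\Omega)$ with domain $\mathbb{Q}_\delta$, is closable; $\overline{\mathcal{D}}_\delta$ denotes its closure, $\overline{\mathbb{Q}}_\delta$ its domain, $\overline{\mathbb{Q}}{}^a_\delta=\overline{\mathbb{Q}}_\delta\cap L^{1,2}_a(\Omega_\delta\times\Omega_\delta)$, and $\overline{\mathbb{Q}}{}^a_\delta(f)=\{\ddot q\in\overline{\mathbb{Q}}{}^a_\delta:\overline{\mathcal{D}}_\delta\ddot q=f\}$. *)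

(* Defs.v *)
From HB Require Import structures.
From mathcomp Require Import all_boot all_order all_algebra.
From mathcomp Require Import all_classical all_reals all_analysis.
Set Implicit Arguments. Unset Strict Implicit. Unset Printing Implicit Defensive.
Import Order.TTheory GRing.Theory Num.Theory.
Import numFieldNormedType.Exports.
Local Open Scope classical_set_scope.
Local Open Scope ring_scope.

Section Defs.
Variables (R : realType) (n : nat).

(** R^n with its Borel sigma-algebra (generated by the open sets of the
    product topology on 'rV[R]_n, which is the Euclidean topology). *)
Definition Rn : Type := g_sigma_algebraType (@open 'rV[R]_n).

Definition edot (x y : 'rV[R]_n) : R := \sum_(i < n) x 0 i * y 0 i.
Definition enorm (x : 'rV[R]_n) : R := Num.sqrt (edot x x).
Definition eball (x : 'rV[R]_n) (r : R) : set Rn :=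
  [set y : Rn | enorm (y - x) < r].

(** mu is the Lebesgue measure on R^n: it gives half-open boxes their volume
    (this determines the Borel measure uniquely). *)
Definition is_lebesgue (mu : {measure set Rn -> \bar R}) : Prop :=
  forall a b : 'rV[R]_n, (forall i, a 0 i <= b 0 i) ->
    mu [set x : Rn | forall i, a 0 i <= x 0 i < b 0 i] =
    (\prod_(i < n) (b 0 i - a 0 i))%:E.

Definition ebounded (O : set 'rV[R]_n) : Prop :=
  exists M : R, forall x, O x -> enorm x <= M.

(** Lipschitz boundary: near every boundary point, after a rigid change of
    coordinates y = (x - x0) Q (Q orthogonal), Omega is the strict subgraph
    y_i < gamma(y') of a Lipschitz function gamma of the remaining
    coordinates y'. *)
Definition lipschitz_boundary (O : set 'rV[R]_n) : Prop :=
  forall x0 : 'rV[R]_n, closure O x0 -> ~ O x0 ->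
  exists (r : R) (Q : 'M[R]_n) (i : 'I_n) (gamma : 'rV[R]_n -> R) (L : R),
    [/\ 0 < r, Q *m Q^T = 1%:M,
      (forall y z : 'rV[R]_n, (forall j, j != i -> y 0 j = z 0 j) ->
         gamma y = gamma z),
      (forall y z : 'rV[R]_n, `|gamma y - gamma z| <= L * enorm (y - z)) &
      (forall x : 'rV[R]_n, enorm (x - x0) < r ->
         (O x <-> ((x - x0) *m Q) 0 i < gamma ((x - x0) *m Q)))].

Definition lipschitz_domain (O : set 'rV[R]_n) : Prop :=
  [/\ open O, connected O, ebounded O & lipschitz_boundary O].

Variable mu : {measure set Rn -> \bar R}.

(** K_{2,n}: average of |s.e|^2 over the unit sphere, e = first basis vector.
    The normalized surface average of a function g on S^{n-1} is computed
    through the cone measure:  |S|^{-1} int_S g = |B_1|^{-1} int_{B_1} g(z/|z|) dz. *)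
Definition e1 : 'rV[R]_n := \row_i (if val i == 0%N then 1 else 0).
Definition K2n : R :=
  fine (\int[mu]_(z in eball 0 1) ((edot z e1 / enorm z) ^+ 2)%:E)%E
  / fine (mu (eball 0 1)).

Definition kernel_ok (delta : R) (w : 'rV[R]_n -> R) : Prop :=
  [/\ measurable_fun [set: Rn] (w : Rn -> R),
      (forall z, 0 <= w z),
      (forall z z', enorm z = enorm z' -> w z = w z'),
      (forall z, delta <= enorm z -> w z = 0) &
      (\int[mu]_(z in [set: Rn]) ((enorm z) ^+ 2 * (w z) ^+ 2)%:E
         = (K2n^-1)%:E)%E].

Definition Odelta (O : set 'rV[R]_n) (delta : R) : set Rn :=
  [set y : Rn | exists x, O x /\ enorm (y - x) < delta].

Definition zext (O : set 'rV[R]_n) (u : 'rV[R]_n -> R) : Rn -> R :=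
  fun x => if `[< O x >] then u x else 0.

Definition inL2 (O : set Rn) (u : Rn -> R) : Prop :=
  measurable_fun O u /\ (\int[mu]_(x in O) ((u x) ^+ 2)%:E < +oo)%E.
Definition L2norm (O : set Rn) (u : Rn -> R) : \bar R :=
  ((\int[mu]_(x in O) ((u x) ^+ 2)%:E) `^ (2^-1))%E.

Definition inL2x2 (D : set Rn) (q : Rn -> Rn -> R) : Prop :=
  measurable_fun (D `*` D) (fun p : Rn * Rn => q p.1 p.2) /\
  (\int[mu]_(x in D) \int[mu]_(x' in D) ((q x x') ^+ 2)%:E < +oo)%E.

Definition L12norm (D : set Rn) (q : Rn -> Rn -> R) : \bar R :=
  (\int[mu]_(x in D) ((\int[mu]_(x' in D) ((q x x') ^+ 2)%:E) `^ (2^-1)))%E.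
Definition inL12 (D : set Rn) (q : Rn -> Rn -> R) : Prop :=
  measurable_fun (D `*` D) (fun p : Rn * Rn => q p.1 p.2) /\
  (L12norm D q < +oo)%E.

Definition antisym_ae (D : set Rn) (q : Rn -> Rn -> R) : Prop :=
  {ae mu, forall x : Rn, D x ->
     {ae mu, forall x' : Rn, D x' -> q x x' = - q x' x}}.

Variables (O : set 'rV[R]_n) (delta : R) (w : 'rV[R]_n -> R).

Definition Gd (u : 'rV[R]_n -> R) : Rn -> Rn -> R :=
  fun x x' => (zext O u x - zext O u x') * w (x - x').

Definition Ud0 (u : 'rV[R]_n -> R) : Prop :=
  inL2 O u /\ inL2x2 (Odelta O delta) (Gd u).

(** q in Q_delta with D_delta q = g (negative adjoint of G_delta) *)
Definition is_Dd (q : Rn -> Rn -> R) (g : Rn -> R) : Prop :=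
  [/\ inL2x2 (Odelta O delta) q, inL2 O g &
      forall v : 'rV[R]_n -> R, Ud0 v ->
        (\int[mu]_(x in O) (g x * v x)%:E =
         - \int[mu]_(x in Odelta O delta)
              \int[mu]_(x' in Odelta O delta) (q x x' * Gd v x x')%:E)%E].

(** graph of the closure of D_delta : L^{1,2} -> L^2(Omega):
    (q, g) is a limit of (q_k, D_delta q_k) with q_k in Q_delta. *)
Definition closure_Dd (q : Rn -> Rn -> R) (g : Rn -> R) : Prop :=
  inL12 (Odelta O delta) q /\ inL2 O g /\
  exists (qk : nat -> Rn -> Rn -> R) (gk : nat -> Rn -> R),
    [/\ (forall k, is_Dd (qk k) (gk k)),
        (fun k => L12norm (Odelta O delta)
                    (fun x x' => qk k x x' - q x x')) @ \oo --> 0%E &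
        (fun k => L2norm O (fun x => gk k x - g x)) @ \oo --> 0%E].

Definition Qbar_a (f : 'rV[R]_n -> R) : set (Rn -> Rn -> R) :=
  [set q | antisym_ae (Odelta O delta) q /\ closure_Dd q f].

End Defs.

(* Main.v *)
Require Import Defs.
From HB Require Import structures.
From mathcomp Require Import all_boot all_order all_algebra.
From mathcomp Require Import all_classical all_reals all_analysis.
From mathcomp Require Import measurable_realfun.
From mathcomp Require Import ring lra.
Import Order.TTheory GRing.Theory Num.Theory.
Import numFieldNormedType.Exports.
Local Open Scope classical_set_scope.
Local Open Scope ring_scope.
Set Implicit Arguments.
Unset Strict Implicit.

(** The closure of D_delta consists of the q in L^{1,2} with <q, G v> = -<f, v> for
    all v in U_{delta,0} whose gradient has uniformly L^2-bounded rows, i.e. lies in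
    L^{oo,2}.  One inclusion is a passage to the limit.  For the other, subtract the
    solution q0 = c G u of D q0 = f given by the Poincare inequality and approximate
    the difference, which annihilates all such G v, by divergence-free L^2 fluxes:
    truncate large rows, project in L^2 onto divergence-free fluxes plus a small
    L^{1,2} ball; the residual is orthogonal to divergence-free fluxes, hence a
    gradient G v, and minimality bounds its rows, so it pairs to zero with q.

    L^{1,2} is not reflexive, and compactness comes from antisymmetry: |q(x,y)| sits in
    the rows of both x and y, so bounded sets of antisymmetric fluxes are uniformly
    integrable.  Hence a minimising sequence which also nearly minimises the integral
    of the strictly convex sqrt(1 + q^2) is Cauchy in L^1, and by Fatou its limit does
    not increase the norm.  The constraint survives the L^1 limit when G v is bounded
    up to an L^{oo,2}-small error.  A general v is a uniform limit of such potentials: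
    if w^2 is not integrable, average v with weight min(w^2, j) normalised and shrink
    the result towards 0; if w^2 is integrable, v is already bounded.

    The Poincare inequality follows from D(2z) <= 4 D(z) for
    D(z) = |u(. + z) - u|_2^2, as D(z) >= |u|_2^2 once |z| exceeds the diameter. *)

(** The bounded-row condition on test gradients is forced by duality: an L^{1,2} flux pairs
    continuously with L^{oo,2}, not with L^2, so the weak equation cannot be tested on all of
    U_{delta,0}. That testing on this smaller class suffices is a Hahn-Banach statement; the
    projection in L^2 plays that part, and as its residual is already a square-integrable function,
    no description of the dual of L^{1,2} is needed.

    The energy sqrt(1 + q^2) has linear growth, so it is finite on near-minimisers, which need not
    lie in L^2; the price is that its convexity degenerates at infinity. It controls distances below
    a level only, and uniform integrability has to control the rest.

    Replacing a potential by a uniformly close one is legitimate although the gradients need not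
    converge in L^{oo,2}: where the kernel is at most k, uniform closeness makes the gradients
    close, and the flux has little L^{1,2} mass where the kernel is large. *)

Lemma measurable_funEFin d (X : measurableType d) (R : realType) (D : set X)
  (f : X -> R) : measurable_fun D f -> measurable_fun D (fun x => (f x)%:E).
Proof. by move=> mf; apply/measurable_EFinP. Qed.

Ltac meas_step := match goal with
  | |- measurable_fun _ (fun _ => ?c) => exact: measurable_cst
  | |- measurable_fun _ (fun x => x) => exact: measurable_id
  | |- measurable_fun _ (fun x => EFin (@?a x)) => apply: measurable_funEFin
  | |- measurable_fun _ (EFin \o _) => apply: measurable_funEFin
  | |- measurable_fun _ (fun x => (@?a x + - @?b x)%R) => apply: measurable_funB
  | |- measurable_fun _ (fun x => (@?a x + @?b x)%R) => apply: measurable_funD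
  | |- measurable_fun _ (fun x => (@?a x * @?b x)%R) => apply: measurable_funM
  | |- measurable_fun _ (fun x => (- @?a x)%R) => apply: measurable_funN
  | |- measurable_fun _ (fun x => (@?a x ^+ ?n)%R) => apply: measurable_funX
  | |- measurable_fun _ (fun x => (`|@?a x|)%R) =>
      apply: (measurableT_comp (@normr_measurable _ setT))
  | |- measurable_fun _ (fun x => (`|@?a x|)%E) =>
      apply: (measurableT_comp (@abse_measurable _ setT))
  | |- measurable_fun _ (fun x => (@?a x + @?b x)%E) => apply: emeasurable_funD
  | |- measurable_fun _ (fun x => (@?a x * @?b x)%E) => apply: emeasurable_funM
  | |- measurable_fun _ (fun x => \1_?D x) => apply: measurable_indic
  | |- measurable_fun _ (\1_?D) => apply: measurable_indic
  | H : measurable_fun _ _ |- _ => exact H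
  | H : measurable _ |- measurable _ => exact H
  | H : forall k, measurable_fun _ _ |- _ => exact: H
  | H : forall k l, measurable_fun _ _ |- _ => exact: H
  | |- measurable_fun _ _ => first
    [ apply: measurable_funEFin | apply: measurable_funB | apply: measurable_funD
    | apply: measurable_funM | apply: measurable_funX
    | apply: (measurableT_comp (@normr_measurable _ setT))
    | apply: (measurableT_comp (@abse_measurable _ setT)) ]
  end.
Ltac meas := repeat meas_step.

(** * Square-integrable functions *)

Section L2.
Context d (X : measurableType d) (R : realType).
Variable M : {measure set X -> \bar R}.
Implicit Types f g h : X -> R.

Definition sqn f : \bar R := (\int[M]_x ((f x) ^+ 2)%:E)%E.
Definition l2 f := measurable_fun setT f /\ (sqn f < +oo)%E.
(** Besides the L^2 inner product this will denote the pairing of an L^{1,2} flux with a gradient.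
    As the [fine] part of an integral it is meaningful only once integrability is known. *)
Definition ip f g : R := (\int[M]_x (f x * g x))%R.

Lemma sqn_ge0 f : (0 <= sqn f)%E.
Proof. by apply: integral_ge0 => x _; rewrite lee_fin sqr_ge0. Qed.

Lemma l2_integrableM f g : l2 f -> l2 g ->
  M.-integrable setT (EFin \o (fun x => f x * g x)).
Proof.
move=> [mf f2] [mg g2]; apply/integrableP; split.
  by apply: measurable_funEFin; exact: measurable_funM.
apply: (@le_lt_trans _ _ (sqn f + sqn g)%E); last exact: lte_add_pinfty.
rewrite -ge0_integralD//; last 4 first.
- by move=> x _; rewrite lee_fin sqr_ge0.
- by meas.
- by move=> x _; rewrite lee_fin sqr_ge0.
- by meas.
apply: ge0_le_integral => //.
- by apply: measurableT_comp => //; meas.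
- by meas.
- move=> x _ /=; rewrite lee_fin normrM -[X in _ <= X + _]real_normK ?num_real//.
  rewrite -[X in _ <= _ + X]real_normK ?num_real//.
  have := normr_ge0 (f x); have := normr_ge0 (g x); nra.
Qed.

Lemma ipE f : ip f f = fine (sqn f).
Proof. by rewrite /ip /sqn /Rintegral; under eq_integral do rewrite -expr2. Qed.

Lemma ipEFin f : l2 f -> (ip f f)%:E = sqn f.
Proof.
by move=> [_ f2]; rewrite ipE fineK// ge0_fin_numE// sqn_ge0.
Qed.

Lemma ipC f g : ip f g = ip g f.
Proof. by rewrite /ip; apply: eq_Rintegral => x _; rewrite mulrC. Qed.

Lemma ipDl f g h : l2 f -> l2 g -> l2 h ->
  ip (fun x => f x + g x) h = ip f h + ip g h.
Proof.
move=> lf lg lh; rewrite /ip -RintegralD//; try exact: l2_integrableM.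
by apply: eq_Rintegral => x _; rewrite mulrDl.
Qed.

Lemma ipZl a f h : l2 f -> l2 h -> ip (fun x => a * f x) h = a * ip f h.
Proof.
move=> lf lh; rewrite /ip -RintegralZl//; try exact: l2_integrableM.
by apply: eq_Rintegral => x _; rewrite mulrA.
Qed.

Lemma ip_ge0 f : 0 <= ip f f.
Proof. by rewrite ipE fine_ge0// sqn_ge0. Qed.

Lemma l2Z a f : l2 f -> l2 (fun x => a * f x).
Proof.
move=> [mf f2]; split; first by meas.
rewrite /sqn; under eq_integral do rewrite exprMn EFinM.
rewrite ge0_integralZl//; last 3 first.
- by meas.
- by move=> x _; rewrite lee_fin sqr_ge0.
- by rewrite lee_fin sqr_ge0.
by rewrite lte_mul_pinfty// ?lee_fin ?sqr_ge0.
Qed.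

Lemma l2D f g : l2 f -> l2 g -> l2 (fun x => f x + g x).
Proof.
move=> [mf f2] [mg g2]; split; first by meas.
apply: (@le_lt_trans _ _ ((2%:E * sqn f) + (2%:E * sqn g))%E); last first.
  by rewrite lte_add_pinfty// lte_mul_pinfty// lee_fin.
rewrite -!ge0_integralZl//; try by [meas|move=> x _; rewrite lee_fin sqr_ge0].
rewrite -ge0_integralD//; last 4 first.
- by move=> x _; rewrite -EFinM lee_fin mulr_ge0 ?sqr_ge0.
- by apply: emeasurable_funM; meas.
- by move=> x _; rewrite -EFinM lee_fin mulr_ge0 ?sqr_ge0.
- by apply: emeasurable_funM; meas.
apply: ge0_le_integral => //.
- by move=> x _; rewrite lee_fin sqr_ge0.
- by meas.
- by apply: emeasurable_funD; apply: emeasurable_funM; meas.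
- move=> x _; rewrite -EFinM -EFinM -EFinD lee_fin.
  have := sqr_ge0 (f x - g x); nra.
Qed.

Lemma l2N f : l2 f -> l2 (fun x => - f x).
Proof.
move=> lf; rewrite (_ : (fun x => - f x) = (fun x => -1 * f x)); first exact: l2Z.
by apply/funext => x; rewrite mulN1r.
Qed.

Lemma l2B f g : l2 f -> l2 g -> l2 (fun x => f x - g x).
Proof. by move=> lf lg; exact: (l2D lf (l2N lg)). Qed.

Lemma l20 : l2 (fun=> 0).
Proof.
split; first exact: measurable_cst.
by rewrite /sqn; under eq_integral do rewrite expr0n/=; rewrite integral0.
Qed.

Lemma ipNl f h : l2 f -> l2 h -> ip (fun x => - f x) h = - ip f h.
Proof.
move=> lf lh; rewrite -mulN1r -ipZl//; congr ip.
by apply/funext => x; rewrite mulN1r.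
Qed.

Lemma ipBl f g h : l2 f -> l2 g -> l2 h ->
  ip (fun x => f x - g x) h = ip f h - ip g h.
Proof. by move=> lf lg lh; rewrite ipDl// ?ipNl//; exact: l2N. Qed.

Lemma ipDr f g h : l2 f -> l2 g -> l2 h ->
  ip h (fun x => f x + g x) = ip h f + ip h g.
Proof. by move=> lf lg lh; rewrite ipC ipDl// !(ipC _ h). Qed.

Lemma ipBr f g h : l2 f -> l2 g -> l2 h ->
  ip h (fun x => f x - g x) = ip h f - ip h g.
Proof. by move=> lf lg lh; rewrite ipC ipBl// !(ipC _ h). Qed.

Lemma ipZr a f h : l2 f -> l2 h -> ip h (fun x => a * f x) = a * ip h f.
Proof. by move=> lf lh; rewrite ipC ipZl// ipC. Qed.

Lemma ip_sq_line a f g : l2 f -> l2 g ->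
  ip (fun x => f x + a * g x) (fun x => f x + a * g x) =
  ip f f + 2 * a * ip f g + a ^+ 2 * ip g g.
Proof.
move=> lf lg; have lag := l2Z a lg; have ls := l2D lf lag.
by rewrite ipDl// !ipDr// !ipZl// !ipZr// (ipC g f); ring.
Qed.

Lemma cauchy_schwarz_ip f g : l2 f -> l2 g -> ip f g ^+ 2 <= ip f f * ip g g.
Proof.
move=> lf lg.
have H a : 0 <= ip f f + 2 * a * ip f g + a ^+ 2 * ip g g.
  by rewrite -ip_sq_line// ip_ge0.
have [g0|g0] := eqVneq (ip g g) 0.
  rewrite g0 mulr0.
  suff -> : ip f g = 0 by rewrite expr0n.
  apply/eqP/negPn/negP => fg0.
  (* The quadratic is affine in [a] here, and this [a] gives it the value -1. *)
  have := H (- (ip f f + 1) / (2 * ip f g)); rewrite g0 mulr0 addr0.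
  have -> : 2 * (- (ip f f + 1) / (2 * ip f g)) * ip f g = - (ip f f + 1).
    by field.
  lra.
have gp : 0 < ip g g by rewrite lt_neqAle eq_sym g0 ip_ge0.
have := H (- ip f g / ip g g).
have -> : ip f f + 2 * (- ip f g / ip g g) * ip f g +
   (- ip f g / ip g g) ^+ 2 * ip g g = ip f f - ip f g ^+ 2 / ip g g by field.
by rewrite subr_ge0 ler_pdivrMr.
Qed.

Lemma ip_eq_ae f f' g : measurable_fun setT f -> measurable_fun setT f' ->
  measurable_fun setT g ->
  {ae M, forall x, f x = f' x} -> ip f g = ip f' g.
Proof.
move=> mf mf' mg E; rewrite /ip /Rintegral; congr fine.
apply: ae_eq_integral => //; try by meas.
by apply: filterS E => x /= -> _.
Qed.

(** Convergence is asked at every point, so the limits below are taken after multiplication by the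
    indicator of a set of full measure. *)
Lemma fatou_le (g : nat -> X -> R) (g' : X -> R) (c : \bar R) :
  (forall k, measurable_fun setT (g k)) -> (forall k x, 0 <= g k x) ->
  (forall x, g ^~ x @ \oo --> g' x) ->
  (\forall k \near \oo, \int[M]_x (g k x)%:E <= c)%E ->
  (\int[M]_x (g' x)%:E <= c)%E.
Proof.
move=> mg g0 gg' gc.
have -> : (\int[M]_x (g' x)%:E =
   \int[M]_x (limn_einf (fun k => (g k x)%:E)))%E.
  apply: eq_integral => x _; apply/esym.
  have H : (fun k => (g k x)%:E) @ \oo --> (g' x)%:E.
    by apply: cvg_comp (gg' x) _; exact: cvg_refl.
  by rewrite is_cvg_limn_einfE ?(cvg_lim _ H)//; apply/cvg_ex; eexists; exact: H.
apply: le_trans.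
  by apply: fatou => //; [move=> k; meas | move=> k x _; rewrite lee_fin].
rewrite limn_einf_lim.
apply: lime_le; first exact: is_cvg_einfs.
near=> k.
apply: ereal_inf_le.
exists (\int[M]_x (g k x)%:E)%E; first by exists k => //=.
by near: k.
Unshelve. all: by end_near. Qed.

Lemma ge0_integralZlR (c : R) (g : X -> R) : 0 <= c ->
  measurable_fun setT g -> (forall x, 0 <= g x) ->
  (\int[M]_x (c * g x)%:E = c%:E * \int[M]_x (g x)%:E)%E.
Proof.
move=> c0 mg g0; under eq_integral do rewrite EFinM.
by rewrite ge0_integralZl//; [meas|move=> x _; rewrite lee_fin].
Qed.

Lemma ge0_integralDR (g h : X -> R) :
  measurable_fun setT g -> (forall x, 0 <= g x) ->
  measurable_fun setT h -> (forall x, 0 <= h x) ->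
  (\int[M]_x (g x + h x)%:E = \int[M]_x (g x)%:E + \int[M]_x (h x)%:E)%E.
Proof.
move=> mg g0 mh h0; under eq_integral do rewrite EFinD.
by rewrite ge0_integralD//; try by [meas|move=> x _; rewrite lee_fin].
Qed.

Lemma ge0_le_integralR (g h : X -> R) :
  measurable_fun setT g -> measurable_fun setT h ->
  (forall x, 0 <= g x) -> (forall x, g x <= h x) ->
  (\int[M]_x (g x)%:E <= \int[M]_x (h x)%:E)%E.
Proof.
move=> mg mh g0 gh; apply: ge0_le_integral => //; try by meas.
- by move=> x _; rewrite lee_fin.
- by move=> x _; rewrite lee_fin.
Qed.

End L2.

(** * Pointwise limits of fast Cauchy sequences and completeness of L^2 *)

Section FastLimit.
Context d (X : measurableType d) (R : realType).
Variable M : {measure set X -> \bar R}.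

(** The sum of the [e k] has integral at most [C], hence is finite off a null set, and where it is
    finite the increments of [f] are summable. [Z] is given explicitly because its invariance under
    exchange of the variables is needed later to keep limits antisymmetric. *)
Lemma fast_limit (C : R) (f e : nat -> X -> R) :
  0 <= C ->
  (forall k, measurable_fun setT (f k)) -> (forall k, measurable_fun setT (e k)) ->
  (forall k x, 0 <= e k x) ->
  (forall k x, `|f k.+1 x - f k x| <= 1 / (2 ^ k.+1)%:R + e k x) ->
  (forall k, (\int[M]_x (e k x)%:E <= (C / (2 ^ k.+1)%:R)%:E)%E) ->
  let Z := [set x | (\sum_(0 <= k <oo) (e k x)%:E < +oo)%E] in
  [/\ measurable Z, M (~` Z) = 0%E & forall x, Z x -> cvgn (f ^~ x)].
Proof.
move=> C0 mf me e0 fe ie Z.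
have mE k : measurable_fun setT (fun x => (e k x)%:E) by meas.
have mS : measurable_fun setT (fun x => \sum_(0 <= k <oo) (e k x)%:E)%E.
  by apply: ge0_emeasurable_sum => // k x _ _; rewrite lee_fin.
have S0 x : (0 <= \sum_(0 <= k <oo) (e k x)%:E)%E.
  by apply: nneseries_ge0 => k _ _; rewrite lee_fin.
have mZ : measurable Z by rewrite -[Z]setTI; exact: emeasurable_fun_infty_o.
split => //.
- have iS : M.-integrable setT (fun x => \sum_(0 <= k <oo) (e k x)%:E)%E.
    apply/integrableP; split => //.
    under eq_integral do rewrite gee0_abs//.
    rewrite integral_nneseries//; last by move=> k x _; rewrite lee_fin.
    apply: (@le_lt_trans _ _ C%:E); last exact: ltry.
    apply: le_trans (epsilon_trick0 xpredT C0).
    apply: lee_nneseries => [k _ _|k _]; last exact: ie.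
    by apply: integral_ge0 => x _; rewrite lee_fin.
  have [N [mN N0 sub]] := integrable_ae measurableT iS.
  apply/eqP; rewrite eq_le measure_ge0 andbT -N0.
  apply: le_measure; rewrite ?inE//; first exact: measurableC.
  apply: subset_trans sub => x /= nZ H; apply: nZ.
  by rewrite /Z /= -ge0_fin_numE//; exact: H.
- move=> x Zx.
  have cd : cvgn (series (telescope (f ^~ x))).
    apply: normed_cvg.
    have ce : cvgn (series (fun k => 1 / (2 ^ k.+1)%:R + e k x : R)).
      have -> : (fun k => 1 / (2 ^ k.+1)%:R + e k x) =
                (fun k => 1 / (2 ^ k.+1)%:R) + (e ^~ x) by [].
      rewrite seriesD; apply: is_cvgD.
        have := @cvg_geometric_series_half R 1 0.
        rewrite (_ : (fun k => 1 / (2 ^ (k + 1))%:R) = (fun k => 1 / (2 ^ k.+1)%:R)).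
          by move=> H; exact: cvgP H.
        by apply/funext => k; rewrite addn1.
      exact: nnseries_is_cvg.
    apply: (series_le_cvg _ _ _ ce) => k /=; first exact: normr_ge0.
      by apply: addr_ge0 => //; rewrite divr_ge0.
    exact: fe.
  have -> : f ^~ x = (fun n => f 0%N x + series (telescope (f ^~ x)) n).
    by apply/funext => n; rewrite -eq_sum_telescope.
  by apply: is_cvgD => //; exact: is_cvg_cst.
Qed.

(** The limit of [f k * \1_Z] is taken at every point, so [g] vanishes wherever all the [f k] do;
    this keeps supports exact and not only exact up to a null set. *)
Lemma l2_complete (C : R) (f : nat -> X -> R) :
  0 <= C -> (forall k, l2 M (f k)) ->
  (forall k l, (k <= l)%N ->
     (sqn M (fun x => f l x - f k x)%R <= (C / (4 ^ k)%:R)%:E)%E) ->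
  exists Z g, [/\ measurable Z, M (~` Z) = 0%E,
    forall x, (fun k => f k x * \1_Z x) @ \oo --> g x, l2 M g &
    forall k, (sqn M (fun x => g x - f k x)%R <= (C / (4 ^ k)%:R)%:E)%E].
Proof.
move=> C0 lf fC.
have mf k : measurable_fun setT (f k) by have [] := lf k.
(* From t <= 1/c + c t^2 / 4 with c = 2^(k+1); the rate 4^-k of the hypothesis turns the second term
   into C / 2^(k+1) after integration. *)
pose e k x : R := (2 ^ k.+1)%:R / 4 * (f k.+1 x - f k x) ^+ 2.
have me k : measurable_fun setT (e k) by rewrite /e; meas.
have e0 k x : 0 <= e k x by rewrite /e mulr_ge0 ?sqr_ge0// divr_ge0.
have fe k x : `|f k.+1 x - f k x| <= 1 / (2 ^ k.+1)%:R + e k x.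
  rewrite /e -[in leRHS]real_normK ?num_real//.
  set t := `|_|; set c : R := (2 ^ k.+1)%:R.
  have c0 : 0 < c by rewrite ltr0n expn_gt0.
  rewrite -subr_ge0.
  have -> : 1 / c + c / 4 * t ^+ 2 - t = (c / 4) * (t - 2 / c) ^+ 2.
    by field; rewrite gt_eqF.
  by rewrite mulr_ge0 ?sqr_ge0// divr_ge0// ltW.
have ie k : (\int[M]_x (e k x)%:E <= (C / (2 ^ k.+1)%:R)%:E)%E.
  rewrite /e; under eq_integral do rewrite EFinM.
  rewrite ge0_integralZl//; last 2 first.
  - by meas.
  - by move=> x _; rewrite lee_fin sqr_ge0.
  apply: (@le_trans _ _ (((2 ^ k.+1)%:R / 4)%:E * (C / (4 ^ k)%:R)%:E))%E.
    by rewrite lee_wpmul2l ?lee_fin ?divr_ge0//; exact: fC.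
  rewrite -EFinM lee_fin le_eqVlt; apply/orP; left; apply/eqP.
  rewrite (_ : 4 = 2 * 2)%N// expnMn expnS !natrM.
  by field; rewrite !pnatr_eq0 expn_eq0.
have [mZ Z0 cZ] := fast_limit C0 mf me e0 fe ie.
set Z := [set x | _] in mZ Z0 cZ.
pose g x := limn (fun k => f k x * \1_Z x).
have fg x : (fun k => f k x * \1_Z x) @ \oo --> g x.
  suff : cvgn (fun k => f k x * \1_Z x) by [].
  have [Zx|nZx] := pselect (Z x).
    by apply: is_cvgM; [exact: cZ | exact: is_cvg_cst].
  rewrite (_ : (fun _ => _) = fun=> 0); first exact: is_cvg_cst.
  by apply/funext => k; rewrite indicE memNset// mulr0.
have mg : measurable_fun setT g.
  apply: (@measurable_fun_cvg _ _ _ _ (fun k x => f k x * \1_Z x)) => //.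
  by move=> k; meas.
have gC k : (sqn M (fun x => g x - f k x)%R <= (C / (4 ^ k)%:R)%:E)%E.
  have -> : sqn M (fun x => g x - f k x)%R =
      (\int[M]_x (((g x - f k x) * \1_Z x) ^+ 2)%:E)%E.
    apply: ge0_ae_eq_integral => //; try by meas.
    - by move=> x _; rewrite lee_fin sqr_ge0.
    - by move=> x _; rewrite lee_fin sqr_ge0.
    - exists (~` Z); split => //; first exact: measurableC.
      move=> x /= H Zx; apply: H => _.
      by rewrite indicE mem_set// mulr1.
  apply: (@fatou_le _ _ _ _ (fun l x => ((f l x - f k x) * \1_Z x) ^+ 2)).
  - by move=> l; meas.
  - by move=> l x; rewrite sqr_ge0.
  - move=> x; rewrite -[g x]mul1r.
    have [Zx|nZx] := pselect (Z x).
      have := fg x; rewrite indicE mem_set// mul1r.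
      under eq_fun do rewrite mulr1.
      move=> H; rewrite mulr1.
      under eq_fun do rewrite mulr1.
      rewrite expr2; under eq_fun do rewrite expr2.
      have H' : (fun l => f l x - f k x) @ \oo --> g x - f k x.
        by apply: cvgB => //; exact: cvg_cst.
      exact: cvgM.
    rewrite indicE memNset// !mulr0 expr0n/=.
    under eq_fun do rewrite mulr0 expr0n/=.
    exact: cvg_cst.
  - exists k => // l /= kl.
    apply: le_trans (fC k l kl); apply: ge0_le_integral => //; try by meas.
    + by move=> x _; rewrite lee_fin sqr_ge0.
    + move=> x _; rewrite lee_fin indicE; case: (_ \in _) => /=.
        by rewrite mulr1.
      by rewrite mulr0 expr0n/= sqr_ge0.
exists Z, g; split => //.
have -> : g = (fun x => (g x - f 0%N x) + f 0%N x).
  by apply/funext => x; rewrite subrK.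
apply: l2D => //; split; first by meas.
by apply: le_lt_trans (gC 0%N) _; exact: ltry.
Qed.

End FastLimit.

Lemma le0_half (R : realType) (p K : R) :
  (forall k : nat, p <= K / (2 ^ k)%:R) -> p <= 0.
Proof.
move=> H; rewrite leNgt; apply/negP => p0.
have K0 : 0 < K by have := H 0%N; rewrite expn0 divr1; lra.
have := archi_boundP (ltW (divr_gt0 K0 p0)).
set k := Num.bound _ => Kk.
have := H k; apply/negP; rewrite -ltNge ltr_pdivrMr ?ltr0n ?expn_gt0//.
rewrite mulrC -ltr_pdivrMr//; apply: lt_le_trans Kk _.
by rewrite ler_nat ltnW// ltn_expl.
Qed.

(** * Projection onto convex subsets of L^2 *)

Section Projection.
Context d (X : measurableType d) (R : realType).
Variable M : {measure set X -> \bar R}.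

Lemma ip_sqB a f g : l2 M f -> l2 M g ->
  ip M (fun x => f x - a * g x) (fun x => f x - a * g x) =
  ip M f f - 2 * a * ip M f g + a ^+ 2 * ip M g g.
Proof.
move=> lf lg; have := @ip_sq_line _ _ _ M (- a) f g lf lg.
under eq_fun do rewrite mulNr; move=> ->; ring.
Qed.

Lemma ip_addadd f g h : l2 M f -> l2 M g -> l2 M h ->
  ip M (fun z => f z + 1 * h z) (fun z => g z + 1 * h z) =
  ip M f g + ip M f h + ip M h g + ip M h h.
Proof.
move=> lf lg lh; have lh1 := l2Z 1 lh; have lgh := l2D lg lh1.
rewrite ipDl// !ipDr// !ipZl// !ipZr//; ring.
Qed.

Lemma ip_young (e : R) f g : 0 < e -> l2 M f -> l2 M g ->
  - (2 * ip M f g) <= e^-1 * ip M f f + e * ip M g g.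
Proof.
move=> e0 lf lg.
have := ip_ge0 M (fun x => f x + e * g x); rewrite ip_sq_line// => H.
rewrite -(ler_pM2l e0) mulrDr mulrA mulfV ?gt_eqF// mul1r; lra.
Qed.

(** [C] need not be closed, so the nearest point [s] may lie outside it: the minimising sequence and
    its rate are returned with [s], and each application identifies the limit by its own means. *)
Lemma projection (C : set (X -> R)) (x : X -> R) :
  l2 M x -> (forall s, C s -> l2 M s) -> C !=set0 ->
  (forall (a : R) s t, 0 <= a <= 1 -> C s -> C t ->
     C (fun z => (1 - a) * s z + a * t z)) ->
  exists (s_ : nat -> X -> R) (Z : set X) (s : X -> R),
    [/\ (forall k, C (s_ k)), measurable Z, M (~` Z) = 0%E & l2 M s] /\
    [/\ forall z, (fun k => s_ k z * \1_Z z) @ \oo --> s z,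
     forall k l, (k <= l)%N ->
       ip M (fun z => s_ l z - s_ k z) (fun z => s_ l z - s_ k z)
         <= 4 / (4 ^ k)%:R,
     forall k, ip M (fun z => s z - s_ k z) (fun z => s z - s_ k z)
         <= 4 / (4 ^ k)%:R &
     forall t, C t -> ip M (fun z => x z - s z) (fun z => t z - s z) <= 0].
Proof.
move=> lx lC [s0 Cs0] cC.
pose nx s := ip M (fun z => x z - s z) (fun z => x z - s z).
pose E := nx @` C.
have hE : has_inf E.
  split; first by exists (nx s0), s0.
  by exists 0 => _ [s _ <-]; exact: ip_ge0.
have dle s : C s -> inf E <= nx s.
  by move=> Cs; apply: ge_inf; [exact: hE.2|exists s].
have ex (k : nat) : exists s, C s /\ nx s <= inf E + 1 / (4 ^ k)%:R.
  have e0 : 0 < 1 / (4 ^ k)%:R :> R by rewrite divr_gt0// ltr0n expn_gt0.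
  have [_ [s Cs <-] H] := inf_adherent e0 hE.
  by exists s; split => //; exact: ltW.
have [s_ Hs] := choice ex.
have Cs k := (Hs k).1.
have ls k := lC _ (Cs k).
have cauchy k l : (k <= l)%N ->
    ip M (fun z => s_ l z - s_ k z) (fun z => s_ l z - s_ k z)
         <= 4 / (4 ^ k)%:R.
  move=> kl.
  have la := l2B lx (ls k); have lb := l2B lx (ls l).
  have H1 := @ip_sq_line _ _ _ M 1 _ _ la lb.
  have H2 := @ip_sq_line _ _ _ M (-1) _ _ la lb.
  have -> : (fun z => s_ l z - s_ k z) =
      (fun z => (x z - s_ k z) + -1 * (x z - s_ l z)).
    by apply/funext => z; ring.
  (* Parallelogram law: the midpoint of [s_ k] and [s_ l] belongs to [C], so its squared distance to
     [x] is at least the infimum, which the two endpoints exceed by at most 4^-k. *)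
  have := dle _ (cC (1/2) _ _ _ (Cs k) (Cs l)).
  rewrite /nx (_ : (fun z => x z - _) =
      (fun z => 1/2 * ((x z - s_ k z) + 1 * (x z - s_ l z)))); last first.
    by apply/funext => z; field.
  have lab := l2D la (l2Z 1 lb).
  have lab2 := l2Z (1/2) lab.
  rewrite ipZl// ipZr// H1 H2.
  move=> /(_ _)/wrap[]; first by apply/andP; split; lra.
  have := (Hs k).2; have := (Hs l).2; rewrite /nx.
  have : 1 / (4 ^ l)%:R <= 1 / (4 ^ k)%:R :> R.
    by rewrite !div1r lef_pV2 ?posrE ?ltr0n ?expn_gt0// ler_nat leq_pexp2l.
  rewrite -[4 / _]mulr1 mulrAC -mulrA; lra.
have cauchyE k l : (k <= l)%N ->
    (sqn M (fun z => s_ l z - s_ k z)%R <= (4 / (4 ^ k)%:R)%:E)%E.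
  by move=> kl; rewrite -ipEFin ?lee_fin; [exact: cauchy|exact: l2B].
have [Z [s [mZ Z0 sZ l_s sC]]] := l2_complete (ler0n _ 4) ls cauchyE.
have sC' k : ip M (fun z => s z - s_ k z) (fun z => s z - s_ k z)
         <= 4 / (4 ^ k)%:R.
  by have := sC k; rewrite -ipEFin ?lee_fin//; exact: l2B.
exists s_, Z, s; split; first by split.
split=> // t Ct.
have ly := l2B lx l_s; have lv := l2B (lC _ Ct) l_s.
set y := fun z => x z - s z; set v := fun z => t z - s z.
(* Compare [s_ k] with its displacement by e = 2^-k towards [t]. The excess over the infimum and |s
   - s_k|^2 are both of order e^2, so division by e leaves a bound of order e; 17 = 1 + 8 + 4 + 4
   collects the constants. *)
apply: (@le0_half _ _ ((17 + 3 * ip M v v + ip M y y) / 2)) => k.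
set e : R := 1 / (2 ^ k)%:R.
have e0 : 0 < e by rewrite /e divr_gt0// ltr0n expn_gt0.
have e1 : e <= 1.
  by rewrite /e div1r invf_le1 ?ltr0n ?expn_gt0// ler1n expn_gt0.
have e2 : 1 / (4 ^ k)%:R = e ^+ 2.
  by rewrite /e (_ : 4 = 2 * 2)%N// expnMn natrM; field; rewrite pnatr_eq0 expn_eq0.
have lr := l2B l_s (ls k).
pose r z := s z - s_ k z.
have rr : ip M r r <= 4 * e ^+ 2 by rewrite -e2 mulrA mulr1; exact: sC'.
have := dle _ (cC e _ _ _ (Cs k) Ct).
rewrite /nx (_ : (fun z => x z - _) =
   (fun z => (y z + 1 * r z) - e * (v z + 1 * r z))); last first.
  by apply/funext => z; rewrite /y /r /v; ring.
have lyr := l2D ly (l2Z 1 lr); have lvr := l2D lv (l2Z 1 lr).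
rewrite ip_sqB//.
move=> /(_ _)/wrap[]; first by rewrite ltW.
have := (Hs k).2; rewrite e2 /nx (_ : (fun z => x z - s_ k z) =
   (fun z => y z + 1 * r z)); last first.
  by apply/funext => z; rewrite /y /r; ring.
rewrite [ip M (fun z => v z + _) _]ip_sq_line//.
have -> : ip M (fun z => y z + 1 * r z) (fun z => v z + 1 * r z) =
  ip M y v + ip M y r + ip M r v + ip M r r.
  exact: ip_addadd.
set A := ip M (fun z => y z + _) _ => HA HB.
have H1 := ip_young e0 lr lv; have H2 := ip_young e0 lr ly.
have H3 := ip_young (ltr01) lr lv.
have rr' : e^-1 * ip M r r <= 4 * e.
  by rewrite ler_pdivrMl//; apply: le_trans rr _; rewrite expr2; lra.
rewrite -/r -/v -/y in H1 H2 H3.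
rewrite (ipC M v r) in HB; rewrite (ipC M y r) in HB.
have r0 := ip_ge0 M r; have v0 := ip_ge0 M v; have y0 := ip_ge0 M y.
have K : 2 * ip M y v <= e * (17 + 3 * ip M v v + ip M y y).
  have Q : 2 * (ip M y v + ip M r y + ip M r v + ip M r r) <=
      e + e * (ip M v v + 2 * 1 * ip M r v + 1 ^+ 2 * ip M r r).
    rewrite -(ler_pM2l e0); lra.
  have T : ip M v v + 2 * 1 * ip M r v + 1 ^+ 2 * ip M r r <= 2 * ip M v v + 8.
    have := ip_ge0 M (fun z => v z + -1 * r z).
    rewrite ip_sq_line// (ipC M v r).
    have : e ^+ 2 <= 1 by rewrite expr_le1// ltW.
    lra.
  have T' : e * (ip M v v + 2 * 1 * ip M r v + 1 ^+ 2 * ip M r r) <=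
      e * (2 * ip M v v + 8) by rewrite ler_wpM2l// ltW.
  lra.
have -> : (17 + 3 * ip M v v + ip M y y) / 2 / (2 ^ k)%:R =
   e * (17 + 3 * ip M v v + ip M y y) / 2 by rewrite /e; field; rewrite pnatr_eq0 expn_eq0.
lra.
Qed.

End Projection.

(** * Mixed norms *)

Section Mixed.
Context d (T : measurableType d) (R : realType).
Variable mu : {sigma_finite_measure set T -> \bar R}.
Implicit Types p q f g : T * T -> R.

Lemma Lnorm2E (f : T -> R) :
  (Lnorm mu 2%:E (EFin \o f) = (\int[mu]_x ((f x) ^+ 2)%:E) `^ 2^-1)%E.
Proof.
rewrite unlock; congr (_ `^ _)%E; apply: eq_integral => x _ /=.
by rewrite powR_mulrn// real_normK// num_real.
Qed.

Lemma hoelder22 (f g : T -> R) : measurable_fun setT f -> measurable_fun setT g ->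
  (\int[mu]_x (`|f x * g x|)%:E <=
   (\int[mu]_x ((f x) ^+ 2)%:E) `^ 2^-1 * (\int[mu]_x ((g x) ^+ 2)%:E) `^ 2^-1)%E.
Proof.
move=> mf mg; rewrite -!Lnorm2E.
have := @hoelder _ _ _ mu f g 2 2 mf mg; rewrite Lnorm1; apply => //.
by field.
Qed.

(* [rown q x] is the L^2 norm of the row [q (x, .)] and [N12 q] the L^{1,2} norm. *)
Definition rowsq q (x : T) : \bar R := (\int[mu]_y ((q (x, y)) ^+ 2)%:E)%E.
Definition rown q (x : T) : \bar R := (rowsq q x `^ 2^-1)%E.
Definition N12 q : \bar R := (\int[mu]_x rown q x)%E.

Lemma rowsq_ge0 q x : (0 <= rowsq q x)%E.
Proof. by apply: integral_ge0 => y _; rewrite lee_fin sqr_ge0. Qed.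

Lemma rown_ge0 q x : (0 <= rown q x)%E.
Proof. exact: poweR_ge0. Qed.

Lemma N12_ge0 q : (0 <= N12 q)%E.
Proof. by apply: integral_ge0 => x _; exact: rown_ge0. Qed.

Lemma measurable_row q x : measurable_fun setT q ->
  measurable_fun setT (fun y => q (x, y)).
Proof. by move=> mq; apply: (measurableT_comp mq); exact: pair1_measurable. Qed.

Lemma measurable_swap_fun q : measurable_fun setT q ->
  measurable_fun setT (fun z => q (z.2, z.1)).
Proof. by move=> mq; apply: (measurableT_comp mq); exact: measurable_swap. Qed.

Lemma measurable_rowsq q : measurable_fun setT q -> measurable_fun setT (rowsq q).
Proof.
move=> mq.
apply: (measurable_fun_fubini_tonelli_F (fun z => ((q z) ^+ 2)%:E)).
  by meas.
by move=> z; rewrite lee_fin sqr_ge0.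
Qed.

Lemma measurable_rown q : measurable_fun setT q -> measurable_fun setT (rown q).
Proof.
by move=> mq; apply: (measurableT_comp (measurable_poweR _)); exact: measurable_rowsq.
Qed.

Lemma sqn_rowsq q : measurable_fun setT q ->
  (sqn (mu \x mu) q = \int[mu]_x rowsq q x)%E.
Proof.
move=> mq; rewrite /sqn fubini_tonelli1//; first by meas.
by move=> z; rewrite lee_fin sqr_ge0.
Qed.

Lemma rown_le p q x : measurable_fun setT p -> measurable_fun setT q ->
  (forall y, `|p (x, y)| <= `|q (x, y)|) -> (rown p x <= rown q x)%E.
Proof.
move=> mp mq H; apply: gt0_ler_poweR => //; rewrite ?in_itv/= ?rowsq_ge0 ?leey//.
have mpx := @measurable_row p x mp; have mqx := @measurable_row q x mq.
apply: ge0_le_integral => //; try by meas.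
  by move=> y _; rewrite lee_fin sqr_ge0.
move=> y _; rewrite lee_fin -[leLHS]real_normK ?num_real//.
by rewrite -[leRHS]real_normK ?num_real// ler_sqr ?nnegrE.
Qed.

Lemma N12_le p q : measurable_fun setT p -> measurable_fun setT q ->
  (forall z, `|p z| <= `|q z|) -> (N12 p <= N12 q)%E.
Proof.
move=> mp mq H; apply: ge0_le_integral => //; try exact: measurable_rown.
  by move=> x _; exact: rown_ge0.
by move=> x _; apply: rown_le.
Qed.

Lemma rownD p q x : measurable_fun setT p -> measurable_fun setT q ->
  (rown (fun z => p z + q z)%R x <= rown p x + rown q x)%E.
Proof.
move=> mp mq; rewrite /rown /rowsq -!(Lnorm2E (fun y => _ (x, y))).
rewrite -(Lnorm2E (fun y => p (x, y) + q (x, y))).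
apply: minkowski_EFin; [exact: measurable_row|exact: measurable_row|].
by rewrite ler1n.
Qed.

Lemma N12D p q : measurable_fun setT p -> measurable_fun setT q ->
  (N12 (fun z => p z + q z)%R <= N12 p + N12 q)%E.
Proof.
move=> mp mq; rewrite /N12 -ge0_integralD//; last 4 first.
- by move=> x _; exact: rown_ge0.
- exact: measurable_rown.
- by move=> x _; exact: rown_ge0.
- exact: measurable_rown.
apply: ge0_le_integral => //.
- by move=> x _; exact: rown_ge0.
- by apply: measurable_rown; meas.
- by apply: emeasurable_funD; exact: measurable_rown.
- by move=> x _; exact: rownD.
Qed.

Lemma rownZ a q x : measurable_fun setT q ->
  (rown (fun z => a * q z)%R x = (`|a|)%:E * rown q x)%E.
Proof.
move=> mq; have mqx := @measurable_row q x mq.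
rewrite /rown /rowsq; under eq_integral do rewrite exprMn EFinM.
rewrite ge0_integralZl//; last 3 first.
- by meas.
- by move=> y _; rewrite lee_fin sqr_ge0.
- by rewrite lee_fin sqr_ge0.
rewrite poweRM ?lee_fin ?sqr_ge0 ?rowsq_ge0//; congr (_ * _)%E.
rewrite poweR_EFin powR12_sqrt ?sqr_ge0// sqrtr_sqr//.
Qed.

Lemma N12Z a q : measurable_fun setT q ->
  (N12 (fun z => a * q z)%R = (`|a|)%:E * N12 q)%E.
Proof.
move=> mq; rewrite /N12 -ge0_integralZl//; last 2 first.
- exact: measurable_rown.
- by move=> x _; exact: rown_ge0.
by apply: eq_integral => x _; rewrite rownZ.
Qed.

Lemma N12N q : N12 (fun z => - q z) = N12 q.
Proof.
apply: eq_integral => x _; congr (_ `^ _)%E; apply: eq_integral => y _.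
by rewrite sqrrN.
Qed.

Lemma pair_row_le q f x : measurable_fun setT q -> measurable_fun setT f ->
  (\int[mu]_y (`|q (x, y) * f (x, y)|)%:E <= rown q x * rown f x)%E.
Proof.
by move=> mq mf; apply: hoelder22; exact: measurable_row.
Qed.

(** Duality of L^{1,2} and L^{oo,2}: Cauchy-Schwarz in each row, then the row bound comes out of the
    outer integral. *)
Lemma pair_le (C : R) q f : 0 <= C -> measurable_fun setT q ->
  measurable_fun setT f ->
  {ae mu, forall x, rown f x <= C%:E}%E ->
  (\int[mu \x mu]_z (`|q z * f z|)%:E <= C%:E * N12 q)%E.
Proof.
move=> C0 mq mf fC; rewrite fubini_tonelli1//; last by meas.
rewrite /N12 -ge0_integralZl//; last 2 first.
- exact: measurable_rown.
- by move=> x _; exact: rown_ge0.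
apply: ae_ge0_le_integral => //.
- by move=> x _; apply: integral_ge0.
- by apply: (measurable_fun_fubini_tonelli_F (fun z => (`|q z * f z|)%:E)) => //; meas.
- by move=> x _; rewrite mule_ge0 ?lee_fin ?rown_ge0.
- by apply: emeasurable_funM => //; exact: measurable_rown.
apply: filterS fC => x fx _; apply: le_trans (pair_row_le _ mq mf) _.
by rewrite muleC; apply: lee_wpmul2r => //; exact: rown_ge0.
Qed.

Lemma rown_young (t : R) q x : 0 < t ->
  (rown q x <= (t / 2)%:E + (1 / (2 * t))%:E * rowsq q x)%E.
Proof.
move=> t0; rewrite /rown; have := rowsq_ge0 q x.
case: (rowsq q x) => [r| |]//=.
  rewrite !lee_fin => r0; rewrite powR12_sqrt//.
  set s := Num.sqrt r; have s2 : s ^+ 2 = r by rewrite sqr_sqrtr.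
  rewrite -s2 -subr_ge0.
  have -> : t / 2 + 1 / (2 * t) * s ^+ 2 - s = (t - s) ^+ 2 / (2 * t).
    by field; rewrite gt_eqF.
  by rewrite divr_ge0 ?sqr_ge0// mulr_ge0// ltW.
move=> _; rewrite gt0_muley ?lte_fin ?divr_gt0//; last by rewrite mulr_gt0.
by rewrite addey// leey.
Qed.

Lemma rown0 q x : (forall y, q (x, y) = 0) -> rown q x = 0%E.
Proof.
move=> q0; rewrite /rown /rowsq integral0_eq ?poweR0r// ?invr_neq0//.
by move=> y _; rewrite q0 expr0n.
Qed.

(** Compares L^{1,2} with L^2 on a set of finite measure. Young's inequality with a free [t], rather
    than Cauchy-Schwarz, keeps the bound linear in the squared L^2 norm, infinite values
    included. *)
Lemma N12_young (t : R) (D : set T) q : 0 < t -> measurable D ->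
  measurable_fun setT q ->
  (forall x y, ~ D x -> q (x, y) = 0) ->
  (N12 q <= (t / 2)%:E * mu D + (1 / (2 * t))%:E * sqn (mu \x mu) q)%E.
Proof.
move=> t0 mD mq q0; rewrite sqn_rowsq//.
have c0 : 0 <= 1 / (2 * t) by rewrite divr_ge0// mulr_ge0// ltW.
have t20 : 0 <= t / 2 by rewrite divr_ge0// ltW.
rewrite (_ : mu D = \int[mu]_x (\1_D x)%:E)%E; last by rewrite integral_indic// setIT.
rewrite -!ge0_integralZl//; try by [meas|exact: measurable_rowsq|
  move=> x _; rewrite ?lee_fin ?rowsq_ge0].
rewrite -ge0_integralD//; last 4 first.
- by move=> x _; rewrite mule_ge0// lee_fin.
- by apply: emeasurable_funM => //; meas.
- by move=> x _; rewrite mule_ge0// ?lee_fin ?rowsq_ge0.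
- by apply: emeasurable_funM => //; exact: measurable_rowsq.
apply: ge0_le_integral => //.
- by move=> x _; exact: rown_ge0.
- exact: measurable_rown.
- apply: emeasurable_funD; apply: emeasurable_funM => //; first by meas.
  exact: measurable_rowsq.
- move=> x _; have [Dx|nDx] := pselect (D x).
    by rewrite indicE mem_set// mule1; exact: rown_young.
  rewrite rown0; last by move=> y; exact: q0.
  by rewrite adde_ge0// mule_ge0 ?lee_fin ?rowsq_ge0.
Qed.

End Mixed.

Section L2ae.
Context d (X : measurableType d) (R : realType).
Variable M : {measure set X -> \bar R}.

Lemma sqn0_ae (f : X -> R) :
  measurable_fun setT f -> sqn M f = 0%E -> {ae M, forall x, f x = 0}.
Proof.
move=> mf f0.
have mf2 : measurable_fun setT (fun x => ((f x) ^+ 2)%:E) by meas.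
have := (ae_eq_integral_abs M measurableT mf2).1.
rewrite /sqn in f0.
under [X in X = _ -> _]eq_integral do rewrite gee0_abs ?lee_fin ?sqr_ge0//.
move=> /(_ f0); apply: filterS => x /(_ I) /eqP; rewrite eqe sqrf_eq0.
by move/eqP.
Qed.

Lemma l2_ae (f g : X -> R) :
  measurable_fun setT g -> l2 M f -> {ae M, forall x, f x = g x} -> l2 M g.
Proof.
move=> mg [mf f2] fg; split => //; rewrite /sqn -(@ge0_ae_eq_integral _ _ _ _ _ (fun x => ((f x) ^+ 2)%:E))//.
- by meas.
- by meas.
- by move=> x _; rewrite lee_fin sqr_ge0.
- by move=> x _; rewrite lee_fin sqr_ge0.
- by apply: filterS fg => x /= ->.
Qed.

End L2ae.

(** * Nonlocal gradients and divergence-free fluxes *)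

Section Gradient.
Context d (T : measurableType d) (R : realType).
Variable mu : {sigma_finite_measure set T -> \bar R}.
Local Notation pi := (mu \x mu)%E.

Lemma ae_prod (Z : set T) : measurable Z -> mu (~` Z) = 0%E ->
  {ae pi, forall z, Z z.1 /\ Z z.2}.
Proof.
move=> mZ Z0; exists ((~` Z `*` setT) `|` (setT `*` ~` Z)); split.
- by apply: measurableU; apply: measurableX => //; exact: measurableC.
- apply/eqP; rewrite eq_le measure_ge0 andbT.
  have mZc := measurableC mZ.
  have E1 : pi (~` Z `*` setT) = 0%E.
    apply: (eq_trans (product_measure1E mu mu mZc measurableT)).
    transitivity (0 * mu setT)%E; last exact: mul0e.
    by congr (_ * _)%E; exact: Z0.
  have E2 : pi (setT `*` ~` Z) = 0%E.
    apply: (eq_trans (product_measure1E mu mu measurableT mZc)).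
    transitivity (mu setT * 0)%E; last exact: mule0.
    by congr (_ * _)%E; exact: Z0.
  apply: le_trans.
    by apply: measureU2; apply: measurableX.
  by rewrite [X in (X + _)%E]E1 [X in (_ + X)%E]E2 adde0.
- move=> z /=; have [|] := pselect (Z z.1); last by left.
  have [|] := pselect (Z z.2); last by right.
  tauto.
Qed.

Variables (O D : set T) (K : T * T -> R).
Hypothesis mK : measurable_fun setT K.
Hypothesis OD : O `<=` D.
Hypothesis KC : forall x y, K (x, y) = K (y, x).
Hypothesis K0 : forall x y, O x -> ~ D y -> K (x, y) = 0.
Variable P : R.
Hypothesis P0 : 0 <= P.

Definition grad (u : T -> R) (z : T * T) : R := (u z.1 - u z.2) * K z.
(* The space U_{delta,0}, its elements being extended by zero off [O]. *)
Definition inU (u : T -> R) :=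
  [/\ l2 mu u, (forall x, ~ O x -> u x = 0) & l2 pi (grad u)].
Definition supp (q : T * T -> R) := forall x y, ~ (D x /\ D y) -> q (x, y) = 0.

Hypothesis poincare : forall u, inU u ->
  (sqn mu u <= P%:E * sqn pi (grad u))%E.

Lemma measurable_grad u : measurable_fun setT u -> measurable_fun setT (grad u).
Proof.
move=> mu_; apply: measurable_funM => //; apply: measurable_funB.
  exact: (measurableT_comp mu_ measurable_fst).
exact: (measurableT_comp mu_ measurable_snd).
Qed.

Lemma gradD a b u v : grad (fun x => a * u x + b * v x) =
  (fun z => a * grad u z + b * grad v z).
Proof. by apply/funext => z; rewrite /grad; ring. Qed.

Lemma gradB u v : grad (fun x => u x - v x) = (fun z => grad u z - grad v z).
Proof. by apply/funext => z; rewrite /grad; ring. Qed.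

Lemma inU_lin a b u v : inU u -> inU v -> inU (fun x => a * u x + b * v x).
Proof.
move=> [lu u0 gu] [lv v0 gv]; split.
- by apply: l2D; exact: l2Z.
- by move=> x nO; rewrite u0// v0// !mulr0 addr0.
- by rewrite gradD; apply: l2D; exact: l2Z.
Qed.

Lemma inUB u v : inU u -> inU v -> inU (fun x => u x - v x).
Proof.
move=> lu lv; rewrite (_ : (fun _ => _) = (fun x => 1 * u x + (-1) * v x)).
  exact: inU_lin.
by apply/funext => x; ring.
Qed.

Lemma inU0 : inU (fun=> 0).
Proof.
split => //; first exact: l20.
rewrite (_ : grad _ = fun=> 0); first exact: l20.
by apply/funext => z; rewrite /grad subrr mul0r.
Qed.

Lemma grad_supp u : inU u -> supp (grad u).
Proof.
move=> [_ u0 _] x y nD; rewrite /grad/=.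
have [Ox|nOx] := pselect (O x).
  have nDy : ~ D y by move=> Dy; apply: nD; split => //; exact: OD.
  by rewrite K0// mulr0.
have [Oy|nOy] := pselect (O y).
  have nDx : ~ D x by move=> Dx; apply: nD; split => //; exact: OD.
  by rewrite KC K0// mulr0.
by rewrite !u0// subrr mul0r.
Qed.

(** Closedness of the range of the gradient: by Poincare the potentials are Cauchy as soon as their
    gradients are, so they have a limit, whose gradient Fatou's lemma identifies with [psi]. *)
Lemma grad_closed (C : R) (u_ : nat -> T -> R) (psi : T * T -> R) : 0 <= C ->
  (forall k, inU (u_ k)) -> l2 pi psi ->
  (forall k l, (k <= l)%N ->
     ip pi (fun z => grad (u_ l) z - grad (u_ k) z)
           (fun z => grad (u_ l) z - grad (u_ k) z) <= C / (4 ^ k)%:R) ->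
  (forall k, ip pi (fun z => psi z - grad (u_ k) z)
                   (fun z => psi z - grad (u_ k) z) <= C / (4 ^ k)%:R) ->
  exists u, [/\ inU u, {ae pi, forall z, grad u z = psi z} &
    forall k, (sqn mu (fun x => u x - u_ k x)%R <= (P * C / (4 ^ k)%:R)%:E)%E].
Proof.
move=> C0 Uu lpsi gC pC.
have lu k : l2 mu (u_ k) by have [] := Uu k.
have lg k : l2 pi (grad (u_ k)) by have [] := Uu k.
have mg k : measurable_fun setT (grad (u_ k)) by have [] := lg k.
have mpsi : measurable_fun setT psi by have [] := lpsi.
have uC k l : (k <= l)%N ->
    (sqn mu (fun x => u_ l x - u_ k x)%R <= (P * C / (4 ^ k)%:R)%:E)%E.
  move=> kl; apply: le_trans (poincare (inUB (Uu l) (Uu k))) _.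
  rewrite gradB -mulrA EFinM; apply: lee_wpmul2l; first by rewrite lee_fin.
  by rewrite -ipEFin ?lee_fin; [exact: gC|exact: l2B].
have [Z [u [mZ Z0 uZ lu' uC']]] := l2_complete (mulr_ge0 P0 C0) lu uC.
have mu' : measurable_fun setT u by have [] := lu'.
have u0 x : ~ O x -> u x = 0.
  move=> nO; apply/esym; have := uZ x.
  rewrite (_ : (fun _ => _) = fun=> 0); last first.
    by apply/funext => k; have [_ ->//] := Uu k; rewrite mul0r.
  by move=> H; apply: (cvg_unique _ _ H) => //; exact: cvg_cst.
have mgu := measurable_grad mu'.
(* These converge everywhere. Pairs with a coordinate outside [Z] form a null set of the product, so
   the gradients of [uz k] and [u_ k] agree almost everywhere. *)
pose uz k x := u_ k x * \1_Z x.
have muz k : measurable_fun setT (uz k) by rewrite /uz; have [? _] := lu k; meas.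
have mguz k := measurable_grad (muz k).
have E0 (e : R) : 0 < e -> (sqn pi (fun z => psi z - grad u z)%R <= e%:E)%E.
  move=> e0.
  apply: (@fatou_le _ _ _ _ (fun k z => (psi z - grad (uz k) z) ^+ 2)).
  - by move=> k; meas.
  - by move=> k z; rewrite sqr_ge0.
  - move=> z; rewrite expr2; under eq_fun do rewrite expr2.
    suff H : (fun k => psi z - grad (uz k) z) @ \oo --> psi z - grad u z.
      exact: cvgM.
    apply: cvgB; first exact: cvg_cst.
    apply: cvgM; last exact: cvg_cst.
    by apply: cvgB; exact: uZ.
  - exists (Num.bound (C / e)) => // k /= kb.
    have -> : (\int[pi]_z ((psi z - grad (uz k) z) ^+ 2)%:E =
       sqn pi (fun z => psi z - grad (u_ k) z)%R)%E.
      apply: ge0_ae_eq_integral => //; try by meas.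
      + by move=> z _; rewrite lee_fin sqr_ge0.
      + by move=> z _; rewrite lee_fin sqr_ge0.
      + apply: filterS (ae_prod mZ Z0) => z [z1 z2] _.
        by rewrite /grad /uz !indicE !mem_set// !mulr1.
    rewrite -ipEFin; last exact: l2B.
    rewrite lee_fin; apply: le_trans (pC k) _.
    rewrite ler_pdivrMr ?ltr0n ?expn_gt0// mulrC -ler_pdivrMr//.
    apply: le_trans (ltW (archi_boundP _)) _; first by rewrite divr_ge0// ltW.
    rewrite ler_nat; apply: leq_trans kb _.
    by apply: ltnW; exact: ltn_expl.
have s0 : sqn pi (fun z => psi z - grad u z) = 0%E.
  apply/eqP; rewrite eq_le sqn_ge0 andbT.
  by apply/lee_addgt0Pr => e e0; rewrite add0e; exact: E0.
have ae : {ae pi, forall z, grad u z = psi z}.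
  have := sqn0_ae (measurable_funB mpsi mgu) s0.
  by apply: filterS => z /eqP; rewrite subr_eq0 => /eqP.
exists u; split => //; split => //.
by apply: (l2_ae _ lpsi) => //; apply: filterS ae => z ->.
Qed.

(* Square-integrable fluxes whose nonlocal divergence vanishes. *)
Definition inN (p : T * T -> R) :=
  [/\ l2 pi p, supp p & forall v, inU v -> ip pi p (grad v) = 0].

(** The projection of [psi] on the gradients is again a gradient [grad u], the range being closed.
    The residual is divergence-free, so it is orthogonal both to [grad u] and to [psi], hence to
    itself. *)
Lemma range_grad (psi : T * T -> R) : l2 pi psi -> supp psi ->
  (forall p, inN p -> ip pi p psi = 0) ->
  exists v, inU v /\ {ae pi, forall z, grad v z = psi z}.
Proof.
move=> lpsi spsi Np.
pose C := [set grad u | u in inU].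
have lC s : C s -> l2 pi s by move=> [u [_ _ lu] <-].
have C0 : C !=set0 by exists (grad (fun=> 0)), (fun=> 0) => //; exact: inU0.
have cC (a : R) s t : 0 <= a <= 1 -> C s -> C t ->
     C (fun z => (1 - a) * s z + a * t z).
  move=> _ [u Uu <-] [v Uv <-]; exists (fun x => (1 - a) * u x + a * v x).
    exact: inU_lin.
  exact: gradD.
have [s_ [Z [s [[Cs _ _ ls] [_ cs ss vs]]]]] := projection lpsi lC C0 cC.
have ex k : exists u, inU u /\ grad u = s_ k.
  by have [u Uu <-] := Cs k; exists u.
have [u_ Hu] := choice ex.
have [u [Uu ae _]] : exists u, [/\ inU u, {ae pi, forall z, grad u z = s z} &
    forall k, (sqn mu (fun x => u x - u_ k x)%R <= (P * 4 / (4 ^ k)%:R)%:E)%E].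
  apply: grad_closed => //.
  - by move=> k; have [] := Hu k.
  - by move=> k l kl; rewrite (Hu k).2 (Hu l).2; exact: cs.
  - by move=> k; rewrite (Hu k).2; exact: ss.
have lgu : l2 pi (grad u) by have [] := Uu.
have mgu : measurable_fun setT (grad u) by have [] := lgu.
have ms : measurable_fun setT s by have [] := ls.
have mpsi : measurable_fun setT psi by have [] := lpsi.
have H v : inU v -> ip pi (fun z => psi z - grad u z) (grad v) <= 0.
  move=> Uv; have lgv : l2 pi (grad v) by have [] := Uv.
  have mgv : measurable_fun setT (grad v) by have [] := lgv.
  have Uuv : inU (fun x => 1 * u x + 1 * v x) by exact: inU_lin.
  have /vs : C (grad (fun x => 1 * u x + 1 * v x)) by exists (fun x => 1 * u x + 1 * v x).
  rewrite gradD.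
  rewrite (@ip_eq_ae _ _ _ _ _ (fun z => psi z - grad u z)); [|by meas..|].
    rewrite ipC (@ip_eq_ae _ _ _ _ _ (grad v)); [|by meas..|].
      by rewrite ipC.
    by apply: filterS ae => z <-; ring.
  by apply: filterS ae => z <-.
have H0 v : inU v -> ip pi (fun z => psi z - grad u z) (grad v) = 0.
  move=> Uv; apply/eqP; rewrite eq_le H//=.
  have := H _ (inU_lin 0 (-1) Uv Uv); rewrite gradD.
  have lgv : l2 pi (grad v) by have [] := Uv.
  rewrite (_ : (fun z => 0 * grad v z + -1 * grad v z) = (fun z => -1 * grad v z)); last first.
    by apply/funext => z; ring.
  by rewrite ipZr//; [lra|exact: l2B].
have lp : l2 pi (fun z => psi z - grad u z) by exact: l2B.
have Np' : inN (fun z => psi z - grad u z).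
  by split => // x y nD; rewrite spsi// (grad_supp Uu)// subrr.
have := ipBr lpsi lgu lp; rewrite H0// Np// subr0 => pp.
exists u; split => //.
have p0 : sqn pi (fun z => psi z - grad u z)%R = 0%E by rewrite -ipEFin// pp.
have := sqn0_ae (measurable_funB mpsi mgu) p0.
by apply: filterS => z /eqP; rewrite subr_eq0 => /eqP.
Qed.

(** Riesz representation by a constrained Dirichlet principle: the shortest gradient with
    [ip mu f u = 1] is orthogonal to the gradients of all potentials orthogonal to [f], so a
    multiple of it represents the functional. If every potential is orthogonal to [f], the zero flux
    does. *)
Lemma exists_potential (f : T -> R) : l2 mu f ->
  exists u (c : R), inU u /\
    forall v, inU v -> ip pi (fun z => c * grad u z) (grad v) = - ip mu f v.
Proof.
move=> lf.
have lu v : inU v -> l2 mu v by move=> [].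
have lg v : inU v -> l2 pi (grad v) by move=> [].
have mg v : inU v -> measurable_fun setT (grad v) by move=> [_ _ []].
have [[v0 [Uv0 v00]]|H] := pselect (exists v, inU v /\ ip mu f v != 0); last first.
  exists (fun=> 0), 0; split; first exact: inU0.
  move=> v Uv; have -> : ip mu f v = 0.
    by apply/eqP/negPn/negP => fv; apply: H; exists v.
  rewrite oppr0 (ipZl _ (lg _ inU0) (lg _ Uv)) mul0r//.
pose C := [set grad u | u in [set u | inU u /\ ip mu f u = 1]].
have lC s : C s -> l2 pi s by move=> [u [[_ _ l] _] <-].
have C0 : C !=set0.
  exists (grad (fun x => (ip mu f v0)^-1 * v0 x + 0 * v0 x)).
  exists (fun x => (ip mu f v0)^-1 * v0 x + 0 * v0 x) => //=; split.
    exact: inU_lin.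
  rewrite ipDr ?ipZr//; try exact: lu; try (by apply: l2Z; exact: lu).
  by rewrite mul0r addr0 mulVf.
have cC (a : R) s t : 0 <= a <= 1 -> C s -> C t ->
     C (fun z => (1 - a) * s z + a * t z).
  move=> _ [u [Uu u1] <-] [v [Uv v1] <-]; exists (fun x => (1 - a) * u x + a * v x).
    split; first exact: inU_lin.
    rewrite ipDr ?ipZr//; try exact: lu; try (by apply: l2Z; exact: lu).
    by rewrite u1 v1; ring.
  exact: gradD.
have [s_ [Z [s [[Cs _ _ ls] [_ cs ss vs]]]]] := projection (l20 pi) lC C0 cC.
have ex k : exists u, (inU u /\ ip mu f u = 1) /\ grad u = s_ k.
  by have [u Uu <-] := Cs k; exists u.
have [u_ Hu] := choice ex.
have [u [Uu ae uu]] : exists u, [/\ inU u, {ae pi, forall z, grad u z = s z} &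
    forall k, (sqn mu (fun x => u x - u_ k x)%R <= (P * 4 / (4 ^ k)%:R)%:E)%E].
  apply: grad_closed => //.
  - by move=> k; have [[]] := Hu k.
  - by move=> k l kl; rewrite (Hu k).2 (Hu l).2; exact: cs.
  - by move=> k; rewrite (Hu k).2; exact: ss.
have Uuk k : inU (u_ k) by have [[]] := Hu k.
(* Poincare makes the potentials converge in L^2, not only their gradients, so the constraint passes
   to the limit. *)
have fu : ip mu f u = 1.
  have : (ip mu f u - 1) ^+ 2 <= 0.
    apply: (@le0_half _ _ (ip mu f f * (P * 4))) => k.
    have -> : ip mu f u - 1 = ip mu f (fun x => u x - u_ k x).
      by rewrite ipBr//; try exact: lu; rewrite (Hu k).1.2.
    apply: le_trans.
      by apply: cauchy_schwarz_ip => //; apply: l2B; exact: lu.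
    rewrite -mulrA; apply: ler_wpM2l; first exact: ip_ge0.
    have := uu k; rewrite -ipEFin; last by apply: l2B; exact: lu.
    rewrite lee_fin => H; apply: le_trans H _.
    apply: ler_wpM2l; first by rewrite mulr_ge0.
    rewrite lef_pV2 ?posrE ?ltr0n ?expn_gt0// ler_nat.
    by rewrite (_ : 4 = 2 * 2)%N// expnMn leq_pmull// expn_gt0.
  by rewrite real_exprn_even_le0//= subr_eq0 => /eqP.
have lgu := lg _ Uu.
have mgu := mg _ Uu.
have ms : measurable_fun setT s by have [] := ls.
have V v : inU v -> ip mu f v = 0 -> ip pi (grad u) (grad v) >= 0.
  move=> Uv fv; have lgv := lg _ Uv; have mgv := mg _ Uv.
  have Cv : C (grad (fun x => 1 * u x + 1 * v x)).
    exists (fun x => 1 * u x + 1 * v x) => //=; split; first exact: inU_lin.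
    rewrite ipDr ?ipZr//; try exact: lu; try (by apply: l2Z; exact: lu).
    by rewrite fu fv; ring.
  have := vs _ Cv; rewrite gradD.
  rewrite (@ip_eq_ae _ _ _ _ _ (fun z => -1 * grad u z)); [|by meas..|].
    rewrite ipC (@ip_eq_ae _ _ _ _ _ (grad v)); [|by meas..|].
      by rewrite ipC ipZl//; lra.
    by apply: filterS ae => z <-; ring.
  by apply: filterS ae => z <-; ring.
have V0 v : inU v -> ip mu f v = 0 -> ip pi (grad u) (grad v) = 0.
  move=> Uv fv; apply/eqP; rewrite eq_le V// andbT.
  have lgv := lg _ Uv.
  have Ug : inU (fun x => 0 * v x + -1 * v x) by exact: inU_lin.
  have /(V _ Ug) : ip mu f (fun x => 0 * v x + -1 * v x) = 0.
    rewrite ipDr ?ipZr//; try exact: lu; try (by apply: l2Z; exact: lu).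
    by rewrite fv; ring.
  rewrite gradD ipDr ?ipZr//; try exact: l2Z.
  by lra.
(* A vanishing gradient would give u = 0 by Poincare, against [ip mu f u = 1]. *)
have uu0 : ip pi (grad u) (grad u) != 0.
  apply/eqP => gu0; have := poincare Uu.
  rewrite -!ipEFin//; last exact: lu.
  rewrite gu0 -EFinM mulr0 lee_fin => uu1.
  have := cauchy_schwarz_ip lf (lu _ Uu); rewrite fu expr1n.
  have := ip_ge0 mu u; have := ip_ge0 mu f; nra.
exists u, (- (ip pi (grad u) (grad u))^-1); split => // v Uv.
have lgv := lg _ Uv.
rewrite ipZl//.
(* Subtracting this multiple of [u] makes [v] orthogonal to [f], because [ip mu f u = 1]. *)
have Uw : inU (fun x => 1 * v x + (- ip mu f v) * u x) by exact: inU_lin.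
have /(V0 _ Uw) : ip mu f (fun x => 1 * v x + (- ip mu f v) * u x) = 0.
  rewrite ipDr ?ipZr//; try exact: lu; try (by apply: l2Z; exact: lu).
  by rewrite fu; ring.
rewrite gradD ipDr ?ipZr//; try exact: l2Z.
move=> H; have -> : ip pi (grad u) (grad v) = ip mu f v * ip pi (grad u) (grad u) by lra.
by field.
Qed.

End Gradient.

(** * Tails of integrals and truncation of rows *)

Section Tail.
Context d (X : measurableType d) (R : realType).
Variable M : {measure set X -> \bar R}.

Lemma cvge0_near_le (u : nat -> \bar R) (e : R) : u @ \oo --> 0%E -> 0 < e ->
  \forall k \near \oo, (u k <= e%:E)%E.
Proof.
move=> /fine_cvgP[fu u0] e0.
have u1 : \forall k \near \oo, `|(fine \o u) k| <= e.
  by move/cvgr0Pnorm_le : u0; exact.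
apply: filterS2 fu u1 => k fk /= ue.
by rewrite -(fineK fk) lee_fin (le_trans (ler_norm _)).
Qed.

Lemma near_le_cvge0 (u : nat -> \bar R) : (forall k, 0 <= u k)%E ->
  (forall e : R, 0 < e -> \forall k \near \oo, (u k <= e%:E)%E) ->
  u @ \oo --> 0%E.
Proof.
move=> u0 H; apply/fine_cvgP; split.
  apply: filterS (H 1 ltr01) => k uk.
  by rewrite ge0_fin_numE// (le_lt_trans uk)// ltry.
apply/cvgr0Pnorm_le => e e0; apply: filterS (H e e0) => k uk.
rewrite /= ger0_norm ?fine_ge0// -lee_fin fineK//.
by rewrite ge0_fin_numE// (le_lt_trans uk)// ltry.
Qed.

Lemma measurable_gt_set (h : X -> \bar R) (c : \bar R) :
  measurable_fun setT h -> measurable [set y | (c < h y)%E].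
Proof.
by move=> mh; rewrite -[X in measurable X]setTI; exact: emeasurable_fun_o_infty.
Qed.

(** Dominated convergence. The level function [h] is separate from the integrand [g] because the cut
    will be made according to the row norm in one use and to the kernel in others. *)
Lemma integral_tail (g h : X -> \bar R) (e : R) :
  measurable_fun setT g -> measurable_fun setT h ->
  (forall x, 0 <= g x)%E -> (\int[M]_x g x < +oo)%E ->
  {ae M, forall x, h x < +oo}%E -> 0 < e ->
  \forall k \near \oo,
    (\int[M]_x (g x * (\1_[set y | ((k%:R)%:E < h y)%E] x)%:E) <= e%:E)%E.
Proof.
move=> mg mh g0 gi hfin e0.
pose u (k : nat) := (\int[M]_x (g x * (\1_[set y | ((k%:R)%:E < h y)%E] x)%:E))%E.
have mI k : measurable [set y | ((k%:R)%:E < h y)%E] by exact: measurable_gt_set.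
have mf k : measurable_fun setT
    (fun x => g x * (\1_[set y | ((k%:R)%:E < h y)%E] x)%:E)%E.
  by apply: emeasurable_funM => //; apply: measurable_funEFin; exact: measurable_indic.
have gint : M.-integrable setT g.
  by apply/integrableP; split => //; under eq_integral do rewrite gee0_abs//.
suff u0 : u @ \oo --> 0%E by exact: cvge0_near_le u0 e0.
have [] := @dominated_convergence _ _ _ M setT measurableT
  (fun k x => g x * (\1_[set y | ((k%:R)%:E < h y)%E] x)%:E)%E (cst 0)%E g mf _ _ gint.
- exact: measurable_cst.
- apply: filterS hfin => x hx _.
  have [k hk] : exists k : nat, (h x <= (k%:R)%:E)%E.
    move: hx; case: (h x) => [r _| |]//; last by exists 0%N; rewrite leNye.
    by exists (Num.bound `|r|); rewrite lee_fin (le_trans (ler_norm _))// ltW// archi_boundP.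
  apply: cvg_near_cst.
  exists k => // l /= kl; rewrite indicE memNset ?mule0//= => H.
  have := lt_le_trans H hk; rewrite lte_fin ltr_nat; apply/negP.
  by rewrite -leqNgt.
- apply: aeW => x k _; rewrite gee0_abs; last by rewrite mule_ge0// lee_fin.
  by rewrite indicE; case: (_ \in _); rewrite ?mule1 ?mule0.
by move=> _ _; rewrite integral_cst// mul0e.
Qed.

End Tail.

Section MixedTail.
Context d (T : measurableType d) (R : realType).
Variable mu : {sigma_finite_measure set T -> \bar R}.
Local Notation pi := (mu \x mu)%E.

Lemma rowsq_le_rown (c : R) (q : T * T -> R) x :
  (rown mu q x <= c%:E)%E -> (rowsq mu q x <= c%:E * rown mu q x)%E.
Proof.
rewrite /rown; have := rowsq_ge0 mu q x; case: (rowsq mu q x) => [r| |]//.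
  rewrite poweR_EFin !lee_fin => r0; rewrite powR12_sqrt// => H.
  rewrite -[leLHS](sqr_sqrtr r0) expr2.
  by apply: ler_wpM2r => //; exact: sqrtr_ge0.
by move=> _; rewrite poweRyr ?invr_neq0// leye_eq.
Qed.

Lemma rown_le_rowsq (c : R) (q : T * T -> R) x : 0 < c ->
  (c%:E < rown mu q x)%E -> (c%:E * rown mu q x <= rowsq mu q x)%E.
Proof.
move=> c0; rewrite /rown; have := rowsq_ge0 mu q x; case: (rowsq mu q x) => [r| |]//=.
  rewrite !lee_fin lte_fin => r0; rewrite powR12_sqrt// => H.
  rewrite -[leRHS](sqr_sqrtr r0) expr2.
  by apply: ler_wpM2r; [exact: sqrtr_ge0|exact: ltW].
by move=> *; rewrite leey.
Qed.

Lemma rowM_indic (q : T * T -> R) (A : set T) x :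
  rown mu (fun z => q z * \1_A z.1) x = (rown mu q x * (\1_A x)%:E)%E.
Proof.
have [Ax|nAx] := pselect (A x).
  rewrite indicE mem_set// mule1; congr (_ `^ _)%E; apply: eq_integral => y _.
  by rewrite /= indicE mem_set// mulr1.
rewrite indicE memNset// mule0 rown0// => y /=.
by rewrite indicE memNset// mulr0.
Qed.

Lemma pair_integrable (C : R) (q f : T * T -> R) : 0 <= C ->
  measurable_fun setT q -> measurable_fun setT f ->
  (N12 mu q < +oo)%E -> {ae mu, forall x, rown mu f x <= C%:E}%E ->
  pi.-integrable setT (EFin \o (fun z => q z * f z)).
Proof.
move=> C0 mq mf Nq fC; apply/integrableP; split; first by meas.
apply: le_lt_trans (pair_le C0 mq mf fC) _.
by rewrite lte_mul_pinfty// lee_fin.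
Qed.

Lemma pair_abs_le (C : R) (q f : T * T -> R) : 0 <= C ->
  measurable_fun setT q -> measurable_fun setT f ->
  (N12 mu q < +oo)%E -> {ae mu, forall x, rown mu f x <= C%:E}%E ->
  (`|ip pi q f|%:E <= C%:E * N12 mu q)%E.
Proof.
move=> C0 mq mf Nq fC.
have H := pair_integrable C0 mq mf Nq fC.
apply: le_trans (pair_le C0 mq mf fC).
rewrite /ip EFin_normr_Rintegral//; apply: le_abse_integral => //.
by meas.
Qed.

Lemma ae_row (p q : T * T -> R) : measurable_fun setT p -> measurable_fun setT q ->
  {ae pi, forall z, p z = q z} -> {ae mu, forall x, rown mu p x = rown mu q x}.
Proof.
move=> mp mq pq.
have m0 : measurable_fun setT (fun z => p z - q z) by meas.
have : sqn pi (fun z => p z - q z)%R = 0%E.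
  rewrite /sqn (@ae_eq_integral _ _ _ _ _ (cst 0)%E)//.
  - by rewrite integral_cst// mul0e.
  - by meas.
  - by apply: filterS pq => z /= -> _; rewrite subrr expr0n.
rewrite sqn_rowsq// => H0.
have mr := measurable_rowsq mu m0.
have := (ae_eq_integral_abs mu measurableT mr).1.
under [X in X = _ -> _]eq_integral do rewrite gee0_abs ?rowsq_ge0//.
move=> /(_ H0); apply: filterS => x /(_ I) /= rx.
have r0 : rown mu (fun z => p z - q z) x = 0%E.
  by rewrite /rown rx poweR0r// invr_neq0.
have r0' : rown mu (fun z => q z - p z) x = 0%E.
  rewrite -r0 /rown; congr (_ `^ _)%E; apply: eq_integral => y _.
  by rewrite -sqrrN opprB.
apply/eqP; rewrite eq_le; apply/andP; split.
  have := rownD mu x mq m0; rewrite r0 adde0.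
  by under eq_fun do rewrite addrC subrK.
have m0' : measurable_fun setT (fun z => q z - p z) by meas.
have := rownD mu x mp m0'; rewrite r0' adde0.
by under eq_fun do rewrite addrC subrK.
Qed.

Lemma N12_tail (q : T * T -> R) (e : R) : measurable_fun setT q ->
  (N12 mu q < +oo)%E -> 0 < e ->
  exists k : nat, (N12 mu (fun z => q z *
     \1_[set x | ((k%:R)%:E < rown mu q x)%E] z.1)%R <= e%:E)%E.
Proof.
move=> mq Nq e0; have mr := measurable_rown mu mq.
have fin : {ae mu, forall x, rown mu q x < +oo}%E.
  have ir : mu.-integrable setT (rown mu q).
    apply/integrableP; split => //.
    by under eq_integral do rewrite gee0_abs ?rown_ge0//.
  apply: filterS (integrable_ae measurableT ir) => x /(_ I).
  by rewrite ge0_fin_numE ?rown_ge0.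
have [k _ H] := integral_tail mr mr (rown_ge0 mu q) Nq fin e0.
exists k; rewrite /N12; under eq_integral do rewrite rowM_indic.
exact: (H k (leqnn k)).
Qed.

Variable D : set T.
Hypothesis mD : measurable D.
Variable m : R.
Hypothesis m0 : 0 <= m.
Hypothesis muDm : (mu D <= m%:E)%E.

Lemma N12_small (e : R) : 0 < e -> exists2 r : R, 0 < r &
  forall q, measurable_fun setT q -> supp D q -> (sqn pi q <= r%:E)%E ->
    (N12 mu q <= e%:E)%E.
Proof.
move=> e0; have m1 : 0 < m + 1 by exact: ltr_wpDl.
(* With this [t] and the bound t e on the squared norm, both terms of [N12_young] are at most e / 2;
   m + 1 keeps the quotient meaningful when m = 0. *)
pose t := e / (m + 1); have t0 : 0 < t by rewrite divr_gt0.
exists (t * e); first by rewrite mulr_gt0.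
move=> q mq sq qr.
have q0 x y : ~ D x -> q (x, y) = 0 by move=> nD; apply: sq => -[].
apply: le_trans (N12_young mu t0 mD mq q0) _.
apply: (@le_trans _ _ ((t / 2)%:E * m%:E + (1 / (2 * t))%:E * (t * e)%:E)%E).
  apply: leeD; apply: lee_wpmul2l => //; rewrite lee_fin.
    by rewrite divr_ge0// ltW.
  by rewrite divr_ge0// mulr_ge0// ltW.
rewrite -!EFinM -EFinD lee_fin.
have -> : t / 2 * m + 1 / (2 * t) * (t * e) = e / 2 * (m / (m + 1)) + e / 2.
  by rewrite /t; field; rewrite !gt_eqF.
have : m / (m + 1) <= 1 by rewrite ler_pdivrMr//; lra.
move=> H; have : e / 2 * (m / (m + 1)) <= e / 2 * 1.
  by apply: ler_wpM2l => //; rewrite divr_ge0// ltW.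
lra.
Qed.

Lemma l2_N12_lty (q : T * T -> R) : l2 pi q -> supp D q -> (N12 mu q < +oo)%E.
Proof.
move=> [mq q2] sq.
have q0 x y : ~ D x -> q (x, y) = 0 by move=> nD; apply: sq => -[].
apply: le_lt_trans (N12_young mu ltr01 mD mq q0) _.
apply: lte_add_pinfty; apply: lte_mul_pinfty => //;
  rewrite ?lee_fin ?divr_ge0 ?mulr_ge0//.
by apply: le_lt_trans muDm _; rewrite ltry.
Qed.

End MixedTail.

Lemma le_half_false (R : realFieldType) (a : R) : 0 < a -> a <= a / 2 -> False.
Proof. by lra. Qed.

(** * Density of divergence-free fluxes in the annihilator of bounded-row gradients *)

Section MixedClosure.
Context d (T : measurableType d) (R : realType).
Variable mu : {sigma_finite_measure set T -> \bar R}.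
Local Notation pi := (mu \x mu)%E.
Variables (O D : set T) (K : T * T -> R).
Hypothesis mD : measurable D.
Hypothesis mK : measurable_fun setT K.
Hypothesis OD : O `<=` D.
Hypothesis KC : forall x y, K (x, y) = K (y, x).
Hypothesis K0 : forall x y, O x -> ~ D y -> K (x, y) = 0.
Variable P : R.
Hypothesis P0 : 0 <= P.
Hypothesis poincare : forall u, inU mu O K u ->
  (sqn mu u <= P%:E * sqn pi (grad K u))%E.
Variable m : R.
Hypothesis m0 : 0 <= m.
Hypothesis muDm : (mu D <= m%:E)%E.

Lemma inN_lin a b p q : inN mu O D K p -> inN mu O D K q ->
  inN mu O D K (fun z => a * p z + b * q z).
Proof.
move=> [lp sp Np] [lq sq Nq]; have lap := l2Z a lp; have lbq := l2Z b lq.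
split; first exact: l2D.
  by move=> x y n; rewrite sp// sq// !mulr0 addr0.
move=> v Uv; have lgv : l2 pi (grad K v) by have [] := Uv.
by rewrite ipDl// !ipZl// Np// Nq// !mulr0 addr0.
Qed.

Lemma inN0 : inN mu O D K (fun=> 0).
Proof.
split => //; first exact: l20.
move=> v Uv; have lgv : l2 pi (grad K v) by have [] := Uv.
by have := ipZl 0 lgv lgv; rewrite mul0r; under eq_fun do rewrite mul0r.
Qed.

(** A row of norm at most [k] has squared norm at most [k] times its norm, so an L^{1,2} flux
    stripped of its larger rows is square-integrable. *)
Lemma l2_row_restrict (k : R) (q : T * T -> R) : 0 <= k ->
  measurable_fun setT q -> (N12 mu q < +oo)%E ->
  l2 pi (fun z => q z - q z * \1_[set x | (k%:E < rown mu q x)%E] z.1).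
Proof.
move=> k0 mq Nq.
have mr := measurable_rown mu mq.
have mA : measurable [set x | (k%:E < rown mu q x)%E] by exact: measurable_gt_set.
have mI : measurable_fun setT (fun z : T * T => \1_[set x | (k%:E < rown mu q x)%E] z.1 : R).
  exact: (measurableT_comp (measurable_indic _) measurable_fst).
have mq' : measurable_fun setT
   (fun z => q z - q z * \1_[set x | (k%:E < rown mu q x)%E] z.1) by meas.
split => //; rewrite sqn_rowsq//.
apply: (@le_lt_trans _ _ (k%:E * N12 mu q)%E); last by rewrite lte_mul_pinfty.
rewrite /N12 -ge0_integralZl//; last by move=> x _; exact: rown_ge0.
apply: ge0_le_integral => //.
- by move=> x _; exact: rowsq_ge0.
- exact: measurable_rowsq.
- exact: emeasurable_funM.
move=> x _; have [kr|kr] := ltP k%:E (rown mu q x).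
  rewrite /rowsq integral0_eq; first by rewrite mule_ge0// rown_ge0.
  by move=> y _ /=; rewrite indicE mem_set// mulr1 subrr expr0n.
have -> : rowsq mu (fun z => q z - q z * \1_[set x | (k%:E < rown mu q x)%E] z.1) x
   = rowsq mu q x.
  apply: eq_integral => y _ /=; rewrite indicE memNset ?mulr0 ?subr0//=.
  by rewrite ltNge kr.
exact: rowsq_le_rown.
Qed.

(** Converse of the duality estimate: [psi] cut to its rows of norm above [c] and rescaled to
    L^{1,2} norm [e] would pair with [psi] to at least [e * c]. Square-integrable test fluxes
    suffice, since [psi] itself is one. *)
Lemma row_bound_of_pairing (c : R) (psi : T * T -> R) (e : R) :
  l2 pi psi -> supp D psi -> 0 < c -> 0 < e ->
  (forall b, l2 pi b -> supp D b -> (N12 mu b <= e%:E)%E -> ip pi psi b < e * c) ->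
  {ae mu, forall x, rown mu psi x <= c%:E}%E.
Proof.
move=> lpsi spsi c0 e0 H.
have mpsi : measurable_fun setT psi by have [] := lpsi.
have mr := measurable_rown mu mpsi.
pose A := [set x | (c%:E < rown mu psi x)%E].
have mA : measurable A by exact: measurable_gt_set.
have mI : measurable_fun setT (fun z : T * T => \1_A z.1 : R).
  exact: (measurableT_comp (measurable_indic _) measurable_fst).
pose g z := psi z * \1_A z.1.
have mg : measurable_fun setT g by rewrite /g; meas.
have lg : l2 pi g.
  split => //; apply: le_lt_trans (lpsi.2); apply: ge0_le_integral => //; try by meas.
  - by move=> z _; rewrite lee_fin sqr_ge0.
  - move=> z _; rewrite lee_fin /g indicE; case: (_ \in _); rewrite ?mulr1//.
    by rewrite mulr0 expr0n sqr_ge0.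
have sg : supp D g by move=> x y n; rewrite /g spsi// mul0r.
have gfin := l2_N12_lty mD muDm lg sg.
have g0 := N12_ge0 mu g.
have [Ng0|Ng0] := eqVneq (N12 mu g) 0%E.
  have mrg := measurable_rown mu mg.
  have := (ae_eq_integral_abs mu measurableT mrg).1.
  under [X in X = _ -> _]eq_integral do rewrite gee0_abs ?rown_ge0//.
  move=> /(_ Ng0); apply: filterS => x /(_ I) /= rx.
  rewrite leNgt; apply/negP => cx; move: rx.
  rewrite /g rowM_indic indicE mem_set// mule1 => rx.
  by move: cx; rewrite rx lte_fin ltNge (ltW c0).
have I0 : 0 < fine (N12 mu g).
  by rewrite fine_gt0// gfin andbT lt_neqAle eq_sym Ng0.
have IE : N12 mu g = (fine (N12 mu g))%:E by rewrite fineK// ge0_fin_numE.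
set I := fine _ in I0 IE.
have eI0 : 0 <= e / I by rewrite divr_ge0// ltW.
have sg' : supp D (fun z => e / I * g z) by move=> x y n; rewrite sg// mulr0.
have Ng' : (N12 mu (fun z => e / I * g z)%R <= e%:E)%E.
  by rewrite N12Z// ger0_norm// IE -EFinM divfK ?gt_eqF.
have := H _ (l2Z _ lg) sg' Ng'.
rewrite ipZr// => Hlt; exfalso.
have : c * I <= ip pi psi g.
  have -> : ip pi psi g = ip pi g g.
    apply: eq_Rintegral => z _; rewrite /g indicE.
    by case: (_ \in _); rewrite ?mulr1 ?mulr0 ?mul0r.
  rewrite -lee_fin ipEFin// EFinM -IE sqn_rowsq// /N12 -ge0_integralZl//; first last.
  - by rewrite lee_fin ltW.
  - by move=> x _; exact: rown_ge0.
  - exact: measurable_rown.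
  apply: ge0_le_integral => //.
  - by move=> x _; rewrite mule_ge0 ?rown_ge0// lee_fin ltW.
  - by apply: emeasurable_funM => //; exact: measurable_rown.
  - exact: measurable_rowsq.
  move=> x _; have [Ax|nAx] := pselect (A x).
    apply: rown_le_rowsq => //.
    by rewrite /g rowM_indic indicE mem_set// mule1.
  by rewrite {1}/g rowM_indic indicE memNset// !mule0 rowsq_ge0.
move=> cI; have : e / I * (c * I) <= e / I * ip pi psi g by exact: ler_wpM2l.
rewrite (_ : e / I * (c * I) = e * c); last by field; rewrite gt_eqF.
by move=> /le_lt_trans /(_ Hlt); rewrite ltxx.
Qed.

Lemma N12_closure (q : T * T -> R) (e : R) :
  measurable_fun setT q -> supp D q -> (N12 mu q < +oo)%E ->
  (forall v (C : R), 0 <= C -> inU mu O K v ->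
     {ae mu, forall x, rown mu (grad K v) x <= C%:E}%E ->
     ip pi q (grad K v) = 0) ->
  0 < e -> exists p, inN mu O D K p /\ (N12 mu (fun z => q z - p z)%R <= e%:E)%E.
Proof.
move=> mq sq Nq Hq e0.
(* The final error is h (truncation) + h/2 (residual) + h/2 (distance from [s] to [s_ j]) + 2 h (the
   ball) = e. *)
pose h := e / 4; have h0 : 0 < h by rewrite divr_gt0.
have [k Nk] := N12_tail mq Nq h0.
set A := [set x | _] in Nk.
have mr := measurable_rown mu mq.
have mA : measurable A by exact: measurable_gt_set.
have mI : measurable_fun setT (fun z : T * T => \1_A z.1 : R).
  exact: (measurableT_comp (measurable_indic _) measurable_fst).
pose qM z := q z - q z * \1_A z.1.
have lqM : l2 pi qM by exact: l2_row_restrict.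
have mqM : measurable_fun setT qM by have [] := lqM.
have sqM : supp D qM by move=> x y n; rewrite /qM sq// mul0r subrr.
have NqM : (N12 mu (fun z => q z - qM z)%R <= h%:E)%E.
  by under eq_fun do rewrite /qM opprB addrC subrK.
(* The radius 2 h is twice the truncation error h; this gap produces the contradiction at the
   end. *)
pose S : set (T * T -> R) := [set s | exists p b, [/\ inN mu O D K p, l2 pi b,
  supp D b, (N12 mu b <= (2 * h)%:E)%E & s = (fun z => p z + b z)]].
have Sl s : S s -> l2 pi s.
  by move=> [p [b [[lp _ _] lb _ _ ->]]]; exact: l2D.
have Ss s : S s -> supp D s.
  by move=> [p [b [[_ sp _] _ sb _ ->]]] x y n; rewrite sp// sb// addr0.
have h20 : (0 <= (2 * h)%:E)%E by rewrite lee_fin; lra.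
have SN p : inN mu O D K p -> S p.
  move=> Np; exists p, (fun=> 0); split => //; first exact: l20.
    rewrite (_ : N12 mu _ = 0%E)// /N12 integral0_eq// => x _.
    by rewrite rown0.
  by apply/funext => z; rewrite addr0.
have SB b : l2 pi b -> supp D b -> (N12 mu b <= (2 * h)%:E)%E -> S b.
  move=> lb sb Nb; exists (fun=> 0), b; split => //; first exact: inN0.
  by apply/funext => z; rewrite add0r.
have S0 : S !=set0 by exists (fun=> 0); apply: SN; exact: inN0.
have cS (a : R) s t : 0 <= a <= 1 -> S s -> S t ->
     S (fun z => (1 - a) * s z + a * t z).
  move=> /andP[a0 a1] [p [b [Np lb sb Nb ->]]] [p' [b' [Np' lb' sb' Nb' ->]]].
  exists (fun z => (1 - a) * p z + a * p' z), (fun z => (1 - a) * b z + a * b' z).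
  have mb : measurable_fun setT b by have [] := lb.
  have mb' : measurable_fun setT b' by have [] := lb'.
  split.
  - exact: inN_lin.
  - by apply: l2D; exact: l2Z.
  - by move=> x y n; rewrite sb// sb'// !mulr0 addr0.
  - apply: le_trans; first by apply: N12D; meas.
    rewrite !N12Z// !ger0_norm//; last by lra.
    apply: (@le_trans _ _ ((1 - a)%:E * (2 * h)%:E + a%:E * (2 * h)%:E)%E).
      by apply: leeD; apply: lee_wpmul2l => //; rewrite lee_fin; lra.
    by rewrite -!EFinM -EFinD lee_fin -mulrDl subrK mul1r.
  - by apply/funext => z; ring.
have [s_ [Z [s [[Cs mZ Z0 ls] [sZ _ ss vs]]]]] := projection lqM Sl S0 cS.
have ms : measurable_fun setT s by have [] := ls.
have supps : supp D s.
  move=> x y n; have := sZ (x, y).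
  rewrite (_ : (fun _ => _) = fun=> 0); last first.
    by apply/funext => j; rewrite (Ss _ (Cs j))// mul0r.
  by move=> H; apply/esym; apply: (cvg_unique _ _ H) => //; exact: cvg_cst.
pose psi z := qM z - s z.
have lpsi : l2 pi psi by exact: l2B.
have mpsi : measurable_fun setT psi by have [] := lpsi.
have spsi : supp D psi by move=> x y n; rewrite /psi sqM// supps// subrr.
have [pp0|pp0] := eqVneq (ip pi psi psi) 0.
  have h20' : 0 < h / 2 by rewrite divr_gt0.
  have [r r0 Hr] := N12_small mD m0 muDm h20'.
  have N1 : (N12 mu psi <= (h / 2)%:E)%E.
    by apply: Hr => //; rewrite -ipEFin// pp0 lee_fin ltW.
  have [j sj] : exists j, ip pi (fun z => s z - s_ j z) (fun z => s z - s_ j z) <= r.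
    exists (Num.bound (4 / r)); apply: le_trans (ss _) _.
    rewrite ler_pdivrMr ?ltr0n ?expn_gt0// mulrC -ler_pdivrMr//.
    apply: le_trans (ltW (archi_boundP _)) _; first by rewrite divr_ge0// ltW.
    by rewrite ler_nat; apply: ltnW; exact: ltn_expl.
  have lsj := l2B ls (Sl _ (Cs j)).
  have N2 : (N12 mu (fun z => s z - s_ j z)%R <= (h / 2)%:E)%E.
    apply: Hr; first by case: lsj.
    - by move=> x y n; rewrite supps// (Ss _ (Cs j))// subrr.
    - by rewrite -ipEFin// lee_fin.
  have [p [b [Np lb sb Nb sE]]] := Cs j.
  exists p; split => //.
  have mb : measurable_fun setT b by have [] := lb.
  have mp : measurable_fun setT p by have [[]] := Np.
  have msj : measurable_fun setT (s_ j) by have [] := Sl _ (Cs j).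
  rewrite (_ : (fun z => q z - p z) = (fun z => ((q z - qM z) + psi z) +
      ((s z - s_ j z) + b z))); last first.
    by apply/funext => z; rewrite sE /psi; ring.
  apply: le_trans; first by apply: N12D; meas.
  rewrite (_ : e = (h + h / 2) + (h / 2 + 2 * h)); last by rewrite /h; field.
  rewrite EFinD; apply: leeD.
    by apply: le_trans; [apply: N12D; meas|rewrite EFinD; exact: leeD].
  by apply: le_trans; [apply: N12D; meas|rewrite EFinD; exact: leeD].
have pp : 0 < ip pi psi psi by rewrite lt_neqAle eq_sym pp0 ip_ge0.
have V t : S t -> ip pi psi t <= ip pi psi s.
  by move=> St; have := vs _ St; rewrite -/psi ipBr//; [lra|exact: Sl].
have psM : ip pi psi qM = ip pi psi psi + ip pi psi s.
  by rewrite -ipDr//; congr ip; apply/funext => z; rewrite /psi subrK.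
have ps0 : 0 <= ip pi psi s.
  have := V _ (SN _ inN0); rewrite (_ : ip pi psi _ = 0)//.
  by rewrite /ip; under eq_Rintegral do rewrite mulr0; rewrite /Rintegral integral0.
(* A linear functional bounded above on a linear space vanishes there: otherwise a suitable multiple
   of [p] would exceed the bound by 1. *)
have Np0 p : inN mu O D K p -> ip pi p psi = 0.
  move=> Np; apply/eqP/negPn/negP => px.
  have lp : l2 pi p by have [] := Np.
  have := V _ (SN _ (inN_lin ((ip pi psi s + 1) / ip pi p psi) 0 Np Np)).
  rewrite ipDr//; try exact: l2Z.
  by rewrite !ipZr// mul0r addr0 (ipC pi psi p) divfK//; lra.
have [v [Uv gv]] := range_grad mK OD KC K0 P0 poincare lpsi spsi Np0.
pose c := ip pi psi qM / (2 * h).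
have qM0 : 0 < ip pi psi qM by rewrite psM ltr_wpDr.
have c0 : 0 < c by rewrite divr_gt0// mulr_gt0.
(* By minimality [ip pi psi b] is at most [ip pi psi s] for every [b] in the ball, and this is
   strictly below [ip pi psi qM], which equals 2 h c. *)
have rc : {ae mu, forall x, rown mu psi x <= c%:E}%E.
  apply: (@row_bound_of_pairing c psi (2 * h)) => //; first by rewrite mulr_gt0.
  move=> b lb sb Nb; apply: le_lt_trans (V _ (SB _ lb sb Nb)) _.
  rewrite /c mulrC divfK; last by rewrite gt_eqF// mulr_gt0.
  by rewrite psM ltrDr.
have lgv : l2 pi (grad K v) by have [] := Uv.
have mgv : measurable_fun setT (grad K v) by have [] := lgv.
have rgv : {ae mu, forall x, rown mu (grad K v) x <= c%:E}%E.
  by apply: filterS2 rc (ae_row mgv mpsi gv) => x r1 ->.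
have c0' := ltW c0.
have qpsi : ip pi q psi = 0.
  rewrite -(Hq v c c0' Uv rgv) ipC (ipC pi q).
  by apply: ip_eq_ae => //; apply: filterS gv => z ->.
have mqq : measurable_fun setT (fun z => q z - qM z) by meas.
have Nqq : (N12 mu (fun z => q z - qM z)%R < +oo)%E.
  by apply: le_lt_trans NqM _; rewrite ltry.
have i1 := pair_integrable c0' mq mpsi Nq rc.
have i2 := pair_integrable c0' mqq mpsi Nqq rc.
(* [psi] is almost everywhere a gradient with bounded rows, so [q] pairs to zero with it. Hence
   [ip pi psi qM] is carried by the discarded rows and is at most c h, half of itself. *)
have qE : ip pi (fun z => q z - qM z) psi = - ip pi psi qM.
  have -> : ip pi psi qM = ip pi q psi - ip pi (fun z => q z - qM z) psi.
    rewrite ipC /ip -RintegralB//; apply: eq_Rintegral => z _; ring.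
  by rewrite qpsi; ring.
have := pair_abs_le c0' mqq mpsi Nqq rc; rewrite qE normrN => H1.
have : (`|ip pi psi qM|%:E <= c%:E * h%:E)%E.
  by apply: le_trans H1 _; apply: lee_wpmul2l.
rewrite -EFinM lee_fin ger0_norm; last exact: ltW.
have -> : c * h = ip pi psi qM / 2 by rewrite /c; field; rewrite gt_eqF.
by move=> /(le_half_false qM0).
Unshelve. all: by [].
Qed.

End MixedClosure.

(** * Lebesgue measure on R^n *)

Section Boxes.
Context (R : realType) (n : nat).
Local Notation T := (Rn R n).

Definition box (a b : 'rV[R]_n) : set T :=
  [set x : T | forall i, a 0 i <= (x : 'rV[R]_n) 0 i < b 0 i].

Lemma measurable_coord (i : 'I_n) :
  measurable_fun [set: T] (fun x : T => (x : 'rV[R]_n) 0 i).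
Proof.
apply: (measurability _ (RGenOInfty.measurableE R)) => //.
move=> _ [_ [c ->] <-]; rewrite setTI; apply: sub_sigma_algebra.
rewrite /preimage/= openE => x /=; rewrite in_itv/= andbT => cx.
apply/nbhs_ballP; exists ((x : 'rV[R]_n) 0 i - c) => /=; first by rewrite subr_gt0.
move=> y [_ /(_ 0 i)]; rewrite /ball/= in_itv/= andbT => H.
have := ler_norm ((x : 'rV[R]_n) 0 i - (y : 'rV[R]_n) 0 i); lra.
Qed.

Lemma measurable_box a b : measurable (box a b).
Proof.
have -> : box a b = \bigcap_(i : 'I_n) ([set: T] `&`
   (fun x : T => (x : 'rV[R]_n) 0 i) @^-1` [set` `[a 0 i, b 0 i[]).
  apply/seteqP; split => x /=.
    by move=> H i _; split => //=; rewrite in_itv/=; exact: H.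
  by move=> H i; have [_ /=] := H i I; rewrite in_itv.
apply: fin_bigcap_measurable => //.
by move=> i _; apply: measurable_coord => //; exact: measurable_itv.
Qed.

Lemma open_bigcup_box (U : set 'rV[R]_n) : open U ->
  U = \bigcup_(p in [set p : 'rV[rat]_n * 'rV[rat]_n |
        box (map_mx ratr p.1) (map_mx ratr p.2) `<=` U])
      box (map_mx ratr p.1) (map_mx ratr p.2).
Proof.
move=> oU; apply/seteqP; split => x; last by case=> p /=; exact.
move=> Ux; move: oU; rewrite openE => /(_ x Ux) /nbhs_ballP[e /= e0 eU].
have Ha i : exists q, x 0 i - e < ratr q < x 0 i.
  have [|q] := @rat_in_itvoo R (x 0 i - e) (x 0 i); first by lra.
  by rewrite in_itv; exists q.
have Hb i : exists q, x 0 i < ratr q < x 0 i + e.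
  have [|q] := @rat_in_itvoo R (x 0 i) (x 0 i + e); first by lra.
  by rewrite in_itv; exists q.
have [a aP] := choice Ha; have [b bP] := choice Hb.
exists (\row_i a i, \row_i b i); last first.
  by move=> i /=; rewrite !mxE; have := aP i; have := bP i; lra.
move=> y /= yP; apply: eU; split => // i j; rewrite (ord1 i).
have := yP j; rewrite !mxE /ball/= => Y.
have := aP j; have := bP j => A B.
rewrite ltr_norml; apply/andP; split; lra.
Qed.

Definition boxes : set (set T) := [set box p.1 p.2 | p in [set: 'rV[R]_n * 'rV[R]_n]].

Lemma measurable_boxesE : measurable = <<s boxes >>.
Proof.
apply/seteqP; split.
  apply: smallest_sub; first exact: smallest_sigma_algebra.
  move=> U oU; rewrite (open_bigcup_box oU).
  have : boxes.-sigma.-measurable (\bigcup_(p in [set p : 'rV[rat]_n * 'rV[rat]_n |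
        box (map_mx ratr p.1) (map_mx ratr p.2) `<=` U])
      box (map_mx ratr p.1) (map_mx ratr p.2) : set (g_sigma_algebraType boxes)).
    rewrite bigcup_mkcond; apply: countable_bigcupT_measurable => //.
    move=> p; case: ifPn => _; last exact: measurable0.
    by apply: sub_sigma_algebra; exists (map_mx ratr p.1, map_mx ratr p.2).
  by [].
apply: smallest_sub; first exact: sigma_algebra_measurable.
by move=> _ [[a b] _ <-]; exact: measurable_box.
Qed.

Lemma boxes_setI_closed : setI_closed boxes.
Proof.
move=> _ _ [[a b] _ <-] [[c d] _ <-].
exists (\row_i Num.max (a 0 i) (c 0 i), \row_i Num.min (b 0 i) (d 0 i)) => //.
apply/seteqP; split => x /=.
  move=> H; split => i; have := H i; rewrite !mxE ge_max lt_min => /andP[/andP[? ?] /andP[? ?]];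
    exact/andP.
move=> [H1 H2] i; rewrite !mxE ge_max lt_min.
by have /andP[-> ->] := H1 i; have /andP[-> ->] := H2 i.
Qed.

Definition cube (k : nat) : set T := box (const_mx (- k%:R)) (const_mx k%:R).

Lemma boxes_cube k : boxes (cube k).
Proof. by exists (const_mx (- k%:R), const_mx k%:R). Qed.

Lemma bigcup_cube : \bigcup_k cube k = setT.
Proof.
apply/seteqP; split => // x _.
pose M : R := \sum_i `|(x : 'rV[R]_n) 0 i|.
have M0 : 0 <= M by apply: sumr_ge0 => i _.
have xM i : `|(x : 'rV[R]_n) 0 i| <= M.
  by rewrite /M (bigD1 i)//= lerDl sumr_ge0.
exists (Num.bound M) => // i; rewrite !mxE.
have := archi_boundP M0; have := xM i; rewrite ler_norml => /andP[] *.
by apply/andP; split; lra.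
Qed.

Lemma measurable_fun_Rn d (X : measurableType d) (f : X -> T) :
  (forall i, measurable_fun setT (fun x => (f x : 'rV[R]_n) 0 i)) ->
  measurable_fun setT f.
Proof.
move=> mf; apply: (measurability _ measurable_boxesE).
move=> _ [_ [[a b] _ <-] <-].
have -> : [set: X] `&` f @^-1` box a b = \bigcap_(i : 'I_n) ([set: X] `&`
   (fun x => (f x : 'rV[R]_n) 0 i) @^-1` [set` `[a 0 i, b 0 i[]).
  apply/seteqP; split => x /=.
    by move=> [_ H] i _; split => //=; rewrite in_itv/=; exact: H.
  by move=> H; split => // i; have [_ /=] := H i I; rewrite in_itv.
apply: fin_bigcap_measurable => //.
by move=> i _; apply: mf => //; exact: measurable_itv.
Qed.

Lemma measurable_translate (z : 'rV[R]_n) :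
  measurable_fun [set: T] (fun x : T => (x : 'rV[R]_n) + z : T).
Proof.
apply: measurable_fun_Rn => i; under eq_fun do rewrite mxE.
by apply: measurable_funD => //; exact: measurable_coord.
Qed.

Lemma measurable_diff :
  measurable_fun [set: T * T] (fun p : T * T => (p.1 : 'rV[R]_n) - p.2 : T).
Proof.
apply: measurable_fun_Rn => i; under eq_fun do rewrite !mxE.
apply: measurable_funB.
  exact: (measurableT_comp (measurable_coord i) measurable_fst).
exact: (measurableT_comp (measurable_coord i) measurable_snd).
Qed.

Lemma measurable_enorm : measurable_fun [set: T] (fun x : T => enorm x).
Proof.
rewrite /enorm; apply: (measurableT_comp (f := @Num.sqrt R)) => //.
  apply: continuous_measurable_fun; exact: sqrt_continuous.
apply: measurable_sum => i.
by apply: measurable_funM; exact: measurable_coord.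
Qed.

Variable mu : {measure set T -> \bar R}.
Hypothesis lmu : is_lebesgue mu.

Lemma lebesgue_cube_lty k : (mu (cube k) < +oo)%E.
Proof.
rewrite /cube /box lmu ?ltry// => i; rewrite !mxE.
by rewrite ge0_cp// ?oppr_le0//.
Qed.

Lemma lebesgue_sigma_finite : sigma_finite setT mu.
Proof.
exists cube; first by rewrite bigcup_cube.
by move=> i; split; [exact: measurable_box|exact: lebesgue_cube_lty].
Qed.

Lemma box_empty (a b : 'rV[R]_n) (i : 'I_n) : b 0 i < a 0 i -> box a b = set0.
Proof. by move=> ba; apply/seteqP; split => x //= /(_ i); lra. Qed.

(** [mu] is known only through the volumes of boxes. Boxes are stable under intersection and
    generate the Borel sets, and cubes of finite measure exhaust space, so measures agreeing on
    boxes are equal. *)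
Lemma lebesgue_translate (z : 'rV[R]_n) (A : set T) : measurable A ->
  pushforward mu (fun x : T => (x : 'rV[R]_n) + z : T) A = mu A.
Proof.
pose f := fun x : T => (x : 'rV[R]_n) + z : T.
have mf : measurable_fun setT f by exact: measurable_translate.
have [m2 m2E] : exists m2 : {measure set T -> \bar R},
    forall B, m2 B = pushforward mu f B.
  by unshelve eexists (pushforward mu f : {measure set T -> \bar R}).
move=> mA.
suff : mu A = m2 A by rewrite m2E.
apply: (@measure_unique _ _ _ boxes cube measurable_boxesE boxes_setI_closed
  boxes_cube bigcup_cube mu m2) => //.
- move=> _ [[a b] _ <-]; rewrite m2E.
  have -> : pushforward mu f (box (a, b).1 (a, b).2) = mu (box (a - z) (b - z)).
    congr (mu _); apply/seteqP.
    by split => x /= H i; have := H i; rewrite /f !mxE; lra.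
  (* [is_lebesgue] speaks of ordered corners only; when some coordinates are in the wrong order both
     boxes are empty. *)
  have [[i ba]|H] := pselect (exists i, b 0 i < a 0 i).
    rewrite (box_empty ba) (@box_empty (a - z) (b - z) i) ?measure0//.
    by rewrite !mxE; lra.
  have ab i : a 0 i <= b 0 i by rewrite leNgt; apply/negP => ba; apply: H; exists i.
  rewrite /box lmu// lmu//; last by move=> i; rewrite !mxE; have := ab i; lra.
  by congr EFin; apply: eq_bigr => i _; rewrite !mxE; lra.
- exact: lebesgue_cube_lty.
Qed.

Lemma ge0_integral_translate (z : 'rV[R]_n) (f : T -> \bar R) :
  measurable_fun setT f -> (forall x, 0 <= f x)%E ->
  (\int[mu]_x f ((x : 'rV[R]_n) + z)%R = \int[mu]_x f x)%E.
Proof.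
move=> mf f0.
have mt := measurable_translate z.
have := @ge0_integral_pushforward _ _ _ _ R _ mt mu setT f measurableT mf
  (fun y _ => f0 y).
rewrite preimage_setT /= => <-.
apply: eq_measure_integral => A mA _.
exact: lebesgue_translate.
Qed.

End Boxes.

(** * Existence of a minimiser *)

Section StrictConvexity.
Context (R : realType).

(** Subtracting 1 makes the energy density vanish at 0, so that it is integrable over the whole
    product for fluxes supported in D x D. *)
Definition phi (t : R) : R := Num.sqrt (1 + t ^+ 2) - 1.

Lemma sqrt1_ge1 (t : R) : 1 <= Num.sqrt (1 + t ^+ 2).
Proof.
rewrite -[leLHS]sqrtr1 ler_sqrt ?addr_ge0 ?sqr_ge0//.
by rewrite lerDl sqr_ge0.
Qed.

Lemma sqrt1_le (t : R) : Num.sqrt (1 + t ^+ 2) <= 1 + `|t|.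
Proof.
have t0 := normr_ge0 t.
rewrite -(@ler_pXn2r _ 2)// ?nnegrE ?sqrtr_ge0 ?addr_ge0//.
rewrite sqr_sqrtr ?addr_ge0 ?sqr_ge0// -[t ^+ 2]real_normK ?num_real//.
nra.
Qed.

Lemma phi_ge0 t : 0 <= phi t.
Proof. by rewrite /phi subr_ge0 sqrt1_ge1. Qed.

Lemma phi_le t : phi t <= `|t|.
Proof. by rewrite /phi; have := sqrt1_le t; lra. Qed.

Lemma measurable_phi : measurable_fun setT phi.
Proof.
apply: measurable_funB => //; apply: (measurableT_comp (f := @Num.sqrt R)).
  by apply: continuous_measurable_fun; exact: sqrt_continuous.
by apply: measurable_funD => //; exact: measurable_funX.
Qed.

(* With X = |(1,a)| and Y = |(1,b)|, the defect X + Y - |(2,a+b)| of the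
   triangle inequality equals
   2 (a - b)^2 / ((XY + 1 + ab) (X + Y + |(2,a+b)|)). *)
Lemma phi_midpoint (a b B : R) : `|a| + 1 <= B -> `|b| + 1 <= B ->
  (a - b) ^+ 2 <= 4 * B ^+ 3 * (phi a + phi b - 2 * phi ((a + b) / 2)).
Proof.
move=> aB bB; rewrite /phi.
set X := Num.sqrt (1 + a ^+ 2); set Y := Num.sqrt (1 + b ^+ 2).
set W := Num.sqrt _.
have X1 : 1 <= X := sqrt1_ge1 a; have Y1 : 1 <= Y := sqrt1_ge1 b.
have W1 : 1 <= W := sqrt1_ge1 _.
have XB : X <= B by have := sqrt1_le a; rewrite -/X; lra.
have YB : Y <= B by have := sqrt1_le b; rewrite -/Y; lra.
have X2 : X ^+ 2 = 1 + a ^+ 2 by rewrite sqr_sqrtr// addr_ge0 ?sqr_ge0.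
have Y2 : Y ^+ 2 = 1 + b ^+ 2 by rewrite sqr_sqrtr// addr_ge0 ?sqr_ge0.
have W2 : 4 * W ^+ 2 = 4 + (a + b) ^+ 2.
  by rewrite sqr_sqrtr ?addr_ge0 ?sqr_ge0//; field.
have XYp : 1 <= X * Y by nra.
have XY2 : (X * Y) ^+ 2 = (1 + a * b) ^+ 2 + (a - b) ^+ 2.
  by rewrite exprMn X2 Y2; ring.
have ab : `|1 + a * b| <= X * Y.
  rewrite -(@ler_pXn2r _ 2)// ?nnegrE// ?real_normK ?num_real//; last by lra.
  by rewrite XY2 lerDl sqr_ge0.
have [ab1 ab2] : - (X * Y) <= 1 + a * b /\ 1 + a * b <= X * Y.
  by move: ab; rewrite ler_norml => /andP[].
have WXY : 2 * W <= X + Y.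
  rewrite -(@ler_pXn2r _ 2)// ?nnegrE; [|lra|lra].
  have -> : (2 * W) ^+ 2 = 4 * W ^+ 2 by ring.
  have -> : (X + Y) ^+ 2 = X ^+ 2 + Y ^+ 2 + 2 * (X * Y) by ring.
  rewrite W2 X2 Y2; nra.
have B1 : 1 <= B by lra.
have D0 : 0 <= X + Y - 2 * W by lra.
have E1 : (X + Y - 2 * W) * (X + Y + 2 * W) = 2 * (X * Y - (1 + a * b)).
  have -> : (X + Y - 2 * W) * (X + Y + 2 * W) =
     X ^+ 2 + Y ^+ 2 + 2 * (X * Y) - 4 * W ^+ 2 by ring.
  by rewrite W2 X2 Y2; ring.
have E2 : (X * Y - (1 + a * b)) * (X * Y + (1 + a * b)) = (a - b) ^+ 2.
  have -> : (X * Y - (1 + a * b)) * (X * Y + (1 + a * b)) =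
     (X * Y) ^+ 2 - (1 + a * b) ^+ 2 by ring.
  by rewrite XY2; ring.
have L1 : X * Y - (1 + a * b) <= 2 * B * (X + Y - 2 * W).
  have : (X + Y - 2 * W) * (X + Y + 2 * W) <= (X + Y - 2 * W) * (4 * B).
    by apply: ler_wpM2l => //; lra.
  rewrite E1; lra.
have XYB : X * Y <= B ^+ 2.
  by rewrite expr2; apply: ler_pM => //; lra.
have L2 : (a - b) ^+ 2 <= (X * Y - (1 + a * b)) * (2 * B ^+ 2).
  by rewrite -E2; apply: ler_wpM2l; lra.
apply: le_trans L2 _.
have -> : X - 1 + (Y - 1) - 2 * (W - 1) = X + Y - 2 * W by ring.
have : (X * Y - (1 + a * b)) * (2 * B ^+ 2) <=
   (2 * B * (X + Y - 2 * W)) * (2 * B ^+ 2).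
  by apply: ler_wpM2r => //; rewrite mulr_ge0// sqr_ge0.
move=> /le_trans; apply; rewrite le_eqVlt; apply/orP; left; apply/eqP; ring.
Qed.

Lemma phi_midpoint_ge0 (a b : R) : 0 <= phi a + phi b - 2 * phi ((a + b) / 2).
Proof.
pose B := `|a| + `|b| + 1.
have B0 : 0 < 4 * B ^+ 3.
  by rewrite mulr_gt0// exprn_gt0// /B ltr_wpDl// addr_ge0.
rewrite -(pmulr_rge0 _ B0); apply: le_trans (sqr_ge0 (a - b)) _.
by apply: phi_midpoint; rewrite /B; have := normr_ge0 a; have := normr_ge0 b; lra.
Qed.

(** Keeps the part above the level [M]; its integral measures the failure of uniform
    integrability. *)
Definition trunc (M t : R) : R := if M < `|t| then `|t| else 0.

(** If one value exceeds [M], the distance is at most twice the larger modulus. Otherwise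
    [phi_midpoint] bounds the squared distance, and t <= l + t^2 / (4 l) removes the square; the
    term [l] will be paid for by the finite measure of D x D. *)
Lemma dist_le_midpoint (a b M l : R) : 0 <= M -> 0 < l ->
  `|a - b| <= 2 * trunc M a + 2 * trunc M b +
    (l + (M + 1) ^+ 3 / l * (phi a + phi b - 2 * phi ((a + b) / 2))).
Proof.
move=> M0 l0; have P0 := phi_midpoint_ge0 a b.
have Q0 : 0 <= l + (M + 1) ^+ 3 / l * (phi a + phi b - 2 * phi ((a + b) / 2)).
  apply: addr_ge0; first exact: ltW.
  by rewrite mulr_ge0// divr_ge0 ?exprn_ge0 ?addr_ge0// ltW.
have := ler_normB a b; have := normr_ge0 a; have := normr_ge0 b.
rewrite /trunc; case: ltP => aM; case: ltP => bM b0 a0 ab; try lra.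
rewrite !mulr0 !add0r.
have aB : `|a| + 1 <= M + 1 by lra.
have bB : `|b| + 1 <= M + 1 by lra.
have := phi_midpoint aB bB.
set F := phi a + _ - _ in P0 Q0 *.
move=> H.
have : (a - b) ^+ 2 / (4 * l) <= (M + 1) ^+ 3 / l * F.
  rewrite ler_pdivrMr; last by rewrite mulr_gt0.
  by apply: le_trans H _; rewrite le_eqVlt; apply/orP; left; apply/eqP; field; rewrite gt_eqF.
move=> HX; apply: (@le_trans _ _ (l + (a - b) ^+ 2 / (4 * l))); last by rewrite lerD2l.
rewrite -[(a - b) ^+ 2]real_normK ?num_real//.
rewrite -subr_ge0.
have -> : l + `|a - b| ^+ 2 / (4 * l) - `|a - b| = (`|a - b| - 2 * l) ^+ 2 / (4 * l).
  by field; rewrite gt_eqF.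
by rewrite divr_ge0 ?sqr_ge0// mulr_ge0// ltW.
Qed.

(* [a1] and [a2] stand for the norms of the rows of x and y: by antisymmetry both
   rows contain |q (x, y)|, which is what prevents concentration. *)
Lemma trunc_le_young (s a1 a2 t : R) : 0 < s -> 0 <= a1 -> 0 <= a2 ->
  trunc (s ^+ 3) t <= (a1 <= s ^+ 2)%R%:R * (t ^+ 2 / s ^+ 3) +
     (a2 <= s ^+ 2)%R%:R * (t ^+ 2 / s ^+ 3) +
     ((s ^+ 2 < a1)%R%:R * (t ^+ 2 / (2 * s * a1)) + a1 * a2 / (2 * s)).
Proof.
move=> s0 a10 a20; rewrite /trunc -[t ^+ 2]real_normK ?num_real//.
set u := `|t|; have u0 : 0 <= u by exact: normr_ge0.
have s30 : 0 < s ^+ 3 by rewrite exprn_gt0.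
have A0 : 0 <= u ^+ 2 / s ^+ 3 by rewrite divr_ge0 ?sqr_ge0// ltW.
have B0 : 0 <= u ^+ 2 / (2 * s * a1).
  by rewrite divr_ge0 ?sqr_ge0// mulr_ge0// mulr_ge0// ltW.
have C0 : 0 <= a1 * a2 / (2 * s) by rewrite divr_ge0 ?mulr_ge0// ltW.
case: ltP => su; last first.
  by apply: addr_ge0; apply: addr_ge0 => //; apply: mulr_ge0 => //; exact: ler0n.
have A1 : u <= u ^+ 2 / s ^+ 3.
  by rewrite ler_pdivlMr// expr2; apply: ler_wpM2l => //; exact: ltW.
case: (leP a1 (s ^+ 2)) => a1s; case: (leP a2 (s ^+ 2)) => a2s;
  rewrite ?mul1r ?mul0r; try lra.
rewrite !add0r.
have a1p : 0 < a1 by apply: le_lt_trans a1s; exact: sqr_ge0.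
have : a1 * s / 2 <= a1 * a2 / (2 * s).
  rewrite ler_pdivlMr; last by rewrite mulr_gt0.
  have -> : a1 * s / 2 * (2 * s) = a1 * s ^+ 2 by field.
  by apply: ler_wpM2l => //; exact: ltW.
move=> HX; apply: (@le_trans _ _ (u ^+ 2 / (2 * s * a1) + a1 * s / 2)); last by rewrite lerD2l.
rewrite -subr_ge0.
have -> : u ^+ 2 / (2 * s * a1) + a1 * s / 2 - u = (u - s * a1) ^+ 2 / (2 * s * a1).
  by field; rewrite !gt_eqF.
by rewrite divr_ge0 ?sqr_ge0// mulr_ge0// mulr_ge0// ltW.
Qed.

Lemma measurable_trunc M : measurable_fun setT (trunc M).
Proof.
apply: measurable_fun_ifT; [|exact: normr_measurable|exact: measurable_cst].
by apply: measurable_fun_ltr; [exact: measurable_cst|exact: normr_measurable].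
Qed.

Lemma trunc_ge0 M t : 0 <= trunc M t.
Proof. by rewrite /trunc; case: ifP. Qed.

End StrictConvexity.

(** * Uniform integrability of antisymmetric fluxes *)

Section UniformIntegrability.
Context d (T : measurableType d) (R : realType).
Variable mu : {sigma_finite_measure set T -> \bar R}.
Local Notation pi := (mu \x mu)%E.

Lemma integral_row_weight (c : T -> R) (q : T * T -> R) :
  measurable_fun setT c -> measurable_fun setT q -> (forall x, 0 <= c x) ->
  (\int[pi]_z (c z.1 * (q z) ^+ 2)%:E = \int[mu]_x ((c x)%:E * rowsq mu q x))%E.
Proof.
move=> mc mq c0.
have mc1 : measurable_fun setT (fun z : T * T => c z.1).
  exact: (measurableT_comp mc measurable_fst).
rewrite fubini_tonelli1//; last 2 first.
- by meas.
- by move=> z; rewrite lee_fin mulr_ge0 ?sqr_ge0.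
apply: eq_integral => x _; rewrite /fubini_F /=.
under eq_integral do rewrite EFinM.
have mqx := measurable_row x mq.
by rewrite ge0_integralZl//; [meas|move=> y _; rewrite lee_fin sqr_ge0|rewrite lee_fin].
Qed.

Lemma integral_col_weight (c : T -> R) (q : T * T -> R) :
  measurable_fun setT c -> measurable_fun setT q -> (forall x, 0 <= c x) ->
  (forall x y, (q (x, y)) ^+ 2 = (q (y, x)) ^+ 2) ->
  (\int[pi]_z (c z.2 * (q z) ^+ 2)%:E = \int[mu]_x ((c x)%:E * rowsq mu q x))%E.
Proof.
move=> mc mq c0 qC.
have mc2 : measurable_fun setT (fun z : T * T => c z.2).
  exact: (measurableT_comp mc measurable_snd).
rewrite fubini_tonelli2//; last 2 first.
- by meas.
- by move=> z; rewrite lee_fin mulr_ge0 ?sqr_ge0.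
apply: eq_integral => x _; rewrite /fubini_G /=.
under eq_integral do rewrite EFinM qC.
have mqx := measurable_row x mq.
by rewrite ge0_integralZl//; [meas|move=> y _; rewrite lee_fin sqr_ge0|rewrite lee_fin].
Qed.

(** Integration of [trunc_le_young]. The level s^3 against the row threshold s^2 makes each of the
    first two terms at most s^2 A / s^3 = A / s; the last two give A / (2 s) and A^2 / (2 s). *)
Lemma trunc_integral_le (q : T * T -> R) (A s : R) :
  measurable_fun setT q -> (forall x y, (q (x, y)) ^+ 2 = (q (y, x)) ^+ 2) ->
  0 <= A -> (N12 mu q <= A%:E)%E -> 0 < s ->
  (\int[pi]_z (trunc (s ^+ 3) (q z))%:E <= ((5 / 2 * A + A ^+ 2 / 2) / s)%:E)%E.
Proof.
move=> mq qC A0 NA s0.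
have mr := measurable_rown mu mq.
have mrs := measurable_rowsq mu mq.
have rfin : {ae mu, forall x, rown mu q x < +oo}%E.
  have ir : mu.-integrable setT (rown mu q).
    apply/integrableP; split => //.
    under eq_integral do rewrite gee0_abs ?rown_ge0//.
    by apply: le_lt_trans NA _; rewrite ltry.
  apply: filterS (integrable_ae measurableT ir) => x /(_ I).
  by rewrite ge0_fin_numE ?rown_ge0.
(* [fine] sends an infinite row norm to 0; such rows form a null set. *)
pose a x := fine (rown mu q x).
have ma : measurable_fun setT a by apply: (measurableT_comp _ mr); exact: fine_measurable.
have a0 x : 0 <= a x by rewrite fine_ge0// rown_ge0.
have ar x : ((a x)%:E <= rown mu q x)%E.
  rewrite /a; have := rown_ge0 mu q x; by case: (rown mu q x).
pose A1 := [set x | ((a x)%:E <= (s ^+ 2)%:E)%E].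
pose A2 := [set x | ((s ^+ 2)%:E < (a x)%:E)%E].
have mA1 : measurable A1.
  by rewrite -[A1]setTI; apply: emeasurable_fun_infty_c => //; meas.
have mA2 : measurable A2 by apply: measurable_gt_set; meas.
have A1E x : \1_A1 x = (a x <= s ^+ 2)%R%:R :> R.
  rewrite indicE (_ : (x \in A1) = (a x <= s ^+ 2))//.
  by apply/idP/idP; rewrite inE /A1 /= lee_fin.
have A2E x : \1_A2 x = (s ^+ 2 < a x)%R%:R :> R.
  rewrite indicE (_ : (x \in A2) = (s ^+ 2 < a x))//.
  by apply/idP/idP; rewrite inE /A2 /= lte_fin.
pose c1 x : R := \1_A1 x / s ^+ 3.
pose c2 x : R := \1_A2 x / (2 * s * a x).
have mc1 : measurable_fun setT c1 by rewrite /c1; meas.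
have mc2 : measurable_fun setT c2.
  rewrite /c2; apply: measurable_funM; first by meas.
  rewrite (_ : (fun _ => _) = (fun x => (2 * s * a x) `^ (-1))).
    apply: (measurableT_comp (f := fun t : R => t `^ (-1))); first exact: measurable_powR.
    by meas.
  by apply/funext => x; rewrite powR_inv1// mulr_ge0// mulr_ge0// ltW.
have c10 x : 0 <= c1 x by rewrite divr_ge0// exprn_ge0// ltW.
have c20 x : 0 <= c2 x by rewrite divr_ge0// mulr_ge0// mulr_ge0// ltW.
pose F1 z := c1 z.1 * q z ^+ 2.
pose F2 z := c1 z.2 * q z ^+ 2.
pose F3 z := c2 z.1 * q z ^+ 2.
pose F4 (z : T * T) := a z.1 * a z.2 / (2 * s).
have mF1 : measurable_fun setT F1.
  by apply: measurable_funM; [exact: (measurableT_comp mc1 measurable_fst)|meas].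
have mF2 : measurable_fun setT F2.
  by apply: measurable_funM; [exact: (measurableT_comp mc1 measurable_snd)|meas].
have mF3 : measurable_fun setT F3.
  by apply: measurable_funM; [exact: (measurableT_comp mc2 measurable_fst)|meas].
have mF4 : measurable_fun setT F4.
  apply: measurable_funM; last by meas.
  by apply: measurable_funM; [exact: (measurableT_comp ma measurable_fst)|
    exact: (measurableT_comp ma measurable_snd)].
have F10 z : 0 <= F1 z by rewrite mulr_ge0 ?sqr_ge0.
have F20 z : 0 <= F2 z by rewrite mulr_ge0 ?sqr_ge0.
have F30 z : 0 <= F3 z by rewrite mulr_ge0 ?sqr_ge0.
have F40 z : 0 <= F4 z by rewrite divr_ge0 ?mulr_ge0// ltW.
have mt : measurable_fun setT (fun z => trunc (s ^+ 3) (q z)).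
  exact: (measurableT_comp (@measurable_trunc R _) mq).
apply: (@le_trans _ _ (\int[pi]_z (F1 z + F2 z + (F3 z + F4 z))%:E)%E).
  apply: ge0_le_integral => //.
  - by move=> z _; rewrite lee_fin trunc_ge0.
  - by meas.
  - by meas.
  - move=> z _; rewrite lee_fin.
    have := @trunc_le_young R s (a z.1) (a z.2) (q z) s0 (a0 _) (a0 _).
    by rewrite /F1 /F2 /F3 /F4 /c1 /c2 -!A1E -!A2E !(mulrAC _ _^-1 (q z ^+ 2)) -!mulrA.
have I1 : (\int[mu]_x ((c1 x)%:E * rowsq mu q x) <= (A / s)%:E)%E.
  apply: (@le_trans _ _ ((1 / s)%:E * N12 mu q)%E); last first.
    rewrite (_ : A / s = 1 / s * A); last by field; rewrite gt_eqF.
    by rewrite [X in (_ <= X)%E]EFinM; apply: lee_wpmul2l => //; rewrite lee_fin divr_ge0// ltW.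
  rewrite /N12 -ge0_integralZl//; last 2 first.
  - by move=> x _; exact: rown_ge0.
  - by rewrite lee_fin divr_ge0// ltW.
  apply: ae_ge0_le_integral => //.
  - by move=> x _; rewrite mule_ge0 ?lee_fin ?rowsq_ge0.
  - by apply: emeasurable_funM => //; meas.
  - by move=> x _; rewrite mule_ge0 ?rown_ge0// lee_fin divr_ge0// ltW.
  - exact: emeasurable_funM.
  apply: filterS rfin => x rx _.
  rewrite /c1 A1E; have [ax|ax] := leP (a x) (s ^+ 2); last first.
    by rewrite /= mulr0n mul0r mul0e mule_ge0 ?rown_ge0// lee_fin divr_ge0// ltW.
  have H : (rowsq mu q x <= (s ^+ 2)%:E * rown mu q x)%E.
    apply: rowsq_le_rown; rewrite -[rown mu q x]fineK ?ge0_fin_numE ?rown_ge0//.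
  apply: (@le_trans _ _ ((1 / s ^+ 3)%:E * ((s ^+ 2)%:E * rown mu q x))%E).
    by apply: lee_wpmul2l => //; rewrite lee_fin divr_ge0// exprn_ge0// ltW.
  rewrite muleA -EFinM (_ : 1 / s ^+ 3 * s ^+ 2 = 1 / s)//.
  by field; rewrite gt_eqF.
have I3 : (\int[mu]_x ((c2 x)%:E * rowsq mu q x) <= (A / (2 * s))%:E)%E.
  have s20 : 0 <= 1 / (2 * s) by rewrite divr_ge0// mulr_ge0// ltW.
  apply: (@le_trans _ _ ((1 / (2 * s))%:E * N12 mu q)%E); last first.
    rewrite (_ : A / (2 * s) = 1 / (2 * s) * A); last by field; rewrite gt_eqF.
    by rewrite [X in (_ <= X)%E]EFinM; apply: lee_wpmul2l.
  rewrite /N12 -ge0_integralZl//; last by move=> x _; exact: rown_ge0.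
  apply: ae_ge0_le_integral => //.
  - by move=> x _; rewrite mule_ge0 ?lee_fin ?rowsq_ge0.
  - by apply: emeasurable_funM => //; meas.
  - by move=> x _; rewrite mule_ge0 ?rown_ge0// lee_fin.
  - exact: emeasurable_funM.
  apply: filterS rfin => x rx _.
  rewrite /c2 A2E; have [ax|ax] := ltP (s ^+ 2) (a x); last first.
    by rewrite /= mulr0n mul0r mul0e mule_ge0 ?rown_ge0// lee_fin.
  have axp : 0 < a x by apply: le_lt_trans ax; exact: sqr_ge0.
  have H : (rowsq mu q x <= (a x)%:E * rown mu q x)%E.
    apply: rowsq_le_rown; rewrite -[leLHS]fineK ?ge0_fin_numE ?rown_ge0//.
  apply: (@le_trans _ _ ((1 / (2 * s * a x))%:E * ((a x)%:E * rown mu q x))%E).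
    by apply: lee_wpmul2l => //; rewrite lee_fin divr_ge0// ltW// mulr_gt0// mulr_gt0.
  rewrite muleA -EFinM (_ : 1 / (2 * s * a x) * a x = 1 / (2 * s))//.
  by field; rewrite !gt_eqF.
have I4 : (\int[pi]_z (F4 z)%:E <= (A ^+ 2 / (2 * s))%:E)%E.
  have Ia : (\int[mu]_x (a x)%:E <= A%:E)%E.
    apply: le_trans NA; apply: ge0_le_integral => //.
    - by move=> x _; rewrite lee_fin.
    - by meas.
  have s20 : 0 <= 1 / (2 * s) by rewrite divr_ge0// mulr_ge0// ltW.
  rewrite fubini_tonelli1//; last by meas.
  rewrite (_ : fubini_F _ _ = fun x => ((a x)%:E * ((1 / (2 * s))%:E * \int[mu]_y (a y)%:E))%E); last first.
    apply/funext => x; rewrite /fubini_F /F4 /= -ge0_integralZl//; last 2 first.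
    - by meas.
    - by move=> y _; rewrite lee_fin.
    rewrite -ge0_integralZl//; last 3 first.
    - by meas.
    - by move=> y _; rewrite -EFinM lee_fin mulr_ge0.
    - by rewrite lee_fin.
    apply: eq_integral => y _; rewrite -!EFinM; congr EFin.
    by field; rewrite gt_eqF.
  rewrite ge0_integralZr//; last 3 first.
  - by meas.
  - by move=> x _; rewrite lee_fin.
  - by rewrite mule_ge0 ?lee_fin// integral_ge0// => x _; rewrite lee_fin.
  apply: (@le_trans _ _ (A%:E * ((1 / (2 * s))%:E * A%:E))%E).
    apply: lee_pmul => //.
    - by apply: integral_ge0 => x _; rewrite lee_fin.
    - by rewrite mule_ge0 ?lee_fin// integral_ge0// => x _; rewrite lee_fin.
    - by apply: lee_wpmul2l.
  rewrite -!EFinM lee_fin le_eqVlt; apply/orP; left; apply/eqP.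
  by field; rewrite gt_eqF.
rewrite (_ : (5 / 2 * A + A ^+ 2 / 2) / s =
   A / s + A / s + (A / (2 * s) + A ^+ 2 / (2 * s))); last by field; rewrite gt_eqF.
have E1 : (\int[pi]_z (F1 z)%:E <= (A / s)%:E)%E by rewrite integral_row_weight.
have E2 : (\int[pi]_z (F2 z)%:E <= (A / s)%:E)%E by rewrite integral_col_weight.
have E3 : (\int[pi]_z (F3 z)%:E <= (A / (2 * s))%:E)%E by rewrite integral_row_weight.
under eq_integral do rewrite EFinD.
rewrite ge0_integralD//; last 4 first.
- by move=> z _; rewrite lee_fin addr_ge0.
- by meas.
- by move=> z _; rewrite lee_fin addr_ge0.
- by meas.
rewrite EFinD; apply: leeD.
- under eq_integral do rewrite EFinD.
  rewrite ge0_integralD//; last 4 first.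
  - by move=> z _; rewrite lee_fin.
  - by meas.
  - by move=> z _; rewrite lee_fin.
  - by meas.
  by rewrite EFinD; apply: leeD; [exact: E1|exact: E2].
- under eq_integral do rewrite EFinD.
  rewrite ge0_integralD//; last 4 first.
  - by move=> z _; rewrite lee_fin.
  - by meas.
  - by move=> z _; rewrite lee_fin.
  - by meas.
  by rewrite EFinD; apply: leeD; [exact: E3|exact: I4].
Qed.

End UniformIntegrability.

(** * Lower semicontinuity of the norm and L^1 distances between admissible fluxes *)

Section Minimizer.
Context d (T : measurableType d) (R : realType).
Variable mu : {sigma_finite_measure set T -> \bar R}.
Local Notation pi := (mu \x mu)%E.

Lemma limn_einfE (u : nat -> \bar R) : limn_einf u = ereal_sup (range (einfs u)).
Proof. by rewrite limn_einf_lim; apply/cvg_lim => //; exact: cvg_einfs_sup. Qed.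

Lemma limn_einf_ge0 (u : nat -> \bar R) : (forall k, 0 <= u k)%E ->
  (0 <= limn_einf u)%E.
Proof.
move=> u0; rewrite limn_einfE; apply: le_ereal_sup_tmp; exists (einfs u 0%N).
  by exists 0%N.
by apply: le_ereal_inf_tmp => _ [j _ <-].
Qed.

(** Fatou's lemma will be applied twice in [N12_fatou], inside each row and then across the rows,
    and this carries the lower limit through the square root in between. *)
Lemma limn_einf_sqrt_le (u : nat -> \bar R) : (forall k, 0 <= u k)%E ->
  (limn_einf u `^ 2^-1 <= limn_einf (fun k => u k `^ 2^-1))%E.
Proof.
move=> u0; set y := limn_einf (fun k => u k `^ 2^-1)%E.
have y0 : (0 <= y)%E by apply: limn_einf_ge0 => k; exact: poweR_ge0.
have [yoo|yoo] := eqVneq y +oo%E; first by rewrite yoo leey.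
have yf : y \is a fin_num by rewrite ge0_fin_numE// lt_neqAle yoo leey.
apply/lee_addgt0Pr => e e0.
pose r := fine y + e.
have r0 : 0 <= r by rewrite addr_ge0 ?fine_ge0// ltW.
have yr : (y < r%:E)%E by rewrite -[y]fineK// lte_fin /r ltrDl.
suff H : (limn_einf u <= (r ^+ 2)%:E)%E.
  rewrite (_ : (y + e%:E)%E = r%:E); last by rewrite /r EFinD fineK.
  rewrite (_ : r = (r ^+ 2) `^ 2^-1); last by rewrite powR12_sqrt ?sqr_ge0// sqrtr_sqr ger0_norm.
  rewrite -poweR_EFin; apply: gt0_ler_poweR => //; rewrite in_itv/= leey andbT.
    exact: limn_einf_ge0.
  by rewrite lee_fin sqr_ge0.
rewrite limn_einfE; apply: ge_ereal_sup => _ [k _ <-].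
have : (einfs (fun k => u k `^ 2^-1)%E k < r%:E)%E.
  apply: le_lt_trans yr; rewrite /y limn_einfE; apply: le_ereal_sup_tmp.
  by exists (einfs (fun k => u k `^ 2^-1)%E k) => //; exists k.
move=> /ereal_inf_lt[_ [j /= kj <-] uj].
apply: ge_ereal_inf; exists (u j); first by exists j.
move: uj; have := u0 j; case: (u j) => [t| |]//.
  rewrite poweR_EFin lte_fin !lee_fin => t0; rewrite powR12_sqrt// => tr.
  rewrite -[leLHS]sqr_sqrtr// ler_sqr ?nnegrE ?sqrtr_ge0//; exact: ltW.
by rewrite poweRyr ?invr_neq0.
Qed.

Lemma N12_fatou (q_ : nat -> T * T -> R) (q : T * T -> R) (c : \bar R) :
  (forall k, measurable_fun setT (q_ k)) ->
  (forall z, q_ ^~ z @ \oo --> q z) ->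
  (\forall k \near \oo, N12 mu (q_ k) <= c)%E -> (N12 mu q <= c)%E.
Proof.
move=> mq qq Nq.
have mqq : measurable_fun setT q by apply: (measurable_fun_cvg mq) => z _; exact: qq.
have H x : (rown mu q x <= limn_einf (fun k => rown mu (q_ k) x))%E.
  apply: le_trans (limn_einf_sqrt_le _); last by move=> k; exact: rowsq_ge0.
  apply: gt0_ler_poweR => //; rewrite ?in_itv/= ?leey ?rowsq_ge0//.
    by rewrite andbT; apply: limn_einf_ge0 => k; exact: rowsq_ge0.
  have -> : rowsq mu q x = (\int[mu]_y (limn_einf (fun k => ((q_ k (x, y)) ^+ 2)%:E)))%E.
    apply: eq_integral => y _; apply/esym.
    have H : (fun k => ((q_ k (x, y)) ^+ 2)%:E) @ \oo --> ((q (x, y)) ^+ 2)%:E.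
      have H' : (fun k => q_ k (x, y) ^+ 2) @ \oo --> q (x, y) ^+ 2.
        by rewrite expr2; under eq_fun do rewrite expr2; apply: cvgM; exact: qq.
      by apply: cvg_comp H' _; exact: cvg_refl.
    by rewrite is_cvg_limn_einfE ?(cvg_lim _ H)//; apply/cvg_ex; eexists; exact: H.
  apply: fatou => //.
    by move=> k; have := measurable_row x (mq k) => ?; meas.
  by move=> k y _; rewrite lee_fin sqr_ge0.
apply: (@le_trans _ _ (\int[mu]_x limn_einf (fun k => rown mu (q_ k) x)))%E.
  apply: ge0_le_integral => //.
  - by move=> x _; exact: rown_ge0.
  - exact: measurable_rown.
  - have h : measurable_fun setT (fun x => limn_esup (fun k => - rown mu (q_ k) x)%E).
      apply: measurable_fun_limn_esup => k.
      apply: (measurableT_comp (f := -%E)) => //.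
      exact: measurable_rown.
    exact: (measurableT_comp (@oppe_measurable R setT) h).
apply: le_trans.
  apply: fatou => //; first by move=> k; exact: measurable_rown.
  by move=> k x _; exact: rown_ge0.
rewrite limn_einf_lim; apply: lime_le; first exact: is_cvg_einfs.
near=> k; apply: ge_ereal_inf; exists (N12 mu (q_ k)); first by exists k => //=.
by near: k.
Unshelve. all: by end_near. Qed.

Variables (O D : set T) (K : T * T -> R).
Hypothesis mD : measurable D.
Variable m : R.
Hypothesis m0 : 0 <= m.
Hypothesis muDm : (mu D <= m%:E)%E.
Variable f : T -> R.

(* The weak form of D q = f.  The integrals converge because the rows of
   [grad K v] are bounded in L^2; no L^2 bound on [q] is required. *)
Definition inQ (q : T * T -> R) :=
  [/\ measurable_fun setT q, supp D q, (forall x y, q (x, y) = - q (y, x)),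
    (N12 mu q < +oo)%E &
    forall v (C : R), 0 <= C -> inU mu O K v ->
      {ae mu, forall x, rown mu (grad K v) x <= C%:E}%E ->
      ip pi q (grad K v) = - ip mu f v].

(* Potentials whose gradient is, up to an error small in L^{oo,2}, bounded:
   testing against them is continuous along L^1-convergent fluxes with bounded
   L^{1,2} norm. *)
Definition regular (v : T -> R) :=
  [/\ inU mu O K v,
      exists C : R, 0 <= C /\ {ae mu, forall x, rown mu (grad K v) x <= C%:E}%E &
      forall e : R, 0 < e -> exists (b : T * T -> R) (B : R),
        [/\ measurable_fun setT b, 0 <= B, forall z, `|b z| <= B &
          {ae mu, forall x, rown mu (fun z => grad K v z - b z)%R x <= e%:E}%E]].

(** Pairing with the indicator of [D] in the second variable, whose rows have norm sqrt (mu D), at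
    most (1 + m) / 2. *)
Lemma L1_N12 (q : T * T -> R) : measurable_fun setT q -> supp D q ->
  (\int[pi]_z (`|q z|)%:E <= (m + 1)%:E * N12 mu q)%E.
Proof.
move=> mq sq.
have mX : measurable_fun setT (fun z : T * T => \1_D z.2 : R).
  exact: (measurableT_comp (measurable_indic mD) measurable_snd).
have m1 : 0 <= m + 1 by rewrite addr_ge0.
rewrite (_ : (fun z => (`|q z|)%:E) = (fun z => (`|q z * \1_D z.2|)%:E)).
  apply: pair_le => //; apply: aeW => x.
  apply: le_trans (rown_young mu _ x ltr01) _.
  have -> : rowsq mu (fun z : T * T => \1_D z.2) x = mu D.
    rewrite /rowsq /= (_ : mu D = \int[mu]_x (\1_D x)%:E)%E; last by rewrite integral_indic// setIT.
    apply: eq_integral => y _; rewrite indicE.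
    by case: (_ \in _); rewrite ?expr1n ?expr0n.
  apply: (@le_trans _ _ ((1 / 2)%:E + (1 / (2 * 1))%:E * m%:E)%E).
    by apply: leeD => //; apply: lee_wpmul2l => //; rewrite lee_fin divr_ge0// mulr1.
  rewrite -EFinM -EFinD lee_fin.
  have -> : 1 / 2 + 1 / (2 * 1) * m = 1/2 + m / 2 :> R by field.
  have : m / 2 <= m by rewrite ler_pdivrMr// ler_peMr// ler1n.
  by move=> H; rewrite addrC lerD// ler_pdivrMr// mul1r ler1n.
apply/funext => -[x y] /=; have [Dy|nDy] := pselect (D y).
  by rewrite indicE mem_set// mulr1.
by rewrite sq ?mul0r// => -[].
Qed.

Lemma supp_integrable (q : T * T -> R) : measurable_fun setT q -> supp D q ->
  (N12 mu q < +oo)%E -> pi.-integrable setT (EFin \o q).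
Proof.
move=> mq sq Nq; apply/integrableP; split; first by meas.
apply: le_lt_trans (L1_N12 mq sq) _.
by rewrite lte_mul_pinfty ?lee_fin ?addr_ge0.
Qed.

Lemma phi_integrable (q : T * T -> R) : measurable_fun setT q -> supp D q ->
  (N12 mu q < +oo)%E -> pi.-integrable setT (EFin \o (fun z => phi (q z))).
Proof.
move=> mq sq Nq; apply: le_integrable (supp_integrable mq sq Nq) => //.
  by apply: measurable_funEFin; exact: (measurableT_comp (@measurable_phi R) mq).
move=> z _ /=; rewrite lee_fin ger0_norm ?phi_ge0//; exact: phi_le.
Qed.

Lemma inQ_mid p q : inQ p -> inQ q -> inQ (fun z => (p z + q z) / 2).
Proof.
move=> [mp sp ap Np ip_] [mq sq aq Nq iq].
have Nm : (N12 mu (fun z => p z + q z)%R < +oo)%E.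
  exact: (le_lt_trans (N12D mu mp mq) (lte_add_pinfty Np Nq)).
have mpq : measurable_fun setT (fun z => p z + q z) by meas.
split.
- by meas.
- by move=> x y n; rewrite sp// sq// addr0 mul0r.
- by move=> x y; rewrite ap aq -opprD mulNr.
- under eq_fun do rewrite mulrC.
  by rewrite N12Z// lte_mul_pinfty// lee_fin.
- move=> v C C0 Uv rv.
  have mg : measurable_fun setT (grad K v) by have [_ _ []] := Uv.
  have i1 := pair_integrable C0 mp mg Np rv.
  have i2 := pair_integrable C0 mq mg Nq rv.
  have i3 := pair_integrable C0 mpq mg Nm rv.
  have e1 := ip_ v C C0 Uv rv; have e2 := iq v C C0 Uv rv.
  have e3 : ip pi (fun z => p z + q z) (grad K v) = ip pi p (grad K v) + ip pi q (grad K v).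
    by rewrite /ip -RintegralD//; apply: eq_Rintegral => z _; rewrite mulrDl.
  have -> : ip pi (fun z => (p z + q z) / 2) (grad K v) =
     2^-1 * ip pi (fun z => p z + q z) (grad K v).
    by rewrite /ip -RintegralZl//; apply: eq_Rintegral => z _; ring.
  by rewrite e3 e1 e2; field.
Qed.

Lemma N12_mid p q (c : R) : measurable_fun setT p -> measurable_fun setT q ->
  (N12 mu p <= c%:E)%E -> (N12 mu q <= c%:E)%E ->
  (N12 mu (fun z => (p z + q z) / 2)%R <= c%:E)%E.
Proof.
move=> mp mq Np Nq; under eq_fun do rewrite mulrC.
have mpq : measurable_fun setT (fun z => p z + q z) by meas.
rewrite N12Z// ger0_norm//.
apply: (@le_trans _ _ ((2^-1)%:E * (c%:E + c%:E))%E).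
  apply: lee_wpmul2l; first by rewrite lee_fin.
  exact: (le_trans (N12D mu mp mq) (leeD Np Nq)).
by rewrite -EFinD -EFinM lee_fin le_eqVlt; apply/orP; left; apply/eqP; field.
Qed.

(** The three terms are the tails of both fluxes above s^3, the constant [l] spread over D x D, and
    the midpoint defect of the energy. The coefficient of the last depends on [s] and [l], so these
    are fixed before the defect is made small. *)
Lemma L1_dist_le (p q : T * T -> R) (A s l : R) :
  inQ p -> inQ q -> 0 <= A -> 0 < s -> 0 < l ->
  (N12 mu p <= A%:E)%E -> (N12 mu q <= A%:E)%E ->
  (\int[pi]_z (`|p z - q z|)%:E <=
   (4 * ((5 / 2 * A + A ^+ 2 / 2) / s) + l * m ^+ 2 + (s ^+ 3 + 1) ^+ 3 / l *
   (\int[pi]_z phi (p z) + \int[pi]_z phi (q z) -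
    2 * \int[pi]_z phi ((p z + q z) / 2))%R)%:E)%E.
Proof.
move=> Qp Qq A0 s0 l0 Np Nq.
have [mp sp ap Npf _] := Qp; have [mq sq aq Nqf _] := Qq.
have [mm sm _ Nmf _] := inQ_mid Qp Qq.
have ip := phi_integrable mp sp Npf; have iq := phi_integrable mq sq Nqf.
have im := phi_integrable mm sm Nmf.
pose c := (s ^+ 3 + 1) ^+ 3 / l.
have s30 : 0 <= s ^+ 3 by rewrite exprn_ge0// ltW.
have c0 : 0 <= c by rewrite divr_ge0 ?exprn_ge0 ?addr_ge0// ltW.
pose De z := phi (p z) + phi (q z) - 2 * phi ((p z + q z) / 2).
have mphi := @measurable_phi R.
have mpp : measurable_fun setT (fun z => phi (p z)) by exact: (measurableT_comp mphi mp).
have mpq : measurable_fun setT (fun z => phi (q z)) by exact: (measurableT_comp mphi mq).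
have mpm : measurable_fun setT (fun z => phi ((p z + q z) / 2)).
  exact: (measurableT_comp mphi mm).
have mDe : measurable_fun setT De by rewrite /De; meas.
have De0 z : 0 <= De z by exact: phi_midpoint_ge0.
have im2 : pi.-integrable setT (EFin \o (fun z => 2 * phi ((p z + q z) / 2))).
  exact: (integrableZl measurableT 2 im).
have ipq : pi.-integrable setT (EFin \o (fun z => phi (p z) + phi (q z))).
  exact: (integrableD measurableT ip iq).
have iDe : pi.-integrable setT (EFin \o De) by exact: (integrableB measurableT ipq im2).
have DeE : (\int[pi]_z (De z)%:E = (\int[pi]_z phi (p z) + \int[pi]_z phi (q z) -
    2 * \int[pi]_z phi ((p z + q z) / 2))%R%:E)%E.
  rewrite -RintegralD// -RintegralZl// -RintegralB//.
  by rewrite /Rintegral fineK//; exact: integrable_fin_num iDe.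
pose tp z := trunc (s ^+ 3) (p z); pose tq z := trunc (s ^+ 3) (q z).
have mtp : measurable_fun setT tp by exact: (measurableT_comp (@measurable_trunc R _) mp).
have mtq : measurable_fun setT tq by exact: (measurableT_comp (@measurable_trunc R _) mq).
have tp0 z : 0 <= tp z by exact: trunc_ge0.
have tq0 z : 0 <= tq z by exact: trunc_ge0.
have Itp : (\int[pi]_z (tp z)%:E <= ((5 / 2 * A + A ^+ 2 / 2) / s)%:E)%E.
  by apply: trunc_integral_le => // x y; rewrite ap sqrrN.
have Itq : (\int[pi]_z (tq z)%:E <= ((5 / 2 * A + A ^+ 2 / 2) / s)%:E)%E.
  by apply: trunc_integral_le => // x y; rewrite aq sqrrN.
have mDD : measurable (D `*` D) by exact: measurableX.
pose X (z : T * T) : R := \1_(D `*` D) z.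
have mX : measurable_fun setT X by exact: measurable_indic.
have IX : (\int[pi]_z (X z)%:E <= (m ^+ 2)%:E)%E.
  rewrite integral_indic// setIT.
  apply: (@le_trans _ _ (mu D * mu D)%E).
    by rewrite le_eqVlt; apply/orP; left; apply/eqP; exact: (product_measure1E mu mu mD mD).
  by rewrite expr2 EFinM; apply: lee_pmul.
set r := (_ / s) in Itp Itq *.
have mt2 : measurable_fun setT (fun z => 2 * (tp z + tq z)) by meas.
have mlX : measurable_fun setT (fun z => l * X z) by meas.
have mcD : measurable_fun setT (fun z => c * De z) by meas.
have ttq0 z : 0 <= tp z + tq z by rewrite addr_ge0.
have t20 z : 0 <= 2 * (tp z + tq z) by rewrite mulr_ge0.
have X0 z : 0 <= X z by rewrite /X.
have lX0 z : 0 <= l * X z by rewrite mulr_ge0// ltW.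
have cD0 z : 0 <= c * De z by rewrite mulr_ge0.
apply: (@le_trans _ _ (\int[pi]_z (2 * (tp z + tq z) + (l * X z + c * De z))%:E)%E).
  apply: ge0_le_integralR => //; [by meas|by meas|].
  move=> z; rewrite /X indicE; have [DD|nDD] := boolP (z \in D `*` D).
    by rewrite mulr1 mulrDr; exact: dist_le_midpoint.
  have zD : ~ (D z.1 /\ D z.2) by move: nDD; rewrite notin_setE.
  case: z zD nDD => x y /= zD _; rewrite sp// sq// subrr normr0 mulr0 add0r.
  by apply: addr_ge0; [exact: t20|exact: cD0].
rewrite ge0_integralDR//; [|by meas|by move=> z; rewrite addr_ge0].
rewrite -[X in (_ <= X%:E)%E]addrA [leRHS]EFinD; apply: leeD.
  rewrite ge0_integralZlR//; last by meas.
  rewrite (_ : 4 * r = 2 * (r + r)); last by ring.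
  rewrite EFinM; apply: lee_wpmul2l; first by rewrite lee_fin.
  rewrite ge0_integralDR// EFinD; apply: leeD; [exact: Itp|exact: Itq].
rewrite ge0_integralDR// EFinD; apply: leeD.
  rewrite ge0_integralZlR//; last exact: ltW.
  by rewrite EFinM; apply: lee_wpmul2l; [rewrite lee_fin ltW|exact: IX].
by rewrite ge0_integralZlR// DeE -EFinM.
Qed.

End Minimizer.

Section Existence.
Context d (T : measurableType d) (R : realType).
Variable mu : {sigma_finite_measure set T -> \bar R}.
Local Notation pi := (mu \x mu)%E.
Variables (O D : set T) (K : T * T -> R).
Hypothesis mD : measurable D.
Variable m : R.
Hypothesis m0 : 0 <= m.
Hypothesis muDm : (mu D <= m%:E)%E.
Variable f : T -> R.
Local Notation inQ := (inQ mu O D K f).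

(** [a], [b] and [c] are the energies of two near-minimisers and of their midpoint, [i], [j] and [k]
    the energy infima over the classes containing them, [s] the supremum of all such infima. *)
Lemma midpoint_defect_le (a b c s e i j k p q : R) :
  a <= i + p -> b <= j + q -> p <= e -> q <= e -> i <= s -> j <= s ->
  s - e < k -> k <= c -> a + b - 2 * c <= 4 * e.
Proof. lra. Qed.

Lemma L1_cauchy_subsequence (g : nat -> T * T -> R) :
  (forall e : R, 0 < e -> exists N : nat, forall k l, (N <= k)%N -> (N <= l)%N ->
     (\int[pi]_z (`|g k z - g l z|)%:E <= e%:E)%E) ->
  exists n_ : nat -> nat, (forall j, (j <= n_ j)%N) /\
    forall j l, (j <= l)%N ->
      (\int[pi]_z (`|g (n_ l) z - g (n_ j) z|)%:E <= (1 / (2 ^ j.+1)%:R)%:E)%E.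
Proof.
move=> H.
have e0 (j : nat) : 0 < 1 / (2 ^ j.+1)%:R :> R by rewrite divr_gt0// ltr0n expn_gt0.
have [N_ HN] := choice (fun j : nat => H _ (e0 j)).
(* At least [j], and at least [N_ i] for every i <= j, without any recursion. *)
pose n_ j := (j + \sum_(i < j.+1) N_ i)%N.
have nN j l : (j <= l)%N -> (N_ j <= n_ l)%N.
  move=> jl; rewrite /n_; apply: leq_trans (leq_addl _ _).
  have jl' : (j < l.+1)%N by [].
  by rewrite (bigD1 (Ordinal jl'))//= leq_addr.
exists n_; split; first by move=> j; exact: leq_addr.
by move=> j l jl; apply: HN; exact: nN.
Qed.

(** Adding the energy to the norm would change the problem, so it is minimised inside the classes
    [Cs k] of near-minimisers. These are convex and decreasing, hence their energy infima increase
    to a finite supremum; midpoints of late terms stay in an early class and cannot have much less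
    energy than the terms themselves. *)
Lemma exists_minimizing_cauchy :
  (exists q, inQ q) ->
  exists (A : R) (h : nat -> T * T -> R),
   [/\ 0 <= A, forall q, inQ q -> (A%:E <= N12 mu q)%E,
       forall k, inQ (h k),
       forall k, (N12 mu (h k) <= (A + 1 / (k.+1)%:R)%:E)%E &
       forall j l, (j <= l)%N ->
         (\int[pi]_z (`|h l z - h j z|)%:E <= (1 / (2 ^ j.+1)%:R)%:E)%E].
Proof.
move=> [q0 Qq0].
pose S := [set fine (N12 mu q) | q in inQ].
have Nfin q : inQ q -> (fine (N12 mu q))%:E = N12 mu q.
  by move=> [_ _ _ Nq _]; rewrite fineK// ge0_fin_numE ?N12_ge0.
have hS : has_inf S.
  split; first by exists (fine (N12 mu q0)), q0.
  by exists 0 => _ [q _ <-]; rewrite fine_ge0// N12_ge0.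
pose A := inf S.
have Alb q : inQ q -> A <= fine (N12 mu q).
  by move=> Qq; apply: ge_inf; [exact: hS.2|exists q].
have A0 : 0 <= A.
  apply: lb_le_inf; first exact: hS.1.
  by move=> _ [q _ <-]; rewrite fine_ge0// N12_ge0.
pose Cs (k : nat) q := inQ q /\ (N12 mu q <= (A + 1 / (k.+1)%:R)%:E)%E.
have Cs0 k : exists q, Cs k q.
  have e0 : 0 < 1 / (k.+1)%:R :> R by rewrite divr_gt0// ltr0n.
  have [_ [q Qq <-] H] := inf_adherent e0 hS.
  by exists q; split => //; rewrite -Nfin// lee_fin ltW.
have Csle k l q : (k <= l)%N -> Cs l q -> Cs k q.
  move=> kl [Qq Nq]; split => //; apply: le_trans Nq _.
  by rewrite lee_fin lerD2l !div1r lef_pV2 ?posrE ?ltr0n// ler_nat.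
pose En (q : T * T -> R) : R := (\int[pi]_z phi (q z))%R.
have En0 q : 0 <= En q by apply: Rintegral_ge0 => z _; exact: phi_ge0.
have EnM k q : Cs k q -> En q <= (m + 1) * (A + 1).
  move=> [[mq sq aq Nq iq] Nk].
  have ip := phi_integrable mD m0 muDm mq sq Nq.
  rewrite -lee_fin /En /Rintegral fineK; last exact: integrable_fin_num ip.
  apply: (@le_trans _ _ (\int[pi]_z (`|q z|)%:E)%E).
    apply: ge0_le_integralR => //; [|by meas|by move=> z; exact: phi_ge0|].
      exact: (measurableT_comp (@measurable_phi R) mq).
    by move=> z; exact: phi_le.
  apply: le_trans (L1_N12 mD m0 muDm mq sq) _.
  rewrite EFinM; apply: lee_wpmul2l; first by rewrite lee_fin addr_ge0.
  apply: le_trans Nk _; rewrite lee_fin lerD2l ler_pdivrMr ?ltr0n// mul1r ler1n//.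
pose I k := En @` (Cs k).
have hI k : has_inf (I k).
  split; first by have [q Cq] := Cs0 k; exists (En q), q.
  by exists 0 => _ [q _ <-].
pose ek k := inf (I k).
have ekM k : ek k <= (m + 1) * (A + 1).
  have [q Cq] := Cs0 k; apply: le_trans (EnM _ _ Cq).
  by apply: ge_inf; [exact: (hI k).2|exists q].
have gex k : exists q, Cs k q /\ En q <= ek k + 1 / (k.+1)%:R.
  have e0 : 0 < 1 / (k.+1)%:R :> R by rewrite divr_gt0// ltr0n.
  have [_ [q Cq <-] H] := inf_adherent e0 (hI k).
  by exists q; split => //; exact: ltW.
have [g Hg] := choice gex.
pose V := range ek.
have hV : has_sup V.
  split; first by exists (ek 0%N), 0%N.
  by exists ((m + 1) * (A + 1)) => _ [k _ <-].
pose es := sup V.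
have eks k : ek k <= es by apply: ub_le_sup; [exact: hV.2|exists k].
have Qg k : inQ (g k) := (Hg k).1.1.
have cauchy (e : R) : 0 < e -> exists N : nat, forall k l, (N <= k)%N -> (N <= l)%N ->
     (\int[pi]_z (`|g k z - g l z|)%:E <= e%:E)%E.
  move=> e0.
  pose A1 := A + 1.
  have A10 : 0 <= A1 by rewrite addr_ge0.
  pose c0 := 5 / 2 * A1 + A1 ^+ 2 / 2.
  have c00 : 0 <= c0 by rewrite addr_ge0 ?mulr_ge0 ?divr_ge0 ?sqr_ge0.
  (* [s], [l0] and then [e1] make each of the three terms of [L1_dist_le] at most e / 3. *)
  pose s := 12 * (c0 + 1) / e.
  have s0 : 0 < s by rewrite divr_gt0// mulr_gt0// ltr_wpDl.
  pose l0 := e / (3 * (m ^+ 2 + 1)).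
  have m20 : 0 < m ^+ 2 + 1 by rewrite ltr_wpDl// sqr_ge0.
  have l00 : 0 < l0 by rewrite divr_gt0// mulr_gt0.
  pose c := (s ^+ 3 + 1) ^+ 3 / l0.
  have c1 : 0 < c.
    by rewrite divr_gt0// exprn_gt0// ltr_wpDl// exprn_ge0// ltW.
  pose e1 := e / (12 * c).
  have e10 : 0 < e1 by rewrite divr_gt0// mulr_gt0.
  have [_ [N1 _ <-] HN1] := sup_adherent e10 hV.
  pose N2 := Num.bound (1 / e1).
  have N2P k : (N2 <= k)%N -> 1 / (k.+1)%:R <= e1.
    move=> Nk; rewrite ler_pdivrMr ?ltr0n// -ler_pdivrMl// mulrC.
    apply: le_trans (ltW (archi_boundP _)) _; first by rewrite divr_ge0// ltW.
    by rewrite ler_nat; apply: leq_trans Nk _; exact: leqnSn.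
  exists (maxn N1 N2) => k l; rewrite !geq_max => /andP[k1 k2] /andP[l1 l2].
  have Nk := (Csle _ _ _ (leq0n k) (Hg k).1).2.
  have Nl := (Csle _ _ _ (leq0n l) (Hg l).1).2.
  rewrite divr1 in Nk Nl.
  apply: le_trans (L1_dist_le mD m0 muDm (Qg k) (Qg l) A10 s0 l00 Nk Nl) _.
  rewrite lee_fin -/(En (g k)) -/(En (g l)) -/(En (fun z => (g k z + g l z) / 2)).
  have Cm : Cs N1 (fun z => (g k z + g l z) / 2).
    have [Qk Nk'] := Csle _ _ _ k1 (Hg k).1; have [Ql Nl'] := Csle _ _ _ l1 (Hg l).1.
    split; first exact: inQ_mid.
    have [mk _ _ _ _] := Qk; have [ml _ _ _ _] := Ql; exact: (N12_mid mk ml Nk' Nl').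
  have Em : ek N1 <= En (fun z => (g k z + g l z) / 2).
    by apply: ge_inf; [exact: (hI N1).2|exists (fun z => (g k z + g l z) / 2)].
  have Ek := (Hg k).2; have El := (Hg l).2.
  have B1 := N2P _ k2; have B2 := N2P _ l2.
  have D4 : En (g k) + En (g l) - 2 * En (fun z => (g k z + g l z) / 2) <= 4 * e1.
    exact: (midpoint_defect_le Ek El B1 B2 (eks k) (eks l) HN1 Em).
  have H1 : 4 * (c0 / s) <= e / 3.
    rewrite mulrA ler_pdivrMr// /s.
    have -> : e / 3 * (12 * (c0 + 1) / e) = 4 * (c0 + 1) by field; rewrite gt_eqF.
    by rewrite ler_pM2l// lerDl.
  have H2 : l0 * m ^+ 2 <= e / 3.
    have -> : l0 * m ^+ 2 = e / 3 * (m ^+ 2 / (m ^+ 2 + 1)).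
      by rewrite /l0; field; rewrite gt_eqF.
    rewrite ger_pMr ?divr_gt0//.
    by rewrite ler_pdivrMr// mul1r lerDl.
  have H3 : c * (En (g k) + En (g l) - 2 * En (fun z => (g k z + g l z) / 2)) <= e / 3.
    apply: (@le_trans _ _ (c * (4 * e1))); first by rewrite ler_wpM2l// ltW.
    by rewrite le_eqVlt; apply/orP; left; apply/eqP; rewrite /e1; field; rewrite gt_eqF.
  apply: (@le_trans _ _ (e / 3 + e / 3 + e / 3)).
    by apply: lerD => //; exact: lerD.
  by rewrite le_eqVlt; apply/orP; left; apply/eqP; field.
have [n_ [nj Hn]] := L1_cauchy_subsequence cauchy.
exists A, (fun j => g (n_ j)); split => //.
- by move=> q Qq; rewrite -Nfin// lee_fin Alb.
- by move=> k; exact: (Csle _ _ _ (nj k) (Hg _).1).2.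
Qed.

Hypothesis density : forall q, measurable_fun setT q -> supp D q ->
  (N12 mu q < +oo)%E ->
  (forall v, regular mu O K v -> ip pi q (grad K v) = - ip mu f v) ->
  forall v (C : R), 0 <= C -> inU mu O K v ->
    {ae mu, forall x, rown mu (grad K v) x <= C%:E}%E ->
    ip pi q (grad K v) = - ip mu f v.

Lemma exists_minimizer : (exists q, inQ q) ->
  exists q, inQ q /\ forall p, inQ p -> (N12 mu q <= N12 mu p)%E.
Proof.
move=> /exists_minimizing_cauchy[A [h [A0 Alb Qh Nh ch]]].
have mh k : measurable_fun setT (h k) by have [] := Qh k.
have sh k : supp D (h k) by have [] := Qh k.
have ah k x y : h k (x, y) = - h k (y, x) by have [] := Qh k.
pose e (k : nat) z := `|h k.+1 z - h k z|.
have me k : measurable_fun setT (e k) by rewrite /e; meas.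
have e0 k z : 0 <= e k z by exact: normr_ge0.
have fe k z : `|h k.+1 z - h k z| <= 1 / (2 ^ k.+1)%:R + e k z.
  by rewrite lerDr divr_ge0.
have ie k : (\int[pi]_z (e k z)%:E <= (1 / (2 ^ k.+1)%:R)%:E)%E by exact: ch.
have [mZ Z0 cZ] := fast_limit ler01 mh me e0 fe ie.
set Z := [set x | _] in mZ Z0 cZ.
(* [inQ] asks for antisymmetry at every point, so the set where the limit is taken must be
   symmetric. *)
have ZC x y : \1_Z (x, y) = \1_Z (y, x) :> R.
  rewrite !indicE (_ : ((x, y) \in Z) = ((y, x) \in Z))//.
  apply/idP/idP; rewrite !inE /Z /=; congr (_ < _)%E; apply: eq_eseriesr => k _;
    by rewrite /e (ah k.+1) (ah k) -opprD normrN.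
pose hz k z := h k z * \1_Z z.
have mhz k : measurable_fun setT (hz k) by rewrite /hz; meas.
pose q z := limn (fun k => hz k z).
have hq z : (fun k => hz k z) @ \oo --> q z.
  suff : cvgn (fun k => hz k z) by [].
  have [Zz|nZz] := pselect (Z z).
    by apply: is_cvgM; [exact: cZ | exact: is_cvg_cst].
  rewrite (_ : (fun _ => _) = fun=> 0); first exact: is_cvg_cst.
  by apply/funext => k; rewrite /hz indicE memNset// mulr0.
have mq : measurable_fun setT q by apply: (measurable_fun_cvg mhz) => z _; exact: hq.
have sq : supp D q.
  move=> x y n; have := hq (x, y).
  rewrite (_ : (fun _ => _) = fun=> 0); last first.
    by apply/funext => j; rewrite /hz sh// mul0r.
  by move=> H; apply/esym; apply: (cvg_unique _ _ H) => //; exact: cvg_cst.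
have aq x y : q (x, y) = - q (y, x).
  apply: (cvg_unique _ (hq (x, y))) => //.
  rewrite (_ : (fun _ => _) = (fun k => - hz k (y, x))); first exact: cvgN.
  by apply/funext => k; rewrite /hz ah ZC mulNr.
have hz_le k z : `|hz k z| <= `|h k z|.
  rewrite /hz normrM ler_piMr// indicE; case: (_ \in _); by rewrite ?normr1 ?normr0.
have NqA : (N12 mu q <= A%:E)%E.
  apply/lee_addgt0Pr => t t0; apply: (N12_fatou mhz hq).
  exists (Num.bound (1 / t)) => // k /= kt.
  apply: le_trans (N12_le mu (mhz k) (mh k) (hz_le k)) _.
  apply: le_trans (Nh k) _; rewrite -EFinD lee_fin lerD2l.
  rewrite ler_pdivrMr ?ltr0n// -ler_pdivrMl// mulrC.
  apply: le_trans (ltW (archi_boundP _)) _; first by rewrite divr_ge0// ltW.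
  by rewrite ler_nat; apply: leq_trans kt _; exact: leqnSn.
have Nq : (N12 mu q < +oo)%E by apply: le_lt_trans NqA _; rewrite ltry.
have aeZ : {ae pi, forall z, Z z} by exists (~` Z); split => //; exact: measurableC.
have L1q k : (\int[pi]_z (`|q z - h k z|)%:E <= (1 / (2 ^ k.+1)%:R)%:E)%E.
  have -> : (\int[pi]_z (`|q z - h k z|)%:E = \int[pi]_z (`|q z - hz k z|)%:E)%E.
    apply: ge0_ae_eq_integral => //; try by meas.
    by apply: filterS aeZ => z Zz _; rewrite /hz indicE mem_set// mulr1.
  apply: (@fatou_le _ _ _ _ (fun l z => `|hz l z - hz k z|)).
  - by move=> l; meas.
  - by move=> l z.
  - by move=> z; apply: cvg_norm; apply: cvgB; [exact: hq|exact: cvg_cst].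
  - exists k => // l /= kl; apply: le_trans (ch k l kl).
    apply: ge0_le_integralR => //; try by meas.
    move=> z; rewrite /hz -mulrBl normrM ler_piMr// indicE.
    by case: (_ \in _); rewrite ?normr1 ?normr0.
exists q; split; last by move=> p Qp; apply: le_trans NqA _; exact: Alb.
split => //; apply: density => // v gv.
have [Uv [C [C0 rv]] bv] := gv.
have mg : measurable_fun setT (grad K v) by have [_ _ []] := Uv.
have iq := pair_integrable C0 mq mg Nq rv.
apply/eqP; rewrite -subr_eq0 opprK -normr_eq0 eq_le normr_ge0 andbT.
apply/ler_addgt0Pr => t t0; rewrite add0r.
(* [A2] bounds the norm of [q - h k]. The bounded part [b] of the gradient is paired through the L^1
   error; the rest, with rows of norm at most [t1], through this norm. Each contributes at most t /
   2. *)
pose A2 := 2 * A + 1.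
have A20 : 0 < A2 by rewrite ltr_wpDl// mulr_ge0.
pose t1 := t / (2 * A2).
have t10 : 0 < t1 by rewrite divr_gt0// mulr_gt0.
have [b [B [mb B0 bB rb]]] := bv t1 t10.
pose k := Num.bound (2 * B / t).
have [_ _ _ Nk ik] := Qh k.
have mqh : measurable_fun setT (fun z => q z - h k z) by meas.
have Nqh : (N12 mu (fun z => q z - h k z)%R <= A2%:E)%E.
  apply: le_trans (N12D mu mq (measurable_funN (mh k))) _.
  rewrite N12N (_ : A2 = A + (A + 1)); last by rewrite /A2; ring.
  rewrite EFinD; apply: leeD => //; apply: le_trans (Nh k) _.
  by rewrite lee_fin lerD2l ler_pdivrMr ?ltr0n// mul1r ler1n.
have Nqhf : (N12 mu (fun z => q z - h k z)%R < +oo)%E.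
  by apply: le_lt_trans Nqh _; rewrite ltry.
have ihk := pair_integrable C0 (mh k) mg Nk rv.
have iqh := pair_integrable C0 mqh mg Nqhf rv.
rewrite -(opprK (ip mu f v)) -(ik v C C0 Uv rv).
have -> : ip pi q (grad K v) - ip pi (h k) (grad K v) =
   ip pi (fun z => q z - h k z) (grad K v).
  by rewrite /ip -RintegralB//; apply: eq_Rintegral => z _; rewrite mulrBl.
rewrite -lee_fin /ip EFin_normr_Rintegral//.
apply: le_trans; first by apply: le_abse_integral => //; meas.
pose gb z := grad K v z - b z.
have mgb : measurable_fun setT gb by rewrite /gb; meas.
apply: (@le_trans _ _ (\int[pi]_z (B * `|q z - h k z| + `|(q z - h k z) * gb z|)%:E)%E).
  apply: ge0_le_integralR => //; try by meas.
  move=> z; rewrite (_ : grad K v z = b z + gb z); last by rewrite /gb addrC subrK.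
  rewrite mulrDr; apply: le_trans (ler_normD _ _) _; rewrite lerD2r.
  by rewrite normrM mulrC ler_wpM2r.
rewrite ge0_integralDR//; [|by meas|by move=> z; rewrite mulr_ge0|by meas].
rewrite ge0_integralZlR//; last by meas.
rewrite (_ : t = t / 2 + t / 2); last by field.
rewrite EFinD; apply: leeD.
  apply: (@le_trans _ _ (B%:E * (1 / (2 ^ k.+1)%:R)%:E)%E).
    by apply: lee_wpmul2l => //; rewrite lee_fin.
  rewrite -EFinM lee_fin mulrA mulr1 ler_pdivrMr ?ltr0n ?expn_gt0//.
  rewrite mulrAC ler_pdivlMr// -ler_pdivrMl// mulrC (mulrC B).
  apply: le_trans (ltW (archi_boundP _)) _.
    by rewrite divr_ge0 ?mulr_ge0// ltW.
  rewrite ler_nat -/k; apply: ltnW; apply: leq_trans (ltn_expl k (ltnSn 1)) _.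
  by rewrite leq_pexp2l.
apply: le_trans.
  apply: (pair_le _ mqh mgb rb); exact: ltW.
apply: (@le_trans _ _ (t1%:E * A2%:E)%E); first by apply: lee_wpmul2l => //; rewrite lee_fin ltW.
rewrite -EFinM lee_fin le_eqVlt; apply/orP; left; apply/eqP.
by rewrite /t1; field; rewrite gt_eqF.
Qed.

End Existence.

(** * Regularisation by averaging *)

Section Smoothing.
Context (R : realType) (n : nat).
Local Notation T := (Rn R n).
Variable mu : {sigma_finite_measure set T -> \bar R}.
Local Notation pi := (mu \x mu)%E.
Local Notation "x +v y" := ((x : 'rV[R]_n) + (y : 'rV[R]_n) : T) (at level 50).
Local Notation "x -v y" := ((x : 'rV[R]_n) - (y : 'rV[R]_n) : T) (at level 50).
Hypothesis Htr : forall (a : T) (g : T -> \bar R), measurable_fun setT g ->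
  (forall x, 0 <= g x)%E -> (\int[mu]_x g (x +v a) = \int[mu]_x g x)%E.

(** Cauchy-Schwarz for sqrt r and sqrt r times g. When the right side is finite this also gives the
    integrability that the real integral on the left requires. *)
Lemma jensen_sq (r g : T -> R) : measurable_fun setT r -> measurable_fun setT g ->
  (forall x, 0 <= r x) -> (\int[mu]_x (r x)%:E = 1)%E ->
  (((\int[mu]_x (r x * g x))%R ^+ 2)%:E <= \int[mu]_x (r x * g x ^+ 2)%:E)%E.
Proof.
move=> mr mg r0 r1.
pose s x := Num.sqrt (r x).
have ms : measurable_fun setT s.
  apply: (measurableT_comp (f := @Num.sqrt R)) => //.
  by apply: continuous_measurable_fun; exact: sqrt_continuous.
have s2 x : s x ^+ 2 = r x by rewrite sqr_sqrtr.
have msg : measurable_fun setT (fun x => s x * g x) by meas.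
have := hoelder22 mu ms msg.
under eq_integral do rewrite mulrA -expr2 s2.
under [X in (_ <= X `^ _ * _)%E -> _]eq_integral do rewrite s2.
under [X in (_ <= _ * X `^ _)%E -> _]eq_integral do rewrite exprMn s2.
rewrite r1 poweR1r mul1e => H.
have I0 : (0 <= \int[mu]_x (r x * g x ^+ 2)%:E)%E.
  by apply: integral_ge0 => x _; rewrite lee_fin mulr_ge0 ?sqr_ge0.
have mrg : measurable_fun setT (fun x => r x * g x) by meas.
move: H I0; case: (\int[mu]_x (r x * g x ^+ 2)%:E)%E => [I| |]// H I0; last by rewrite leey.
rewrite lee_fin in I0.
rewrite poweR_EFin powR12_sqrt// in H.
have irg : mu.-integrable setT (EFin \o (fun x => r x * g x)).
  by apply/integrableP; split; [meas|apply: le_lt_trans H _; rewrite ltry].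
have : `|(\int[mu]_x (r x * g x))%R| <= Num.sqrt I.
  rewrite -lee_fin EFin_normr_Rintegral//; apply: le_trans H.
  by apply: le_abse_integral => //; meas.
move=> H2; rewrite lee_fin -(sqr_sqrtr I0) -[leLHS]real_normK ?num_real//.
by rewrite ler_sqr ?nnegrE ?sqrtr_ge0.
Qed.

Lemma measurable_addv : measurable_fun [set: T * T] (fun p : T * T => p.1 +v p.2).
Proof.
apply: measurable_fun_Rn => i; under eq_fun do rewrite !mxE.
apply: measurable_funD.
  exact: (measurableT_comp (measurable_coord i) measurable_fst).
exact: (measurableT_comp (measurable_coord i) measurable_snd).
Qed.

Lemma measurable_shift d (X : measurableType d) (g : T -> X) (a : T) :
  measurable_fun setT g -> measurable_fun setT (fun x : T => g (x +v a)).
Proof. by move=> mg; apply: (measurableT_comp mg); exact: measurable_translate. Qed.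

Section Kernel.
Variable om : T -> R.
Hypothesis mom : measurable_fun setT om.
Hypothesis omN : forall z, om (- (z : 'rV[R]_n)) = om z.
Definition Kof (z : T * T) : R := om (z.1 -v z.2).

Lemma measurable_Kof : measurable_fun setT Kof.
Proof. exact: (measurableT_comp mom (@measurable_diff R n)). Qed.

Lemma KofC x y : Kof (x, y) = Kof (y, x).
Proof. by rewrite /Kof/= -omN opprB. Qed.

Lemma rowsq_shift v x : measurable_fun setT v ->
  rowsq mu (grad Kof v) x =
  (\int[mu]_z ((om z) ^+ 2 * (v (z +v x) - v x) ^+ 2)%:E)%E.
Proof.
move=> mv; rewrite /rowsq.
have mg := measurable_row x (measurable_grad measurable_Kof mv).
rewrite -[LHS](Htr x); first last.
- by move=> y; rewrite lee_fin sqr_ge0.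
- by meas.
apply: eq_integral => z _; rewrite /grad /Kof /= exprMn mulrC; congr (_ * _)%:E.
  by congr (_ ^+ 2); rewrite -omN opprB addrK.
by rewrite -sqrrN opprB.
Qed.

Variables (rho v : T -> R) (B : R).
Hypotheses (mrho : measurable_fun setT rho) (rho0 : forall x, 0 <= rho x).
Hypotheses (rhoB : forall x, rho x <= B) (rho1 : (\int[mu]_x (rho x)%:E = 1)%E).
Hypotheses (mv : measurable_fun setT v) (iv : mu.-integrable setT (EFin \o v)).

Definition smooth (x : T) : R := (\int[mu]_y (rho y * v (y +v x)))%R.

Let B0 : 0 <= B.
Proof. by apply: le_trans (rho0 (0 : 'rV[R]_n)) (rhoB _). Qed.

Let V := (\int[mu]_x `|v x|%:E)%E.

Lemma smooth_abs_le x : (\int[mu]_y (`|rho y * v (y +v x)|)%:E <= B%:E * V)%E.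
Proof.
have mvx := measurable_shift x mv.
rewrite /V -[X in (_ <= _ * X)%E](Htr x); first last.
- by move=> y; rewrite lee_fin.
- by meas.
rewrite -ge0_integralZlR//; last by meas.
apply: ge0_le_integralR => //; try by meas.
by move=> y; rewrite normrM ler_wpM2r// ger0_norm.
Qed.

Let Vfin : (V < +oo)%E.
Proof. by have /integrableP[_] := iv. Qed.

Lemma smooth_integrable x : mu.-integrable setT (EFin \o (fun y : T => rho y * v (y +v x))).
Proof.
have mvx := measurable_shift x mv.
apply/integrableP; split; first by meas.
by apply: le_lt_trans (smooth_abs_le x) _; rewrite lte_mul_pinfty// lee_fin.
Qed.

Lemma smooth_bounded x : `|smooth x| <= B * fine V.
Proof.
have V0 : (0 <= V)%E by apply: integral_ge0 => y _; rewrite lee_fin.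
rewrite -lee_fin EFinM fineK ?ge0_fin_numE//.
rewrite /smooth EFin_normr_Rintegral//; last exact: smooth_integrable.
apply: le_trans (smooth_abs_le x); apply: le_abse_integral => //.
by have mvx := measurable_shift x mv; meas.
Qed.

(** The parametrised integral is a difference of two Tonelli integrals, of the positive and of the
    negative part, each measurable in the parameter. *)
Lemma measurable_smooth : measurable_fun setT smooth.
Proof.
pose g (z : T * T) := rho z.2 * v (z.2 +v z.1).
have mg : measurable_fun setT g.
  apply: measurable_funM; first exact: (measurableT_comp mrho measurable_snd).
  apply: (measurableT_comp mv).
  exact: (measurableT_comp measurable_addv (@measurable_swap _ _ T T)).
have mgp : measurable_fun setT (fun x => \int[mu]_y ((EFin \o g)^\+ (x, y)))%E.
  apply: (measurable_fun_fubini_tonelli_F ((EFin \o g)^\+)%E) => //.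
  by apply: measurable_funepos; meas.
have mgn : measurable_fun setT (fun x => \int[mu]_y ((EFin \o g)^\- (x, y)))%E.
  apply: (measurable_fun_fubini_tonelli_F ((EFin \o g)^\-)%E) => //.
  by apply: measurable_funeneg; meas.
have : measurable_fun setT (fun x => \int[mu]_y ((EFin \o g)^\+ (x, y)) -
   \int[mu]_y ((EFin \o g)^\- (x, y)))%E by exact: emeasurable_funB.
move=> mE.
have mfine : measurable_fun setT (@fine R) by exact: fine_measurable.
rewrite (_ : smooth = @fine R \o (fun x => \int[mu]_y ((EFin \o g)^\+ (x, y)) -
   \int[mu]_y ((EFin \o g)^\- (x, y)))%E); first exact: measurableT_comp mfine mE.
apply/funext => x; rewrite /smooth /Rintegral /= integralE; by congr (fine (_ - _)%E); apply: eq_integral => y _; rewrite !(funeposE, funenegE).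
Qed.

Lemma smooth_diff_sq x x' : (((smooth x - smooth x') ^+ 2)%:E <=
  \int[mu]_y (rho y * (v (y +v x) - v (y +v x')) ^+ 2)%:E)%E.
Proof.
have mvx := measurable_shift x mv; have mvx' := measurable_shift x' mv.
rewrite /smooth -RintegralB//; try exact: smooth_integrable.
under eq_Rintegral do rewrite -mulrBr.
by apply: jensen_sq => //; meas.
Qed.

Lemma smooth_dist_sq x : (((smooth x - v x) ^+ 2)%:E <=
  \int[mu]_y (rho y * (v (y +v x) - v x) ^+ 2)%:E)%E.
Proof.
have mvx := measurable_shift x mv.
have irho0 : mu.-integrable setT (EFin \o rho).
  apply/integrableP; split; first by meas.
  by under eq_integral do rewrite /= ger0_norm//; rewrite rho1 ltry.
have irho : mu.-integrable setT (EFin \o (fun y => v x * rho y)).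
  by have := integrableZl measurableT (v x) irho0; apply: eq_integrable.
have vE : v x = (\int[mu]_y (v x * rho y))%R.
  rewrite RintegralZl//.
  by rewrite /Rintegral rho1 mulr1.
rewrite [in X in (X <= _)%E]vE /smooth -RintegralB//; last exact: smooth_integrable.
under eq_Rintegral do rewrite (mulrC (v x)) -mulrBr.
by apply: jensen_sq => //; meas.
Qed.

(** Averaging commutes with translations, so by Jensen and Tonelli a row of the averaged potential
    is dominated by the average of the rows of [v]. Bounding [rho] by [B], or the rows by their
    supremum, gives the two estimates that follow. *)
Lemma smooth_rowsq x : (rowsq mu (grad Kof smooth) x <=
  \int[mu]_y ((rho y)%:E * rowsq mu (grad Kof v) (y +v x)))%E.
Proof.
have ms := measurable_smooth.
rewrite rowsq_shift//.
pose F (p : T * T) := om p.1 ^+ 2 * (rho p.2 *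
   (v (p.2 +v (p.1 +v x)) - v (p.2 +v x)) ^+ 2).
have m1 : measurable_fun setT (fun p : T * T => om p.1).
  exact: (measurableT_comp mom measurable_fst).
have m2 : measurable_fun setT (fun p : T * T => rho p.2).
  exact: (measurableT_comp mrho measurable_snd).
have m3 : measurable_fun setT (fun p : T * T => v (p.2 +v x)).
  exact: (measurableT_comp (measurable_shift x mv) measurable_snd).
have m4 : measurable_fun setT (fun p : T * T => v (p.2 +v (p.1 +v x))).
  rewrite (_ : (fun _ => _) = (fun p : T * T => v ((p.1 +v p.2) +v x))).
    exact: (measurableT_comp (measurable_shift x mv) measurable_addv).
  by apply/funext => p; congr v; rewrite addrCA addrA.
have mF : measurable_fun setT F by rewrite /F; meas.
have F0 p : 0 <= F p by apply: mulr_ge0; [exact: sqr_ge0|apply: mulr_ge0; [exact: rho0|exact: sqr_ge0]].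
apply: (@le_trans _ _ (\int[mu]_z \int[mu]_y (F (z, y))%:E)%E).
  apply: ge0_le_integral => //.
  - by move=> z _; rewrite lee_fin mulr_ge0 ?sqr_ge0.
  - by have := measurable_shift x ms => ?; meas.
  - apply: (measurable_fun_fubini_tonelli_F (fun p => (F p)%:E)) => //.
    by meas.
  - move=> z _; rewrite /F /=.
    have mvx := measurable_shift x mv; have mvx' := measurable_shift (z +v x) mv.
    rewrite ge0_integralZlR ?sqr_ge0//; last 2 first.
    + by meas.
    + by move=> y; rewrite mulr_ge0 ?sqr_ge0.
    rewrite EFinM; apply: lee_wpmul2l; first by rewrite lee_fin sqr_ge0.
    exact: smooth_diff_sq.
rewrite (fubini_tonelli (fun p => (F p)%:E)); [|by meas|by move=> p; rewrite lee_fin].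
rewrite le_eqVlt; apply/orP; left; apply/eqP; apply: eq_integral => y _.
rewrite rowsq_shift// /F /=.
rewrite -ge0_integralZlR//; last 2 first.
- have := measurable_shift (y +v x) mv => ?; by meas.
- by move=> z; rewrite mulr_ge0 ?sqr_ge0.
apply: eq_integral => z _; congr EFin; rewrite mulrCA; congr (_ * (_ * (_ - _) ^+ 2)).
by congr v; rewrite addrCA.
Qed.

Lemma smooth_rowsq_bound x :
  (rowsq mu (grad Kof smooth) x <= B%:E * sqn pi (grad Kof v))%E.
Proof.
have mg := measurable_grad measurable_Kof mv.
have mr := measurable_rowsq mu mg.
apply: le_trans (smooth_rowsq x) _.
have B0' : (0 <= B%:E)%E by rewrite lee_fin.
have r0 y : setT y -> (0 <= rowsq mu (grad Kof v) y)%E by move=> _; exact: rowsq_ge0.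
rewrite (sqn_rowsq mu mg) -(ge0_integralZl _ measurableT mr r0 B0').
rewrite -[leRHS](Htr x); first last.
- by move=> y; rewrite mule_ge0 ?rowsq_ge0 ?lee_fin.
- by apply: emeasurable_funM.
have mrx := measurable_shift x mr.
apply: ge0_le_integral => //.
- by move=> y _; rewrite mule_ge0 ?rowsq_ge0 ?lee_fin.
- by apply: emeasurable_funM => //; meas.
- by apply: emeasurable_funM.
- by move=> y _; apply: lee_wpmul2r; rewrite ?rowsq_ge0 ?lee_fin.
Qed.

Lemma smooth_rowsq_sup (c : R) x : 0 <= c ->
  {ae mu, forall y, rowsq mu (grad Kof v) y <= c%:E}%E ->
  (rowsq mu (grad Kof smooth) x <= c%:E)%E.
Proof.
move=> c0 vc.
have mg := measurable_grad measurable_Kof mv.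
have mr := measurable_rowsq mu mg.
apply: le_trans (smooth_rowsq x) _.
have mrho' := measurable_shift (- (x : 'rV[R]_n)) mrho.
rewrite -(Htr (- (x : 'rV[R]_n))); first last.
- by move=> y; rewrite mule_ge0 ?rowsq_ge0 ?lee_fin.
- apply: emeasurable_funM; first by meas.
  exact: measurable_shift.
rewrite (_ : c%:E = c%:E * \int[mu]_y (rho (y +v (- (x : 'rV[R]_n))))%:E)%E; last first.
  by rewrite (Htr _ (g := fun y => (rho y)%:E)) ?rho1 ?mule1//; meas.
have mrho'' : measurable_fun setT (fun y : T => (rho (y +v (- (x : 'rV[R]_n))))%:E) by meas.
have rho0' (y : T) : setT y -> (0 <= (rho (y +v (- (x : 'rV[R]_n))))%:E)%E by rewrite lee_fin.
have c0' : (0 <= c%:E)%E by rewrite lee_fin.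
rewrite -(ge0_integralZl _ measurableT mrho'' rho0' c0').
apply: ae_ge0_le_integral => //.
- by move=> y _; rewrite mule_ge0 ?rowsq_ge0 ?lee_fin.
- apply: emeasurable_funM; first by meas.
  by under eq_fun do rewrite addrNK.
- by move=> y _; rewrite mule_ge0 ?lee_fin.
- by apply: emeasurable_funM; meas.
apply: filterS vc => y yc _; rewrite addrNK muleC.
by apply: lee_wpmul2r => //; rewrite lee_fin.
Qed.

End Kernel.
End Smoothing.

Lemma mulr_frac_le (R : realFieldType) (a e : R) : 0 <= a -> 0 <= e ->
  a * (e / (a + 1)) <= e.
Proof.
move=> a0 e0; rewrite mulrCA ler_piMr// ler_pdivrMr ?mul1r ?lerDl//.
by rewrite ltr_wpDl.
Qed.

Lemma two_thirds_le (R : realFieldType) (e : R) : 0 < e -> e / 3 + e / 3 <= e.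
Proof. by lra. Qed.

(** * Cutting off large values of the kernel *)

Section KernelTail.
Context d (T : measurableType d) (R : realType).
Variable mu : {sigma_finite_measure set T -> \bar R}.
Local Notation pi := (mu \x mu)%E.

Lemma poweR_half_le (r : \bar R) (C : R) : (0 <= r)%E -> 0 <= C ->
  (r `^ 2^-1 <= C%:E)%E = (r <= (C ^+ 2)%:E)%E.
Proof.
move=> + C0; case: r => [r| |] //= r0; last by rewrite ?gt_eqF// !leye_eq.
rewrite lee_fin in r0; rewrite !lee_fin powR12_sqrt//.
by rewrite -[RHS]ler_sqrt ?exprn_ge0// sqrtr_sqr ger0_norm.
Qed.

Lemma rown_le_sq (C : R) (q : T * T -> R) x : 0 <= C ->
  (rown mu q x <= C%:E)%E = (rowsq mu q x <= (C ^+ 2)%:E)%E.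
Proof. by move=> C0; apply: poweR_half_le => //; exact: rowsq_ge0. Qed.

Lemma rowsq_le (p q : T * T -> R) x : measurable_fun setT p -> measurable_fun setT q ->
  (forall y, `|p (x, y)| <= `|q (x, y)|) -> (rowsq mu p x <= rowsq mu q x)%E.
Proof.
move=> mp mq pq.
have mpx := measurable_row x mp; have mqx := measurable_row x mq.
apply: ge0_le_integralR; [by meas|by meas|by move=> y; exact: sqr_ge0|].
by move=> y; rewrite -(real_normK (num_real (p _))) -(real_normK (num_real (q _))) lerXn2r ?nnegrE.
Qed.

Lemma grad_ae (K : T * T -> R) (u v : T -> R) :
  measurable_fun setT u -> measurable_fun setT v ->
  {ae mu, forall x, u x = v x} -> {ae pi, forall z, grad K u z = grad K v z}.
Proof.
move=> mu' mv uv.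
have mZ : measurable [set x | u x = v x].
  rewrite (_ : [set x | u x = v x] = (fun x => u x - v x) @^-1` [set 0]).
    by rewrite -[X in measurable X]setTI; apply: measurable_funB.
  by apply/seteqP; split => x /= H; [rewrite H subrr|apply/eqP; rewrite -subr_eq0 H].
have Z0 : mu (~` [set x | u x = v x]) = 0%E.
  by apply/negligibleP; [exact: measurableC|exact: uv].
by apply: filterS (ae_prod mZ Z0) => z [/= h1 h2]; rewrite /grad h1 h2.
Qed.

Variables (D : set T) (K : T * T -> R).
Hypothesis mD : measurable D.
Hypothesis mK : measurable_fun setT K.
Variable m : R.
Hypothesis m0 : 0 <= m.
Hypothesis muDm : (mu D <= m%:E)%E.
Local Notation large k := [set z | ((k%:R)%:E < (K z)%:E)%E].

Lemma measurable_large (k : nat) : measurable (large k).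
Proof. by apply: measurable_gt_set; meas. Qed.

Lemma sqn_tail (q : T * T -> R) (e : R) : l2 pi q -> 0 < e ->
  \forall k \near \oo, (sqn pi (fun z => q z * \1_(large k) z)%R <= e%:E)%E.
Proof.
move=> [mq q2] e0.
have mq2 : measurable_fun setT (fun z => (q z ^+ 2)%:E) by meas.
have mKE : measurable_fun setT (fun z => (K z)%:E) by meas.
have q20 z : (0 <= (q z ^+ 2)%:E)%E by rewrite lee_fin sqr_ge0.
have Kfin : {ae pi, forall z, (K z)%:E < +oo}%E by apply: aeW => z; rewrite ltry.
apply: filterS (integral_tail mq2 mKE q20 q2 Kfin e0) => k.
congr (_ <= _)%E; apply: eq_integral => z _.
by rewrite exprMn -EFinM; congr (_ * _)%:E; rewrite indicE; case: (_ \in _); rewrite ?expr1n ?expr0n.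
Qed.

(** [q] need not be square-integrable: its rows of large norm are set aside first, at small L^{1,2}
    cost; the rest is in L^2, where dominated convergence applies and [N12_small] returns to
    L^{1,2}. *)
Lemma N12_kernel_tail (q : T * T -> R) (e : R) : measurable_fun setT q -> supp D q ->
  (N12 mu q < +oo)%E -> 0 < e ->
  exists k : nat, (N12 mu (fun z => q z * \1_(large k) z)%R <= e%:E)%E.
Proof.
move=> mq sq Nq e0; have e20 : 0 < e / 2 by rewrite divr_gt0.
have [j Hj] := N12_tail mq Nq e20.
pose A := [set x | ((j%:R)%:E < rown mu q x)%E].
pose q1 := fun z : T * T => q z * \1_A z.1.
pose q2 := fun z : T * T => q z - q1 z.
have l2q2 : l2 pi q2 by apply: (l2_row_restrict (ler0n _ j) mq Nq).
have mA : measurable A by apply: measurable_gt_set; exact: measurable_rown.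
have mq1 : measurable_fun setT q1.
  apply: measurable_funM => //.
  exact: (measurableT_comp (measurable_indic mA) measurable_fst).
have [r r0 Hr] := N12_small mD m0 muDm e20.
have [k _ Hk] := sqn_tail l2q2 r0.
have {}Hk := Hk k (leqnn k).
have mq2 := l2q2.1; have ml := measurable_large k.
exists k.
have mi : measurable_fun setT (\1_(large k) : T * T -> R) by exact: measurable_indic.
rewrite (_ : (fun z => q z * _) = (fun z => q1 z * \1_(large k) z + q2 z * \1_(large k) z)); last first.
  by apply/funext => z; rewrite -mulrDl /q2 addrC subrK.
have m1 : measurable_fun setT (fun z => q1 z * \1_(large k) z) by meas.
have m2 : measurable_fun setT (fun z => q2 z * \1_(large k) z) by meas.
apply: le_trans (N12D mu m1 m2) _.
rewrite [e]splitr EFinD; apply: leeD.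
  apply: le_trans Hj; apply: N12_le => // z; rewrite normrM ler_piMr//.
  by rewrite indicE; case: (_ \in _); rewrite ?normr1 ?normr0.
apply: Hr => // x y n; rewrite /q2 /q1 sq// !mul0r subr0 mul0r//.
Qed.

End KernelTail.

Section DensityLimit.
Context d (T : measurableType d) (R : realType).
Variable mu : {sigma_finite_measure set T -> \bar R}.
Local Notation pi := (mu \x mu)%E.
Variables (O D : set T) (K : T * T -> R).
Hypothesis mD : measurable D.
Hypothesis OD : O `<=` D.
Hypothesis mK : measurable_fun setT K.
Hypothesis K_ge0 : forall z, 0 <= K z.
Variable m : R.
Hypothesis m0 : 0 <= m.
Hypothesis muDm : (mu D <= m%:E)%E.
Variable f : T -> R.
Hypothesis lf : l2 mu f.
Hypothesis approx : forall v (C e : R), 0 <= C -> inU mu O K v ->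
    {ae mu, forall x, rown mu (grad K v) x <= C%:E}%E -> 0 < e ->
  exists u, [/\ regular mu O K u, {ae mu, forall x, rown mu (grad K u) x <= C%:E}%E &
    {ae mu, forall x, `|u x - v x| <= e}].

Lemma rown_grad_dist (C : R) u v : 0 <= C ->
  measurable_fun setT u -> measurable_fun setT v ->
  {ae mu, forall x, rown mu (grad K u) x <= C%:E}%E ->
  {ae mu, forall x, rown mu (grad K v) x <= C%:E}%E ->
  {ae mu, forall x, rown mu (fun z => grad K v z - grad K u z)%R x <= (2 * C)%:E}%E.
Proof.
move=> C0 mu' mv hu hv; have mgu := measurable_grad mK mu'.
have mgv := measurable_grad mK mv.
apply: filterS2 hu hv => x hu hv.
have -> : (fun z => grad K v z - grad K u z) = (fun z => grad K v z + (-1) * grad K u z).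
  by apply/funext => z; rewrite mulN1r.
have mNgu : measurable_fun setT (fun z => (-1) * grad K u z) by meas.
apply: (le_trans (rownD mu x mgv mNgu)).
rewrite rownZ// normrN1 mul1e mulr_natl mulr2n EFinD; exact: leeD.
Qed.

(** Where the kernel is at most [k], potentials at distance [e] have gradients at distance at most 2
    e k, and the flux is integrable. *)
Lemma cutoff_pairing_le (q : T * T -> R) (u v : T -> R) (e : R) (k : nat) :
  measurable_fun setT q -> supp D q -> (N12 mu q < +oo)%E -> 0 <= e ->
  measurable_fun setT u -> measurable_fun setT v ->
  {ae mu, forall x, `|u x - v x| <= e} ->
  (\int[pi]_z (`|(q z - q z * \1_[set z | ((k%:R)%:E < (K z)%:E)%E] z) *
     (grad K v z - grad K u z)|)%:E <=
   (2 * e * k%:R)%:E * ((m + 1)%:E * N12 mu q))%E.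
Proof.
move=> mq sq Nq e0 mu' mv uv.
have mgu := measurable_grad mK mu'; have mgv := measurable_grad mK mv.
have ml := measurable_large mK k.
set J := \1_[set z | ((k%:R)%:E < (K z)%:E)%E].
have mJ : measurable_fun setT J by exact: measurable_indic.
have ek : (0 <= (2 * e * k%:R)%:E)%E by rewrite lee_fin !mulr_ge0.
apply: (@le_trans _ _ ((2 * e * k%:R)%:E * \int[pi]_z (`|q z|)%:E)%E); last first.
  by apply: lee_wpmul2l => //; exact: (L1_N12 mD m0 muDm mq sq).
rewrite -ge0_integralZl//; [|by meas].
apply: ae_ge0_le_integral => //.
- clear -mq mgu mgv mJ; move: mJ; generalize J => I mI; meas.
- by move=> z _; rewrite mule_ge0// lee_fin.
- by meas.
have mZ : measurable [set x | `|u x - v x| <= e].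
  rewrite -[X in measurable X]setTI.
  have : measurable_fun setT (fun x => `|u x - v x|) by meas.
  move=> /(_ measurableT `]-oo, e]%classic (measurable_itv _)).
  by congr measurable; apply/seteqP; split => x /=; rewrite in_itv.
have Z0 : mu (~` [set x | `|u x - v x| <= e]) = 0%E.
  by apply/negligibleP; [exact: measurableC|exact: uv].
apply: filterS (ae_prod mZ Z0) => z [/= h1 h2] _.
rewrite -EFinM lee_fin /J indicE.
case: (ltP (k%:R)%:E (K z)%:E) => hk.
  rewrite mem_set// mulr1 subrr mul0r normr0 !mulr_ge0//.
rewrite memNset ?mulr0 ?subr0 ?normrM; last by rewrite /= ltNge hk.
rewrite mulrC; apply: ler_wpM2r => //.
have -> : grad K v z - grad K u z = ((u z.2 - v z.2) - (u z.1 - v z.1)) * K z.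
  by rewrite /grad; ring.
rewrite normrM; apply: ler_pM => //; last by rewrite ger0_norm.
by apply: le_trans (ler_normB _ _) _; rewrite mulr_natl mulr2n lerD.
Qed.

(** The cutoff [k] is fixed first, from the kernel tail of [q]; only then is the distance [e'] of
    the approximant chosen, since the error on the remaining part of [q] grows with [k]. *)
Lemma density_of_approx q : measurable_fun setT q -> supp D q ->
  (N12 mu q < +oo)%E ->
  (forall v, regular mu O K v -> ip pi q (grad K v) = - ip mu f v) ->
  forall v (C : R), 0 <= C -> inU mu O K v ->
    {ae mu, forall x, rown mu (grad K v) x <= C%:E}%E ->
    ip pi q (grad K v) = - ip mu f v.
Proof.
move=> mq sq Nq Hq v C C0 Uv vC.
have [[mv v2] v0 [mgv gv2]] := Uv.
suff H : forall e : R, 0 < e -> `|ip pi q (grad K v) + ip mu f v| <= e.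
  apply/eqP; rewrite -subr_eq0 opprK -normr_le0; apply/ler_addgt0Pr => e e0.
  by rewrite add0r; exact: H.
move=> e e0; have e30 : 0 < e / 3 by rewrite divr_gt0.
pose N := fine (N12 mu q).
have NE : N12 mu q = N%:E by rewrite fineK ?ge0_fin_numE ?N12_ge0.
have N0 : 0 <= N by rewrite -lee_fin -NE N12_ge0.
have C21 : 0 < 2 * C + 1 by rewrite ltr_wpDl ?mulr_ge0.
have [k Hk] := N12_kernel_tail mD mK m0 muDm mq sq Nq (divr_gt0 e30 C21).
(* [A] and [F] are the factors of [e'] in the errors on the flux of moderate kernel and on the datum
   [f]. *)
pose A := 2 * k%:R * ((m + 1) * N).
have A0 : 0 <= A by rewrite !mulr_ge0 ?addr_ge0.
pose F := Num.sqrt (ip mu f f) * Num.sqrt m.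
have F0 : 0 <= F by rewrite mulr_ge0 ?sqrtr_ge0.
pose e' := e / 3 / (A + F + 1).
have AF : 0 < A + F + 1 by rewrite ltr_wpDl ?addr_ge0.
have e'0 : 0 < e' by rewrite divr_gt0.
have [u [gu uC uv]] := approx C0 Uv vC e'0.
have [Uu _ _] := gu; have [[mu' u2] u0 [mgu gu2]] := Uu.
have luv : l2 mu (fun x => v x - u x) by apply: l2B.
have iqu := pair_integrable C0 mq mgu Nq uC.
have iqv := pair_integrable C0 mq mgv Nq vC.
have mgvu : measurable_fun setT (fun z => grad K v z - grad K u z) by meas.
have E1 : ip pi q (grad K v) + ip mu f v =
    ip pi q (fun z => grad K v z - grad K u z) + ip mu f (fun x => v x - u x).
  have E0 : ip pi q (fun z => grad K v z - grad K u z) =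
      ip pi q (grad K v) - ip pi q (grad K u).
    by rewrite /ip -RintegralB//; apply: eq_Rintegral => z _; rewrite mulrBr.
  rewrite E0 (Hq u gu) (ipBr (conj mv v2) (conj mu' u2) lf); ring.
pose J := \1_[set z | ((k%:R)%:E < (K z)%:E)%E] : T * T -> R.
have mJ : measurable_fun setT J := measurable_indic (measurable_large mK k).
pose q1 z := q z * J z; pose q2 z := q z - q1 z.
have mq1 : measurable_fun setT q1 by rewrite /q1; meas.
have mq2 : measurable_fun setT q2 by rewrite /q2; meas.
have J1 z : `|J z| <= 1 by rewrite /J indicE; case: (_ \in _); rewrite ?normr1 ?normr0.
have q1q z : `|q1 z| <= `|q z| by rewrite normrM ler_piMr.
have q2q z : `|q2 z| <= `|q z|.
  rewrite /q2 /q1 /J indicE; case: (_ \in _); rewrite ?mulr1 ?subrr ?normr0//.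
  by rewrite mulr0 subr0.
have Nq1 : (N12 mu q1 < +oo)%E by apply: le_lt_trans Nq; apply: N12_le.
have Nq2 : (N12 mu q2 < +oo)%E by apply: le_lt_trans Nq; apply: N12_le.
have dC := rown_grad_dist C0 mu' mv uC vC.
have C2 : 0 <= 2 * C by rewrite mulr_ge0.
have i1 := pair_integrable C2 mq1 mgvu Nq1 dC.
have i2 := pair_integrable C2 mq2 mgvu Nq2 dC.
have E2 : ip pi q (fun z => grad K v z - grad K u z) =
    ip pi q1 (fun z => grad K v z - grad K u z) + ip pi q2 (fun z => grad K v z - grad K u z).
  rewrite /ip -RintegralD//; apply: eq_Rintegral => z _.
  by rewrite -mulrDl /q2 (addrC (q1 z)) subrK.
have B1 : `|ip pi q1 (fun z => grad K v z - grad K u z)| <= e / 3.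
  rewrite -lee_fin; apply: (le_trans (pair_abs_le C2 mq1 mgvu Nq1 dC)).
  apply: (@le_trans _ _ ((2 * C)%:E * (e / 3 / (2 * C + 1))%:E)%E).
    by apply: lee_wpmul2l => //; rewrite lee_fin.
  by rewrite -EFinM lee_fin; exact: (mulr_frac_le C2 (ltW e30)).
have B2 : `|ip pi q2 (fun z => grad K v z - grad K u z)| <= e' * A.
  rewrite -lee_fin /ip EFin_normr_Rintegral//.
  apply: le_trans (le_abse_integral _ measurableT _) _; first by meas.
  have := cutoff_pairing_le k mq sq Nq (ltW e'0) mu' mv uv.
  rewrite NE -!EFinM => H; apply: le_trans H _.
  by rewrite lee_fin /A le_eqVlt; apply/orP; left; apply/eqP; ring.
have B3 : `|ip mu f (fun x => v x - u x)| <= e' * F.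
  have s0 : (sqn mu (fun x => v x - u x)%R <= (e' ^+ 2 * m)%:E)%E.
    apply: (@le_trans _ _ (\int[mu]_x ((e' ^+ 2)%:E * (\1_D x)%:E))%E).
      apply: ae_ge0_le_integral => //.
      - by move=> x _; rewrite lee_fin sqr_ge0.
      - by have := luv.1 => ?; meas.
      - by move=> x _; rewrite -EFinM lee_fin mulr_ge0 ?sqr_ge0.
      - by meas.
      apply: filterS uv => x uvx _; rewrite -EFinM lee_fin indicE.
      have [Dx|nD] := pselect (D x).
        rewrite mem_set// mulr1 -(real_normK (num_real (v x - u x))) distrC.
        by apply: lerXn2r => //; rewrite nnegrE ltW.
      have nO : ~ O x by move=> Ox; apply: nD; exact: OD.
      by rewrite u0// v0// subr0 expr0n /= mulr_ge0 ?ler0n ?sqr_ge0.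
    rewrite ge0_integralZl ?lee_fin ?sqr_ge0//; [|by meas].
    rewrite integral_indic// setIT (EFinM (e' ^+ 2) m); apply: lee_wpmul2l => //.
    by rewrite lee_fin sqr_ge0.
  have := cauchy_schwarz_ip lf luv.
  have : ip mu (fun x => v x - u x) (fun x => v x - u x) <= e' ^+ 2 * m.
    by rewrite -lee_fin (ipEFin luv).
  move=> H1 H2.
  have e'F : 0 <= e' * F by apply: mulr_ge0 => //; exact: ltW.
  suff : `|ip mu f (fun x => v x - u x)| ^+ 2 <= (e' * F) ^+ 2 by rewrite ler_sqr ?nnegrE.
  rewrite real_normK ?num_real//; apply: le_trans H2 _.
  have -> : (e' * F) ^+ 2 = ip mu f f * (e' ^+ 2 * m).
    by rewrite exprMn (exprMn _ _ (Num.sqrt m)) !sqr_sqrtr ?ip_ge0// mulrCA.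
  by apply: ler_wpM2l => //; exact: ip_ge0.
rewrite E1 E2; apply: le_trans (ler_normD _ _) _.
apply: le_trans (lerD (ler_normD _ _) (lexx _)) _.
apply: le_trans (lerD (lerD B1 B2) B3) _.
have H4 : e' * (A + F + 1) = e / 3 by rewrite /e' divfK// gt_eqF.
have H5 : e' * (A + F) <= e / 3 by rewrite -H4 ler_wpM2l ?ltW// ltrDl.
rewrite -addrA -mulrDr; apply: le_trans (lerD (lexx _) H5) _.
exact: two_thirds_le.
Qed.

End DensityLimit.

Section Clip.
Context (R : realType).

Definition clip (e t : R) : R := Num.max (- e) (Num.min e t).

Lemma clipE (e t : R) : 0 <= e ->
  clip e t = if t < - e then - e else if e < t then e else t.
Proof.
rewrite /clip maxEge minEle => e0.
by do !case: ifPn => //; rewrite -?leNgt -?ltNge => *; lra.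
Qed.

Lemma clip_abs (e t : R) : 0 <= e -> `|clip e t| <= e.
Proof.
by move=> e0; rewrite ler_norml clipE//; do !case: ifPn; rewrite -?leNgt => *; lra.
Qed.

Lemma clip_id (e t : R) : `|t| <= e -> clip e t = t.
Proof.
move=> te; have e0 := le_trans (normr_ge0 t) te; move: te.
by rewrite ler_norml clipE//; do !case: ifPn; rewrite -?leNgt => *; lra.
Qed.

Lemma clip_lip (e s t : R) : 0 <= e -> `|clip e s - clip e t| <= `|s - t|.
Proof.
move=> e0; rewrite !clipE// ler_norml; case: (ler0P (s - t)) => ?;
  by do !case: ifPn; rewrite -?leNgt => *; lra.
Qed.

(* Shrinking absorbs the error of an approximation of [v]: it restores the value 0
   wherever [v] vanishes, without increasing differences. *)
Definition shrink (e t : R) : R := t - clip e t.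

Lemma shrink0 (e t : R) : `|t| <= e -> shrink e t = 0.
Proof. by move=> te; rewrite /shrink clip_id// subrr. Qed.

Lemma shrink_dist (e t : R) : 0 <= e -> `|shrink e t - t| <= e.
Proof. by move=> e0; rewrite /shrink addrAC subrr add0r normrN clip_abs. Qed.

Lemma shrink_lip (e s t : R) : 0 <= e -> `|shrink e s - shrink e t| <= `|s - t|.
Proof.
move=> e0; rewrite /shrink !clipE// ler_norml; case: (ler0P (s - t)) => ?;
  by do !case: ifPn; rewrite -?leNgt => *; lra.
Qed.

Lemma shrink_abs (e t : R) : 0 <= e -> `|shrink e t| <= `|t|.
Proof.
move=> e0; have := shrink_lip t 0 e0; rewrite subr0.
by rewrite (shrink0 (t := 0)) ?normr0// subr0.
Qed.

Lemma measurable_clip (e : R) : measurable_fun setT (clip e).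
Proof. by apply: measurable_maxr => //; apply: measurable_minr. Qed.

Lemma measurable_shrink (e : R) : measurable_fun setT (shrink e).
Proof. by apply: measurable_funB => //; exact: measurable_clip. Qed.

End Clip.

(** * Uniform approximation by regular potentials *)

Section Approximation.
Context (R : realType) (n : nat).
Local Notation T := (Rn R n).
Variable mu : {sigma_finite_measure set T -> \bar R}.
Local Notation pi := (mu \x mu)%E.
Local Notation "x +v y" := ((x : 'rV[R]_n) + (y : 'rV[R]_n) : T) (at level 50).
Local Notation "x -v y" := ((x : 'rV[R]_n) - (y : 'rV[R]_n) : T) (at level 50).
Hypothesis Htr : forall (a : T) (g : T -> \bar R), measurable_fun setT g ->
  (forall x, 0 <= g x)%E -> (\int[mu]_x g (x +v a) = \int[mu]_x g x)%E.
Variables (O D S : set T) (w : T -> R) (m : R).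
Hypotheses (mO : measurable O) (mD : measurable D) (mS : measurable S).
Hypothesis mw : measurable_fun setT w.
Hypothesis w0 : forall z, 0 <= w z.
Hypothesis wN : forall z, w (- (z : 'rV[R]_n)) = w z.
Hypothesis OD : O `<=` D.
Local Notation K := (Kof w).
Hypothesis K0 : forall x y, O x -> ~ D y -> K (x, y) = 0.
Hypothesis m0 : 0 <= m.
Hypothesis muDm : (mu D <= m%:E)%E.
Hypothesis muS : (mu S < +oo)%E.
Hypothesis wS : forall z, ~ S z -> w z = 0.

Definition wtail (k : nat) (z : T) : R := w z * \1_[set z | ((k%:R)%:E < (w z)%:E)%E] z.

Lemma measurable_wtail k : measurable_fun setT (wtail k).
Proof.
by apply: measurable_funM => //; apply: measurable_indic; apply: measurable_gt_set; meas.
Qed.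

Lemma wtailN k z : wtail k (- (z : 'rV[R]_n)) = wtail k z.
Proof.
rewrite /wtail wN !indicE; congr (_ * (nat_of_bool _)%:R).
by apply/idP/idP; rewrite !in_setE /= wN.
Qed.

Lemma wtail_rest k z : `|w z - wtail k z| <= k%:R.
Proof.
rewrite /wtail indicE; case: (ltP (k%:R)%:E (w z)%:E) => h.
  by rewrite mem_set// mulr1 subrr normr0.
by rewrite memNset ?mulr0 ?subr0 ?ger0_norm//= ltNge h.
Qed.

Let mK : measurable_fun setT K. Proof. exact: measurable_Kof. Qed.

(** The bounded part is the gradient of [g] for the kernel cut at level k, bounded by 2 B k; the
    remainder is its gradient for [wtail k]. [u] has to vanish off [O] and [g] to be bounded, both
    at every point, so the two are kept distinct. *)
Lemma regular_of_ae_eq (u g : T -> R) (C B : R) : inU mu O K u -> measurable_fun setT g ->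
  (forall x, `|g x| <= B) -> {ae mu, forall x, u x = g x} -> 0 <= C ->
  {ae mu, forall x, rowsq mu (grad K g) x <= (C ^+ 2)%:E}%E ->
  (forall e : R, 0 < e -> exists k,
    {ae mu, forall x, rowsq mu (grad (Kof (wtail k)) g) x <= e%:E}%E) ->
  regular mu O K u /\ {ae mu, forall x, rown mu (grad K u) x <= C%:E}%E.
Proof.
move=> Uu mg gB ug C0 gC gtail.
have [[mu' u2] u0 [mgu gu2]] := Uu.
have B0 : 0 <= B by apply: le_trans (gB (0 : 'rV[R]_n)).
have mgg := measurable_grad mK mg.
have uC : {ae mu, forall x, rown mu (grad K u) x <= C%:E}%E.
  apply: filterS2 (ae_row mgu mgg (grad_ae K mu' mg ug)) gC => x -> h.
  by rewrite rown_le_sq.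
split => //; split => //; first by exists C.
move=> e e0; have [k Hk] := gtail (e ^+ 2) (exprn_gt0 _ e0).
have mwr : measurable_fun setT (fun z => w z - wtail k z).
  by apply: measurable_funB => //; exact: measurable_wtail.
have mKr := measurable_Kof mwr.
have mb := measurable_grad mKr mg.
have mKt := measurable_Kof (measurable_wtail k).
have mgt := measurable_grad mKt mg.
exists (grad (Kof (fun z => w z - wtail k z)) g), ((B + B) * k%:R); split => //.
- by rewrite mulr_ge0 ?addr_ge0.
- move=> z; rewrite /grad normrM; apply: ler_pM => //; last exact: wtail_rest.
  by apply: le_trans (ler_normB _ _) _; exact: lerD.
have mub : measurable_fun setT
  (fun z => grad K u z - grad (Kof (fun z => w z - wtail k z)) g z) by meas.
have aeE : {ae pi, forall z, grad K u z - grad (Kof (fun z => w z - wtail k z)) g z =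
    grad (Kof (wtail k)) g z}.
  apply: filterS (grad_ae K mu' mg ug) => z ->.
  by rewrite /grad /Kof -mulrBr; congr (_ * _); rewrite opprB addrC subrK.
apply: filterS2 (ae_row mub mgt aeE) Hk => x -> h.
by rewrite rown_le_sq// ltW.
Qed.

Lemma inU_bounded (u : T -> R) (C B : R) : measurable_fun setT u ->
  (forall x, ~ O x -> u x = 0) -> (forall x, `|u x| <= B) ->
  {ae mu, forall x, rowsq mu (grad K u) x <= C%:E}%E -> inU mu O K u.
Proof.
move=> mu' u0 uB uC.
have B0 : 0 <= B by apply: le_trans (uB (0 : 'rV[R]_n)).
have muDoo : (mu D < +oo)%E by apply: le_lt_trans muDm _; rewrite ltry.
have bound (c : R) : 0 <= c -> (\int[mu]_x (c%:E * (\1_D x)%:E) < +oo)%E.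
  move=> c0; rewrite ge0_integralZl ?lee_fin//; last by meas.
  by rewrite integral_indic// setIT lte_mul_pinfty// lee_fin.
split => //.
  split => //; apply: le_lt_trans (bound (B ^+ 2) (sqr_ge0 _)).
  apply: ge0_le_integral => //; [|by meas|by meas|].
  - by move=> x _; rewrite lee_fin sqr_ge0.
  - move=> x _; rewrite -EFinM lee_fin indicE; have [Dx|nD] := pselect (D x).
      rewrite mem_set// mulr1 -(real_normK (num_real (u x))).
      by apply: lerXn2r => //; rewrite nnegrE.
    have nO : ~ O x by move=> Ox; apply: nD; exact: OD.
    by rewrite u0// expr0n /= mulr_ge0 ?ler0n ?sqr_ge0.
have mgu := measurable_grad mK mu'.
split => //; rewrite sqn_rowsq//.
have C'0 : 0 <= Num.max C 0 by rewrite le_max lexx orbT.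
apply: le_lt_trans (bound (Num.max C 0) C'0).
apply: ae_ge0_le_integral => //.
- by move=> x _; exact: rowsq_ge0.
- exact: measurable_rowsq.
- by move=> x _; rewrite -EFinM lee_fin mulr_ge0.
- by meas.
apply: filterS uC => x uCx _; have [Dx|nD] := pselect (D x).
  rewrite indicE mem_set// mule1; apply: le_trans uCx _.
  by rewrite lee_fin le_max lexx.
have -> : rowsq mu (grad K u) x = 0%E.
  apply: integral0_eq => y _; rewrite /grad /=.
  have nO : ~ O x by move=> Ox; apply: nD; exact: OD.
  rewrite (u0 x)//; have [Oy|nOy] := pselect (O y).
    by rewrite KofC// K0// mulr0 expr0n.
  by rewrite u0// subrr mul0r expr0n.
by rewrite -EFinM lee_fin mulr_ge0.
Qed.

Lemma inU_integrable u : inU mu O K u -> mu.-integrable setT (EFin \o u).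
Proof.
move=> [lu u0 _].
have l1 : l2 mu (\1_D : T -> R).
  split; first by meas.
  rewrite /sqn (eq_integral (fun x => (\1_D x)%:E)); last first.
    by move=> x _; rewrite indicE; case: (_ \in _); rewrite ?expr1n ?expr0n.
  by rewrite integral_indic// setIT; apply: le_lt_trans muDm _; rewrite ltry.
have := l2_integrableM lu l1; apply: eq_integrable => // x _ /=.
have [Dx|nD] := pselect (D x); first by rewrite indicE mem_set// mulr1.
rewrite u0 ?mul0r// => Ox; apply: nD; exact: OD.
Qed.

Lemma rowsq_grad_lip (k : T -> R) (g h : T -> R) x : measurable_fun setT k ->
  measurable_fun setT g -> measurable_fun setT h ->
  (forall x y, `|g x - g y| <= `|h x - h y|) ->
  (rowsq mu (grad (Kof k) g) x <= rowsq mu (grad (Kof k) h) x)%E.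
Proof.
move=> mk mg mh gh; have mKk := measurable_Kof mk.
apply: rowsq_le; [exact: measurable_grad|exact: measurable_grad|].
by move=> y; rewrite /grad !normrM ler_wpM2r.
Qed.

Lemma wtail_sq_le (e : R) : (\int[mu]_z (w z ^+ 2)%:E < +oo)%E -> 0 < e ->
  exists k, (\int[mu]_z (wtail k z ^+ 2)%:E <= e%:E)%E.
Proof.
move=> w2 e0.
have mw2 : measurable_fun setT (fun z => (w z ^+ 2)%:E) by meas.
have mwE : measurable_fun setT (fun z => (w z)%:E) by meas.
have w20 z : (0 <= (w z ^+ 2)%:E)%E by rewrite lee_fin sqr_ge0.
have wfin : {ae mu, forall z, (w z)%:E < +oo}%E by apply: aeW => z; rewrite ltry.
have [k _ Hk] := integral_tail mw2 mwE w20 w2 wfin e0.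
exists k; have := Hk k (leqnn k); congr (_ <= _)%E; apply: eq_integral => z _.
by rewrite /wtail exprMn -EFinM; congr (_ * _)%:E; rewrite indicE; case: (_ \in _); rewrite ?expr1n ?expr0n.
Qed.

(** Average v(x)^2 <= 2 (v(z + x) - v(x))^2 + 2 v(z + x)^2 in z with an integrable weight of
    positive mass below both w^2 and 1: the first term is bounded by the row at x, the second by the
    L^2 norm of v. *)
Lemma ae_bounded_of_rows v (C : R) : (0 < \int[mu]_z (w z ^+ 2)%:E)%E ->
  inU mu O K v -> 0 <= C ->
  {ae mu, forall x, rown mu (grad K v) x <= C%:E}%E ->
  exists2 B : R, 0 <= B & {ae mu, forall x, `|v x| <= B}.
Proof.
move=> wpos [[mv v2] v0 [mgv gv2]] C0 vC.
pose r z := Num.min (w z) 1 ^+ 2.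
have mr : measurable_fun setT r by apply: measurable_funX; apply: measurable_minr.
have r0 z : 0 <= r z by exact: sqr_ge0.
have mn0 z : 0 <= Num.min (w z) 1 by rewrite le_min w0 ler01.
have r1 z : r z <= 1 by rewrite /r exprn_ile1// ge_min lexx orbT.
have rw z : r z <= w z ^+ 2.
  by apply: lerXn2r; rewrite ?nnegrE// ge_min lexx.
have Ir : (\int[mu]_z (r z)%:E < +oo)%E.
  apply: le_lt_trans muS; rewrite -(setIT S) -integral_indic//.
  apply: ge0_le_integralR => //.
  move=> z; rewrite indicE; have [Sz|nS] := pselect (S z).
    by rewrite mem_set.
  by rewrite memNset// /r wS// min_l ?ler01// expr0n.
have Ir0 : (0 < \int[mu]_z (r z)%:E)%E.
  rewrite lt0e integral_ge0 ?andbT; last by move=> z _; rewrite lee_fin.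
  apply/negP => /eqP r00.
  have mmn : measurable_fun setT (fun z => Num.min (w z) 1) by exact: measurable_minr.
  move: wpos; rewrite ltNge => /negP; apply.
  rewrite -(@integral0 _ _ _ mu setT); apply: ae_ge0_le_integral => //.
  - by move=> z _; rewrite lee_fin sqr_ge0.
  - by meas.
  apply: filterS (sqn0_ae mmn r00) => z + _.
  have [w1|w1] := leP (w z) 1; first by move=> ->; rewrite expr0n.
  by move=> h; have := ltr01 (R := R); rewrite h ltxx.
pose I := fine (\int[mu]_z (r z)%:E)%E.
have IE : (\int[mu]_z (r z)%:E)%E = I%:E.
  by rewrite fineK// ge0_fin_numE// ltW.
have I0 : 0 < I by rewrite -lte_fin -IE.
pose V := fine (sqn mu v).
have VE : sqn mu v = V%:E by rewrite fineK// ge0_fin_numE// sqn_ge0.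
have V0 : 0 <= V by rewrite -lee_fin -VE sqn_ge0.
exists (Num.sqrt ((2 * C ^+ 2 + 2 * V) / I)); first exact: sqrtr_ge0.
apply: filterS vC => x; rewrite rown_le_sq// rowsq_shift// => vx.
rewrite -sqrtr_sqr ler_sqrt; last first.
  by apply: divr_ge0; [apply: addr_ge0; apply: mulr_ge0 => //; exact: sqr_ge0|exact: ltW].
rewrite ler_pdivlMr// -lee_fin EFinM -IE -ge0_integralZlR ?sqr_ge0//.
have mvx := measurable_shift x mv.
apply: (@le_trans _ _ (\int[mu]_z (2 * (w z ^+ 2 * (v (z +v x) - v x) ^+ 2) + 2 * v (z +v x) ^+ 2)%:E)%E).
  apply: ge0_le_integralR; [by meas|by meas|by move=> z; rewrite mulr_ge0 ?sqr_ge0|].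
  move=> z; apply: (@le_trans _ _ (r z * (2 * (v (z +v x) - v x) ^+ 2 + 2 * v (z +v x) ^+ 2))).
    rewrite mulrC ler_wpM2l// -subr_ge0.
    have -> : 2 * (v (z +v x) - v x) ^+ 2 + 2 * v (z +v x) ^+ 2 - v x ^+ 2 =
      (2 * v (z +v x) - v x) ^+ 2 by ring.
    exact: sqr_ge0.
  rewrite mulrDr; apply: lerD; first by rewrite mulrCA; apply: ler_wpM2l => //; apply: ler_wpM2r => //; exact: sqr_ge0.
  by apply: ler_piMl => //; apply: mulr_ge0 => //; exact: sqr_ge0.
rewrite ge0_integralDR; [|by meas|by move=> z; apply: mulr_ge0 => //; apply: mulr_ge0; exact: sqr_ge0|by meas|by move=> z; rewrite mulr_ge0 ?sqr_ge0].
rewrite EFinD; apply: leeD.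
  rewrite ge0_integralZlR//; [|by meas|by move=> z; rewrite mulr_ge0 ?sqr_ge0].
  by rewrite (EFinM 2); apply: lee_wpmul2l => //; rewrite lee_fin.
rewrite ge0_integralZlR//; [|by meas|by move=> z; rewrite sqr_ge0].
rewrite (EFinM 2); apply: lee_wpmul2l; first by rewrite lee_fin.
rewrite (Htr x (g := fun z => (v z ^+ 2)%:E)) -/(sqn mu v) ?VE//; first by meas.
by move=> z; rewrite lee_fin sqr_ge0.
Qed.

(** The tail of an integrable w^2 is small, and a bounded potential turns this into smallness of
    every row of its gradient for [wtail k]. Clipping provides a representative bounded at every
    point. *)
Lemma regular_of_square_integrable v (C : R) : (0 < \int[mu]_z (w z ^+ 2)%:E < +oo)%E ->
  inU mu O K v -> 0 <= C ->
  {ae mu, forall x, rown mu (grad K v) x <= C%:E}%E -> regular mu O K v.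
Proof.
move=> /andP[wpos wfin] Uv C0 vC.
have [B B0 vB] := ae_bounded_of_rows wpos Uv C0 vC.
have [[mv _] v0 [mgv _]] := Uv.
pose g x := clip B (v x).
have mg : measurable_fun setT g by apply: (measurableT_comp (@measurable_clip R B) mv).
have gB x : `|g x| <= B by exact: clip_abs.
have vg : {ae mu, forall x, v x = g x} by apply: filterS vB => x vx; rewrite /g clip_id.
have gC : {ae mu, forall x, rowsq mu (grad K g) x <= (C ^+ 2)%:E}%E.
  apply: filterS vC => x; rewrite rown_le_sq// => vx; apply: le_trans vx.
  by apply: rowsq_grad_lip => // y z; exact: clip_lip.
apply: (proj1 (regular_of_ae_eq Uv mg gB vg C0 gC _)).
move=> e e0; have B1 : 0 < 4 * B ^+ 2 + 1 by rewrite ltr_wpDl// mulr_ge0 ?sqr_ge0.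
have [k Hk] := wtail_sq_le wfin (divr_gt0 e0 B1).
have mt := measurable_wtail k.
exists k; apply: aeW => x; rewrite rowsq_shift//; last exact: wtailN.
have mgx := measurable_shift x mg.
apply: (@le_trans _ _ (\int[mu]_z (4 * B ^+ 2 * wtail k z ^+ 2)%:E)%E).
  apply: ge0_le_integralR; [by meas|by meas|by move=> z; rewrite mulr_ge0 ?sqr_ge0|].
  move=> z; rewrite mulrC ler_wpM2r ?sqr_ge0//.
  rewrite -(real_normK (num_real (_ - _))) (_ : 4 * B ^+ 2 = (B + B) ^+ 2); last by ring.
  apply: lerXn2r; rewrite ?nnegrE ?addr_ge0//.
  by apply: le_trans (ler_normB _ _) _; exact: lerD.
rewrite ge0_integralZlR//; [|by rewrite mulr_ge0 ?sqr_ge0|by meas|by move=> z; exact: sqr_ge0].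
apply: (@le_trans _ _ ((4 * B ^+ 2)%:E * (e / (4 * B ^+ 2 + 1))%:E)%E).
  by apply: lee_wpmul2l => //; rewrite lee_fin mulr_ge0 ?sqr_ge0.
rewrite -EFinM lee_fin; apply: mulr_frac_le; last exact: ltW.
by rewrite mulr_ge0 ?sqr_ge0.
Qed.

Lemma truncated_mass (A : R) : (\int[mu]_z (w z ^+ 2)%:E = +oo)%E ->
  exists j : nat, (A%:E < \int[mu]_z (Num.min (w z ^+ 2) j%:R)%:E)%E.
Proof.
move=> winf; apply: contrapT => H.
have HA j : (\int[mu]_z (Num.min (w z ^+ 2) j%:R)%:E <= A%:E)%E.
  by rewrite leNgt; apply/negP => h; apply: H; exists j.
have : (\int[mu]_z (w z ^+ 2)%:E <= A%:E)%E.
  apply: (fatou_le (g := fun j z => Num.min (w z ^+ 2) j%:R)).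
  - by move=> j; apply: measurable_minr => //; meas.
  - by move=> j z; rewrite le_min sqr_ge0 ler0n.
  - move=> z; apply: cvg_near_cst.
    near=> j; rewrite min_l//; near: j.
    exact: nbhs_infty_ger.
  - by apply: nearW.
by rewrite winf leye_eq.
Unshelve. all: by end_near. Qed.

(* The averaging weight is min (w^2, j) / c with c its mass: by Jensen the averaging
   error at x is at most the norm of the row of [grad K v] divided by sqrt c. *)
Lemma approx_of_not_square_integrable v (C e : R) : (\int[mu]_z (w z ^+ 2)%:E = +oo)%E ->
  0 <= C -> inU mu O K v ->
  {ae mu, forall x, rown mu (grad K v) x <= C%:E}%E -> 0 < e ->
  exists u, [/\ regular mu O K u, {ae mu, forall x, rown mu (grad K u) x <= C%:E}%E &
    {ae mu, forall x, `|u x - v x| <= e}].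
Proof.
move=> winf C0 Uv vC e0.
have [[mv v2] v0 [mgv gv2]] := Uv.
have iv := inU_integrable Uv.
(* Half of e is for averaging, half for shrinking; a mass c beyond C^2 / h^2 makes the averaging
   error C / sqrt c at most h. *)
pose h := e / 2; have h0 : 0 < h by rewrite divr_gt0.
have [j Hj] := truncated_mass (C ^+ 2 / h ^+ 2) winf.
pose r z := Num.min (w z ^+ 2) j%:R.
have mr : measurable_fun setT r by apply: measurable_minr => //; meas.
have r0 z : 0 <= r z by rewrite le_min sqr_ge0 ler0n.
have Ir : (\int[mu]_z (r z)%:E < +oo)%E.
  apply: (@le_lt_trans _ _ (\int[mu]_z ((j%:R)%:E * (\1_S z)%:E))%E).
    apply: ge0_le_integral => //; [by move=> z _; rewrite lee_fin|by meas|by meas|].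
    move=> z _; rewrite -EFinM lee_fin indicE; have [Sz|nS] := pselect (S z).
      by rewrite mem_set// mulr1 ge_min lexx orbT.
    by rewrite memNset// mulr0 /r wS// expr0n min_l ?ler0n.
  rewrite ge0_integralZl ?lee_fin//; last by meas.
  by rewrite integral_indic// setIT lte_mul_pinfty// lee_fin.
pose c := fine (\int[mu]_z (r z)%:E)%E.
have cE : (\int[mu]_z (r z)%:E)%E = c%:E.
  by rewrite fineK// ge0_fin_numE//; apply: integral_ge0 => z _; rewrite lee_fin.
have cC : C ^+ 2 / h ^+ 2 < c by rewrite -lte_fin -cE.
have c0 : 0 < c by apply: le_lt_trans cC; rewrite divr_ge0 ?sqr_ge0.
pose rho z := c^-1 * r z.
have ci0 : 0 <= c^-1 by rewrite invr_ge0 ltW.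
have mrho : measurable_fun setT rho by rewrite /rho; meas.
have rho0 z : 0 <= rho z by rewrite mulr_ge0.
have rhoB z : rho z <= c^-1 * j%:R by rewrite ler_wpM2l// ge_min lexx orbT.
have rho1 : (\int[mu]_z (rho z)%:E = 1)%E.
  by rewrite ge0_integralZlR// cE -EFinM mulVf// gt_eqF.
have rhow z : rho z <= c^-1 * w z ^+ 2 by rewrite ler_wpM2l// ge_min lexx.
pose s := smooth mu rho v.
have ms : measurable_fun setT s by exact: measurable_smooth.
pose B := c^-1 * j%:R * fine (\int[mu]_x `|v x|%:E)%E.
have sB x : `|s x| <= B by exact: smooth_bounded.
have sv : {ae mu, forall x, `|s x - v x| <= h}.
  apply: filterS vC => x; rewrite rown_le_sq// rowsq_shift// => vx.
  rewrite -ler_sqr ?nnegrE ?(ltW h0)// real_normK ?num_real// -lee_fin.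
  apply: le_trans (smooth_dist_sq Htr mrho rho0 rhoB rho1 mv iv x) _.
  have mvx := measurable_shift x mv.
  apply: (@le_trans _ _ (\int[mu]_z (c^-1 * (w z ^+ 2 * (v (z +v x) - v x) ^+ 2))%:E)%E).
    apply: ge0_le_integralR; [by meas|by meas|by move=> z; rewrite mulr_ge0 ?sqr_ge0|].
    by move=> z; rewrite [leRHS]mulrA; apply: ler_wpM2r => //; exact: sqr_ge0.
  rewrite ge0_integralZlR//; [|by meas|by move=> z; rewrite mulr_ge0 ?sqr_ge0].
  apply: (@le_trans _ _ ((c^-1)%:E * (C ^+ 2)%:E)%E); first exact: lee_wpmul2l.
  rewrite -EFinM lee_fin mulrC ler_pdivrMr//.
  by move: cC; rewrite ltr_pdivrMr ?exprn_gt0// mulrC => /ltW.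
pose g x := shrink h (s x).
have mg : measurable_fun setT g by apply: (measurableT_comp (@measurable_shrink R h) ms).
have glip x y : `|g x - g y| <= `|s x - s y| by apply: shrink_lip; exact: ltW.
have gB x : `|g x| <= B by apply: le_trans (shrink_abs _ (ltW h0)) (sB x).
pose u x := \1_O x * g x.
have mu' : measurable_fun setT u by rewrite /u; meas.
have u0 x : ~ O x -> u x = 0 by move=> nO; rewrite /u indicE memNset// mul0r.
have uB x : `|u x| <= B.
  apply: le_trans (gB x); rewrite normrM ler_piMl// indicE.
  by case: (_ \in _); rewrite ?normr1 ?normr0.
have ug : {ae mu, forall x, u x = g x}.
  apply: filterS sv => x svx; have [Ox|nO] := pselect (O x).
    by rewrite /u indicE mem_set// mul1r.
  by rewrite u0// /g shrink0//; rewrite v0// subr0 in svx.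
have sC x : (rowsq mu (grad K s) x <= (C ^+ 2)%:E)%E.
  apply: (smooth_rowsq_sup Htr mw wN mrho rho0 rhoB rho1 mv iv); first exact: sqr_ge0.
  by apply: filterS vC => y; rewrite rown_le_sq.
have gC x : (rowsq mu (grad K g) x <= (C ^+ 2)%:E)%E.
  by apply: le_trans (sC x); exact: rowsq_grad_lip.
have mgu := measurable_grad mK mu'; have mgg := measurable_grad mK mg.
have uC : {ae mu, forall x, rowsq mu (grad K u) x <= (C ^+ 2)%:E}%E.
  apply: filterS (ae_row mgu mgg (grad_ae K mu' mg ug)) => x hx.
  by rewrite -rown_le_sq// hx rown_le_sq.
have Uu := inU_bounded mu' u0 uB uC.
have [gu ur] : regular mu O K u /\ {ae mu, forall x, rown mu (grad K u) x <= C%:E}%E.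
  apply: (regular_of_ae_eq Uu mg gB ug C0); first exact: aeW.
  move=> t t0.
  have B1 : 0 < c^-1 * j%:R + 1 by rewrite ltr_wpDl// mulr_ge0.
  (* Averaging turns an L^2 bound into a bound on rows: the tail of [grad K v] is small in L^2, and
     the bounded weight makes every row of the averaged tail small. *)
  have [k _ Hk] := sqn_tail mK (conj mgv gv2) (divr_gt0 t0 B1).
  have {}Hk := Hk k (leqnn k).
  exists k; apply: aeW => x; have mt := measurable_wtail k.
  apply: le_trans (rowsq_grad_lip x mt mg ms glip) _.
  apply: le_trans (smooth_rowsq_bound Htr mt (wtailN k) mrho rho0 rhoB rho1 mv iv x) _.
  apply: (@le_trans _ _ ((c^-1 * j%:R)%:E * (t / (c^-1 * j%:R + 1))%:E)%E).
    apply: lee_wpmul2l; first by rewrite lee_fin mulr_ge0.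
    apply: le_trans Hk; rewrite le_eqVlt; apply/orP; left; apply/eqP.
    by apply: eq_integral => z _; rewrite /grad /Kof /wtail mulrA.
  rewrite -EFinM lee_fin; apply: mulr_frac_le; last exact: ltW.
  exact: mulr_ge0.
exists u; split => //.
apply: filterS2 sv ug => x svx ->.
apply: le_trans (ler_distD (s x) _ _) _.
by rewrite [e]splitr; apply: lerD => //; apply: shrink_dist; exact: ltW.
Qed.

Hypothesis wpos : (0 < \int[mu]_z (w z ^+ 2)%:E)%E.

Lemma exists_regular_approx v (C e : R) : 0 <= C -> inU mu O K v ->
    {ae mu, forall x, rown mu (grad K v) x <= C%:E}%E -> 0 < e ->
  exists u, [/\ regular mu O K u, {ae mu, forall x, rown mu (grad K u) x <= C%:E}%E &
    {ae mu, forall x, `|u x - v x| <= e}].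
Proof.
move=> C0 Uv vC e0; have [winf|wfin] := eqVneq (\int[mu]_z (w z ^+ 2)%:E)%E +oo%E.
  exact: approx_of_not_square_integrable.
exists v; split => //; last by apply: aeW => x; rewrite subrr normr0 ltW.
by apply: (regular_of_square_integrable _ Uv C0 vC); rewrite wpos ltey.
Qed.

End Approximation.

(** * The nonlocal Poincare inequality *)

Section Geometry.
Context (R : realType) (n : nat).
Local Notation T := (Rn R n).
Implicit Types x y z : 'rV[R]_n.

Lemma edot_ge0 x : 0 <= edot x x.
Proof. by apply: sumr_ge0 => i _; rewrite -expr2 sqr_ge0. Qed.

Lemma enorm_ge0 x : 0 <= enorm x. Proof. exact: sqrtr_ge0. Qed.

Lemma enorm_sq x : enorm x ^+ 2 = edot x x.
Proof. by rewrite sqr_sqrtr// edot_ge0. Qed.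

Lemma enorm0 : enorm (0 : 'rV[R]_n) = 0.
Proof. by rewrite /enorm /edot big1 ?sqrtr0// => i _; rewrite !mxE mul0r. Qed.

Lemma enormN x : enorm (- x) = enorm x.
Proof. by rewrite /enorm /edot; congr Num.sqrt; apply: eq_bigr => i _; rewrite !mxE mulrNN. Qed.

Lemma enormZ a x : 0 <= a -> enorm (a *: x) = a * enorm x.
Proof.
move=> a0; rewrite -[in RHS](ger0_norm a0) -sqrtr_sqr -sqrtrM ?sqr_ge0//.
rewrite /enorm; congr Num.sqrt; rewrite /edot mulr_sumr; apply: eq_bigr => i _.
by rewrite !mxE; ring.
Qed.

Lemma edotD_le x y : edot (x + y) (x + y) <= 2 * edot x x + 2 * edot y y.
Proof.
rewrite /edot !mulr_sumr -big_split /=; apply: ler_sum => i _; rewrite !mxE -subr_ge0.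
have -> : 2 * (x 0 i * x 0 i) + 2 * (y 0 i * y 0 i) - (x 0 i + y 0 i) * (x 0 i + y 0 i) =
  (x 0 i - y 0 i) ^+ 2 by ring.
exact: sqr_ge0.
Qed.

(** A crude form of the triangle inequality; only boundedness is drawn from it. *)
Lemma enormD_le x y (a b : R) : enorm x <= a -> enorm y <= b ->
  enorm (x + y) <= 2 * (a + b).
Proof.
move=> xa yb; have a0 := le_trans (enorm_ge0 x) xa; have b0 := le_trans (enorm_ge0 y) yb.
rewrite -ler_sqr ?nnegrE ?enorm_ge0 ?mulr_ge0 ?addr_ge0// enorm_sq.
apply: le_trans (edotD_le _ _) _; rewrite -!enorm_sq.
have xa2 : enorm x ^+ 2 <= a ^+ 2 by rewrite ler_sqr ?nnegrE ?enorm_ge0.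
have yb2 : enorm y ^+ 2 <= b ^+ 2 by rewrite ler_sqr ?nnegrE ?enorm_ge0.
apply: (@le_trans _ _ (2 * a ^+ 2 + 2 * b ^+ 2)); first by apply: lerD; apply: ler_wpM2l.
rewrite -subr_ge0 (_ : _ - _ = 2 * a ^+ 2 + 2 * b ^+ 2 + 8 * (a * b)); last by ring.
by apply: addr_ge0; [apply: addr_ge0; apply: mulr_ge0 => //; exact: sqr_ge0|rewrite !mulr_ge0].
Qed.

Lemma coord_le_enorm x i : `|x 0 i| <= enorm x.
Proof.
rewrite -sqrtr_sqr /enorm ler_sqrt ?edot_ge0// /edot (bigD1 i)//= expr2 lerDl.
by apply: sumr_ge0 => j _; rewrite -expr2 sqr_ge0.
Qed.

Lemma continuous_enorm : continuous (fun y : 'rV[R]_n => enorm y).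
Proof.
move=> y; rewrite /enorm.
apply: (@continuous_comp _ _ _ (fun z : 'rV[R]_n => edot z z) (@Num.sqrt R));
  last exact: sqrt_continuous.
rewrite /edot; apply: continuous_big => [|i _].
  exact: add_continuous.
by move=> z; apply: continuousM; exact: coord_continuous.
Qed.

Lemma open_eball (x : 'rV[R]_n) r : open (eball x r).
Proof.
have -> : eball x r = (fun y : 'rV[R]_n => enorm (y - x)) @^-1` [set t | t < r].
  by [].
apply: open_comp; last exact: open_lt.
move=> y _; apply: continuous_comp; last exact: continuous_enorm.
apply: continuousB => //; exact: cst_continuous.
Qed.

Lemma measurable_open (A : set T) : open (A : set 'rV[R]_n) -> measurable A.
Proof. by move=> oA; apply: sub_sigma_algebra. Qed.

Lemma open_Odelta (O : set 'rV[R]_n) (delta : R) : open (Odelta O delta : set 'rV[R]_n).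
Proof.
have -> : Odelta O delta = \bigcup_(x in O) eball x delta.
  by apply/seteqP; split=> y; [move=> [x [Ox h]]; exists x|move=> [x Ox h]; exists x].
by apply: bigcup_open => x _; exact: open_eball.
Qed.

Lemma sub_Odelta (O : set 'rV[R]_n) (delta : R) : 0 < delta -> O `<=` Odelta O delta.
Proof. by move=> d0 x Ox; exists x; split; rewrite // subrr enorm0. Qed.

Lemma bounded_sub_cube (A : set T) (M : R) : (forall x, A x -> enorm x <= M) ->
  exists k, A `<=` @cube R n k.
Proof.
move=> AM; exists (Num.bound `|M|) => x Ax i; rewrite !mxE.
have h : `|(x : 'rV[R]_n) 0 i| < (Num.bound `|M|)%:R.
  have hM := archi_boundP (normr_ge0 M).
  apply: (le_lt_trans _ hM); apply: le_trans (ler_norm _).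
  exact: le_trans (coord_le_enorm x i) (AM _ Ax).
by move: h; rewrite ltr_norml => /andP[/ltW -> ->].
Qed.

Lemma bounded_Odelta (O : set 'rV[R]_n) (delta : R) : ebounded O ->
  exists M, forall x, Odelta O delta x -> enorm x <= M.
Proof.
move=> [M OM]; exists (2 * (delta + M)) => y [x [Ox xy]].
by rewrite -(subrK x y); apply: enormD_le; [exact: ltW|exact: OM].
Qed.

Lemma bounded_diff (O : set 'rV[R]_n) : ebounded O ->
  exists L, forall x z, O x -> O (z + x) -> enorm z <= L.
Proof.
move=> [M OM]; exists (2 * (M + M)) => x z Ox Ozx.
by rewrite -(addrK x z); apply: enormD_le; rewrite ?enormN; exact: OM.
Qed.

Variable mu : {measure set T -> \bar R}.
Hypothesis lmu : is_lebesgue mu.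

Lemma bounded_measure_lty (A : set T) (M : R) : measurable A ->
  (forall x, A x -> enorm x <= M) -> (mu A < +oo)%E.
Proof.
move=> mA AM; have [k Ak] := bounded_sub_cube AM.
apply: le_lt_trans (lebesgue_cube_lty lmu k).
by apply: le_measure => //; rewrite inE//; exact: measurable_box.
Qed.

(** The inverse of 0 is 0, so a vanishing constant would let the normalisation in [kernel_ok] admit
    the zero kernel. On the box with sides [t, 2 t), which lies in the unit ball because n (2 t)^2 =
    1 / (4 n) < 1, the integrand is at least t^2. *)
Lemma K2n_neq0 : (0 < n)%N -> K2n mu != 0.
Proof.
move=> n0; pose t : R := (4 * n%:R)^-1.
have nR : 0 < n%:R :> R by rewrite ltr0n.
have t0 : 0 < t by rewrite invr_gt0 mulr_gt0.
pose A : set T := box (const_mx t) (const_mx (2 * t)).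
have mA : measurable A by exact: measurable_box.
have muA : mu A = (t ^+ n)%:E.
  rewrite lmu; last by move=> i; rewrite !mxE ler_peMl ?ltW// ltr1n.
  rewrite (eq_bigr (fun=> t)) ?prodr_const ?card_ord// => i _.
  by rewrite !mxE mulr_natl mulr2n addrK.
have mB : measurable (eball (0 : 'rV[R]_n) 1 : set T) by apply: measurable_open; exact: open_eball.
have AB : A `<=` eball 0 1.
  move=> x Ax; rewrite /eball /= subr0 -[ltRHS]sqrtr1 ltr_sqrt//.
  apply: (@le_lt_trans _ _ (\sum_(i < n) (2 * t) ^+ 2)).
    apply: ler_sum => i _; rewrite -expr2; have := Ax i; rewrite !mxE => /andP[h1 h2].
    have x0 := le_trans (ltW t0) h1; have t20 : 0 <= 2 * t by rewrite mulr_ge0// ltW.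
    by apply: lerXn2r => //; exact: ltW.
  rewrite sumr_const card_ord -[ltLHS]mulr_natr.
  have -> : (2 * t) ^+ 2 * n%:R = (4 * n%:R)^-1 by rewrite /t; field; rewrite gt_eqF.
  rewrite invf_lt1 ?mulr_gt0//.
  by apply: (@lt_le_trans _ _ 4); rewrite ?ltr1n// ler_peMr// ler1n.
have muB : (mu (eball 0 1) < +oo)%E.
  by apply: (@bounded_measure_lty _ 1) => // x; rewrite /eball /= subr0 => /ltW.
pose g (z : T) := (edot z (e1 R n) / enorm z) ^+ 2.
have e1E (z : T) : edot z (e1 R n) = (z : 'rV[R]_n) 0 (Ordinal n0).
  rewrite /edot (bigD1 (Ordinal n0))//= mxE/= mulr1 big1 ?addr0// => i i0.
  rewrite mxE; case: eqP => // i00; last by rewrite mulr0.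
  by move: i0; rewrite -val_eqE /= i00.
have mg : measurable_fun setT g.
  rewrite /g; apply: measurable_funX; under eq_fun do rewrite e1E.
  apply: measurable_funM; first exact: measurable_coord.
  rewrite (_ : (fun x : T => (enorm x)^-1) = (fun x => powR (enorm x) (-1))).
    apply: (measurableT_comp (f := fun t : R => t `^ (-1))); first exact: measurable_powR.
    exact: measurable_enorm.
  by apply/funext => x; rewrite powR_inv1// enorm_ge0.
have g0 z : 0 <= g z by exact: sqr_ge0.
have g1 z : g z <= 1.
  rewrite /g e1E; have [->|nz] := eqVneq (enorm z) 0; first by rewrite invr0 mulr0 expr0n.
  have z0 : 0 < enorm z by rewrite lt0r nz enorm_ge0.
  rewrite -real_normK ?num_real// exprn_ile1// normrM normfV (gtr0_norm z0).
  by rewrite ler_pdivrMr// mul1r coord_le_enorm.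
have gA z : A z -> t ^+ 2 <= g z.
  move=> Az; rewrite /g e1E; have := Az (Ordinal n0); rewrite !mxE => /andP[h _].
  have zi0 := le_trans (ltW t0) h.
  have := AB _ Az; rewrite /eball /= subr0 => z1.
  have z0 : 0 < enorm z.
    apply: lt_le_trans (coord_le_enorm z (Ordinal n0)).
    by rewrite normr_gt0 gt_eqF// (lt_le_trans t0).
  have tz : t <= (z : 'rV[R]_n) 0 (Ordinal n0) / enorm z.
    by rewrite ler_pdivlMr//; apply: le_trans h; apply: ler_piMr; exact: ltW.
  by apply: lerXn2r => //; [exact: ltW|apply: divr_ge0 => //; exact: ltW].
rewrite /K2n mulf_neq0// ?invr_eq0 gt_eqF//; apply: fine_gt0; apply/andP; split => //.
- apply: (@lt_le_trans _ _ (\int[mu]_(z in A) (t ^+ 2)%:E)%E).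
    by rewrite integral_cst// muA -EFinM lte_fin mulr_gt0 ?exprn_gt0.
  apply: (@le_trans _ _ (\int[mu]_(z in A) (g z)%:E)%E).
    apply: ge0_le_integral => //.
    - by move=> z _; rewrite lee_fin sqr_ge0.
    - by apply: measurable_funEFin; apply: measurable_funTS.
  apply: ge0_subset_integral => //.
    by apply: measurable_funEFin; apply: measurable_funTS.
  by move=> x _; rewrite lee_fin.
- apply: (@le_lt_trans _ _ (\int[mu]_(z in eball 0 1) (1)%:E)%E).
    apply: ge0_le_integral => //.
    - by move=> z _; rewrite lee_fin; exact: g0.
    - by apply: measurable_funEFin; apply: (measurable_funTS (f := g)).
    - by move=> z _; rewrite lee_fin; exact: g1.
  by rewrite integral_cst// mul1e.
- apply: (@lt_le_trans _ _ (mu A)); first by rewrite muA lte_fin exprn_gt0.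
  by apply: le_measure => //; rewrite inE.
Qed.

End Geometry.

Section Poincare.
Context (R : realType) (n : nat).
Local Notation T := (Rn R n).
Variable mu : {sigma_finite_measure set T -> \bar R}.
Local Notation pi := (mu \x mu)%E.
Local Notation "x +v y" := ((x : 'rV[R]_n) + (y : 'rV[R]_n) : T) (at level 50).
Local Notation "x -v y" := ((x : 'rV[R]_n) - (y : 'rV[R]_n) : T) (at level 50).
Hypothesis Htr : forall (a : T) (g : T -> \bar R), measurable_fun setT g ->
  (forall x, 0 <= g x)%E -> (\int[mu]_x g (x +v a) = \int[mu]_x g x)%E.

Definition diffsq (u : T -> R) (z : T) : \bar R :=
  (\int[mu]_x ((u (x +v z) - u x) ^+ 2)%:E)%E.

Lemma diffsq_ge0 (u : T -> R) (z : T) : (0 <= diffsq u z)%E.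
Proof. by apply: integral_ge0 => x _; rewrite lee_fin sqr_ge0. Qed.

Lemma diffsq_double (u : T -> R) (z : T) : measurable_fun setT u ->
  (diffsq u (z +v z) <= 4%:E * diffsq u z)%E.
Proof.
move=> mu'; have mz := measurable_shift z mu'; have mzz := measurable_shift (z +v z) mu'.
have mzz' : measurable_fun setT (fun x : T => u ((x +v z) +v z)) by exact: (measurable_shift z mz).
apply: (@le_trans _ _ (\int[mu]_x (2 * (u ((x +v z) +v z) - u (x +v z)) ^+ 2 +
   2 * (u (x +v z) - u x) ^+ 2)%:E)%E).
  apply: ge0_le_integralR; [by meas|by meas|by move=> x; exact: sqr_ge0|].
  move=> x; rewrite addrA -subr_ge0.
  set a := u _; set b := u _; set c := u _.
  rewrite (_ : _ - _ = (a - 2 * b + c) ^+ 2) ?sqr_ge0//; ring.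
rewrite ge0_integralDR; [|by meas|by move=> x; rewrite mulr_ge0 ?sqr_ge0|by meas|by move=> x; rewrite mulr_ge0 ?sqr_ge0].
rewrite !ge0_integralZlR//; try (by move=> x; exact: sqr_ge0); try by meas.
rewrite (Htr z (g := fun x : T => ((u (x +v z) - u x) ^+ 2)%:E)); first last.
- by move=> x; rewrite lee_fin sqr_ge0.
- by meas.
rewrite -/(diffsq u z) -ge0_muleDl ?lee_fin// -EFinD.
by rewrite (_ : 2 + 2 = 4 :> R)//; ring.
Qed.

Lemma diffsq_pow (u : T -> R) (z : T) k : measurable_fun setT u ->
  (diffsq u ((2 ^+ k) *: (z : 'rV[R]_n))%R <= (4 ^+ k)%:E * diffsq u z)%E.
Proof.
move=> mu'; elim: k => [|k IH]; first by rewrite !expr0 scale1r mul1e.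
have -> : 2 ^+ k.+1 *: (z : 'rV[R]_n) = (2 ^+ k *: (z : 'rV[R]_n)) +v (2 ^+ k *: (z : 'rV[R]_n)).
  by rewrite -scalerDl exprS mulr_natl mulr2n.
apply: le_trans (diffsq_double _ mu') _.
by rewrite exprS EFinM -muleA; apply: lee_wpmul2l.
Qed.

Lemma diffsq_far (O : set T) (u : T -> R) (z : T) : measurable_fun setT u ->
  (forall x, ~ O x -> u x = 0) -> (forall x : T, O x -> ~ O (x +v z)) ->
  (sqn mu u <= diffsq u z)%E.
Proof.
move=> mu' u0 Oz; have mz := measurable_shift z mu'.
apply: ge0_le_integralR; [by meas|by meas|by move=> x; exact: sqr_ge0|].
move=> x; have [Ox|nO] := pselect (O x); last by rewrite (u0 x)// expr0n sqr_ge0.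
by rewrite (u0 (x +v z)) ?sub0r ?sqrrN//; exact: Oz.
Qed.

Variables (O : set T) (w : T -> R) (L : R).
Hypothesis mw : measurable_fun setT w.
Hypothesis wN : forall z, w (- (z : 'rV[R]_n)) = w z.
Hypothesis OL : forall x z : T, O x -> O (z +v x) -> enorm z <= L.
Hypothesis wpos : (0 < \int[mu]_z (enorm z ^+ 2 * w z ^+ 2)%:E)%E.
Local Notation K := (Kof w).

Lemma measurable_diffsq (u : T -> R) : measurable_fun setT u ->
  measurable_fun setT (diffsq u).
Proof.
move=> mu'; pose F (p : T * T) := (u (p.2 +v p.1) - u p.2) ^+ 2.
have m3 : measurable_fun setT (fun p : T * T => u p.2).
  exact: (measurableT_comp mu' measurable_snd).
have m4 : measurable_fun setT (fun p : T * T => u (p.2 +v p.1)).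
  apply: (measurableT_comp mu').
  exact: (measurableT_comp (@measurable_addv R n) (@measurable_swap _ _ T T)).
have mF : measurable_fun setT F by rewrite /F; meas.
apply: (measurable_fun_fubini_tonelli_F (fun p => (F p)%:E)) => //.
  by meas.
by move=> p; rewrite lee_fin sqr_ge0.
Qed.

Lemma measurable_far (c : R) :
  measurable_fun setT (fun z : T => (c <= enorm z)%R%:R : R).
Proof.
rewrite (_ : (fun z : T => _) = \1_[set z : T | c <= enorm z]); last first.
  by apply/funext => z; rewrite indicE; congr (nat_of_bool _)%:R; apply/idP/idP; rewrite in_setE.
apply: measurable_indic; rewrite -[X in measurable X]setTI.
have := @measurable_enorm R n measurableT `[c, +oo[%classic (measurable_itv _).
by congr measurable; apply/seteqP; split => x /=; rewrite in_itv /= andbT.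
Qed.

Lemma sqn_grad_diffsq (u : T -> R) : measurable_fun setT u ->
  (sqn pi (grad K u) = \int[mu]_z ((w z ^+ 2)%:E * diffsq u z))%E.
Proof.
move=> mu'; have mK := measurable_Kof mw; have mgu := measurable_grad mK mu'.
rewrite sqn_rowsq//.
pose F (p : T * T) := w p.2 ^+ 2 * (u (p.1 +v p.2) - u p.1) ^+ 2.
have m2 : measurable_fun setT (fun p : T * T => w p.2).
  exact: (measurableT_comp mw measurable_snd).
have m3 : measurable_fun setT (fun p : T * T => u p.1).
  exact: (measurableT_comp mu' measurable_fst).
have m4 : measurable_fun setT (fun p : T * T => u (p.1 +v p.2)).
  apply: (measurableT_comp mu').
  exact: measurable_addv.
have mF : measurable_fun setT F by rewrite /F; meas.
have F0 p : 0 <= F p by apply: mulr_ge0; exact: sqr_ge0.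
transitivity (\int[mu]_x \int[mu]_z (F (x, z))%:E)%E.
  apply: eq_integral => x _; rewrite rowsq_shift//; apply: eq_integral => z _.
  by rewrite /F /= (addrC (z : 'rV[R]_n)).
rewrite (fubini_tonelli (fun p => (F p)%:E)); [|by meas|by move=> p; rewrite lee_fin].
apply: eq_integral => z _; rewrite /F /=; have mz := measurable_shift z mu'.
rewrite ge0_integralZlR ?sqr_ge0//; [by meas|by move=> x; exact: sqr_ge0].
Qed.

(** The number of doublings needed to leave the domain grows as z approaches 0, so a single constant
    requires z bounded away from 0; some such region carries mass since |z|^2 w^2 is not null. *)
Lemma exists_far_mass : exists k : nat,
  (0 < \int[mu]_z (w z ^+ 2 * ((k.+1)%:R^-1 <= enorm z)%R%:R)%:E)%E.
Proof.
have me := @measurable_enorm R n.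
have mI k := measurable_far ((k.+1)%:R^-1).
apply: contrapT => H; move: wpos; rewrite ltNge => /negP; apply.
pose g k z := enorm (z : T) ^+ 2 * w z ^+ 2 * ((k.+1)%:R^-1 <= enorm z)%R%:R.
have mg k : measurable_fun setT (g k) by have := mI k => ?; rewrite /g; meas.
apply: (fatou_le (g := g)) => //.
- by move=> k z; rewrite mulr_ge0 ?ler0n// mulr_ge0 ?sqr_ge0.
- move=> z; apply: cvg_near_cst; rewrite /g.
  have [->|z0] := eqVneq (enorm z) 0; first by apply: nearW => k; rewrite expr0n !mul0r.
  have {}z0 : 0 < enorm z by rewrite lt0r z0 enorm_ge0.
  near=> k; rewrite (_ : (_ <= _) = true) ?mulr1//.
  rewrite -[leRHS]invrK lef_pV2 ?posrE ?invr_gt0//.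
  apply: (@le_trans _ _ k%:R); last by rewrite ler_nat.
  by near: k; exact: nbhs_infty_ger.
- apply: nearW => k; have h0 : {ae mu, forall z, w z * ((k.+1)%:R^-1 <= enorm z)%R%:R = 0}.
    have mIk := mI k.
    apply: sqn0_ae; first by meas.
    apply/eqP; rewrite eq_le sqn_ge0 andbT leNgt; apply/negP => h; apply: H; exists k.
    move: h; congr (_ < _)%E; apply: eq_integral => z _.
    by rewrite exprMn; case: (_ <= _)%R; rewrite ?expr1n ?expr0n.
  rewrite -(@integral0 _ _ _ mu setT); apply: ae_ge0_le_integral => //.
  + by move=> z _; rewrite lee_fin mulr_ge0 ?ler0n// mulr_ge0 ?sqr_ge0.
  + by have := mg k => ?; meas.
  + apply: filterS h0 => z hz _; rewrite /g -mulrA expr2 -(mulrA (w z)) hz !mulr0//.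
Unshelve. all: by end_near. Qed.

Lemma poincare_inequality : exists2 P : R, 0 <= P &
  forall u, inU mu O K u -> (sqn mu u <= P%:E * sqn pi (grad K u))%E.
Proof.
have [k Hk] := exists_far_mass.
set I := (\int[mu]_z _)%E in Hk.
(* From [wpos] alone [I] could be infinite; a finite positive lower bound suffices. *)
have [a a0 aI] : exists2 a : R, 0 < a & (a%:E <= I)%E.
  move: Hk; case: I => [r|_|//]; first by rewrite lte_fin => r0; exists r.
  by exists 1; rewrite ?leey.
(* 2^M / (k + 1) exceeds L, so translation by 2^M z moves the domain off itself as soon as |z| >= 1
   / (k + 1). *)
pose M := Num.bound (`|L| * k.+1%:R).
have HM : `|L| * k.+1%:R < 2 ^+ M.
  apply: lt_le_trans (archi_boundP _) _; first by rewrite mulr_ge0.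
  by rewrite -natrX ler_nat; apply: ltnW; exact: ltn_expl.
exists (4 ^+ M / a); first by rewrite divr_ge0 ?exprn_ge0 ?ltW.
move=> u [[mu' u2] u0 [mgu gu2]].
have mI := measurable_far ((k.+1)%:R^-1).
have far z : (k.+1)%:R^-1 <= enorm z -> (sqn mu u <= (4 ^+ M)%:E * diffsq u z)%E.
  move=> zk; apply: le_trans (diffsq_pow z M mu').
  apply: (diffsq_far mu' u0) => x Ox Oxz.
  have : enorm (2 ^+ M *: (z : 'rV[R]_n)) <= L by apply: (OL Ox); rewrite addrC.
  rewrite enormZ ?exprn_ge0// leNgt => /negP; apply.
  apply: le_lt_trans (ler_norm L) _.
  apply: (@lt_le_trans _ _ (2 ^+ M * (k.+1)%:R^-1)); first by rewrite ltr_pdivlMr.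
  by rewrite ler_wpM2l ?exprn_ge0.
pose V := fine (sqn mu u).
have VE : sqn mu u = V%:E by rewrite fineK ?ge0_fin_numE ?sqn_ge0.
have V0 : 0 <= V by rewrite -lee_fin -VE sqn_ge0.
have : (V%:E * I <= (4 ^+ M)%:E * sqn pi (grad K u))%E.
  have mDu := measurable_diffsq mu'.
  rewrite sqn_grad_diffsq// /I -ge0_integralZlR//; last 2 first.
  - by meas.
  - by move=> z; rewrite mulr_ge0 ?ler0n ?sqr_ge0.
  have mG : measurable_fun setT (fun z => (w z ^+ 2)%:E * diffsq u z)%E.
    by apply: emeasurable_funM => //; meas.
  have G0 z : setT z -> (0 <= (w z ^+ 2)%:E * diffsq u z)%E.
    by move=> _; rewrite mule_ge0 ?diffsq_ge0 ?lee_fin ?sqr_ge0.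
  have M0 : (0 <= (4 ^+ M : R)%:E)%E by rewrite lee_fin exprn_ge0.
  rewrite -(ge0_integralZl _ measurableT mG G0 M0).
  apply: ge0_le_integral => //.
  - by move=> z _; rewrite lee_fin mulr_ge0// mulr_ge0 ?ler0n ?sqr_ge0.
  - by meas.
  - by apply: emeasurable_funM.
  move=> z _; have [zk|zk] := boolP ((k.+1)%:R^-1 <= enorm z); last first.
    by rewrite !mulr0 !mule_ge0 ?diffsq_ge0 ?lee_fin ?sqr_ge0 ?exprn_ge0.
  rewrite mulr1 mulrC EFinM -VE muleCA; apply: lee_wpmul2l; last exact: far.
  by rewrite lee_fin sqr_ge0.
pose S := fine (sqn pi (grad K u)).
have SE : sqn pi (grad K u) = S%:E by rewrite fineK ?ge0_fin_numE ?sqn_ge0.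
rewrite SE VE => H.
have {}H : (V%:E * a%:E <= (4 ^+ M)%:E * S%:E)%E.
  by apply: le_trans H; apply: lee_wpmul2l.
move: H; rewrite -!EFinM !lee_fin => H.
by rewrite mulrAC ler_pdivlMr.
Qed.

End Poincare.

(** * The closure of the divergence *)

Section Cut.
Context d (T : measurableType d) (R : realType).
Variable mu : {sigma_finite_measure set T -> \bar R}.
Local Notation pi := (mu \x mu)%E.
Variable D : set T.
Hypothesis mD : measurable D.

Lemma eq_integral_mkcond (A : set T) (g h : T -> \bar R) :
  (forall x, A x -> g x = h x) -> (forall x, ~ A x -> h x = 0%E) ->
  (\int[mu]_(x in A) g x = \int[mu]_x h x)%E.
Proof.
move=> gh h0; rewrite integral_mkcond; apply: eq_integral => x _.
by rewrite patchE; case: ifPn => [/set_mem/gh//|/negP xA]; rewrite h0// => /mem_set.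
Qed.

(** Extension by zero turns iterated integrals over [D] into integrals over the whole product, where
    Fubini and the norms above apply. *)
Definition cut (q : T -> T -> R) (z : T * T) : R :=
  if (z.1 \in D) && (z.2 \in D) then q z.1 z.2 else 0.

Lemma cut_in q x y : D x -> D y -> cut q (x, y) = q x y.
Proof. by move=> Dx Dy; rewrite /cut !mem_set. Qed.

Lemma supp_cut q : supp D (cut q).
Proof.
move=> x y nD; rewrite /cut /=; case: ifPn => // /andP[/set_mem Dx /set_mem Dy].
by case: nD.
Qed.

Lemma measurable_cut q : measurable_fun (D `*` D) (fun p => q p.1 p.2) <->
  measurable_fun setT (cut q).
Proof.
have -> : cut q = (fun p => q p.1 p.2) \_ (D `*` D).
  by apply/funext => z; rewrite patchE in_setX.
by apply: measurable_restrictT; exact: measurableX.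
Qed.

Lemma cut_curry (p : T * T -> R) : supp D p -> cut (fun x y => p (x, y)) = p.
Proof.
move=> sp; apply/funext => -[x y]; rewrite /cut /=.
case: ifPn => // h; rewrite sp// => -[Dx Dy]; move: h; rewrite !mem_set//.
Qed.

Lemma iterated_sqE (q : T -> T -> R) x : D x ->
  (\int[mu]_(x' in D) ((q x x') ^+ 2)%:E = rowsq mu (cut q) x)%E.
Proof.
move=> Dx; apply: eq_integral_mkcond => y Dy; first by rewrite cut_in.
by rewrite supp_cut ?expr0n//= => -[].
Qed.

Lemma L12normE (q : T -> T -> R) :
  (\int[mu]_(x in D) ((\int[mu]_(x' in D) ((q x x') ^+ 2)%:E) `^ (2^-1)) = N12 mu (cut q))%E.
Proof.
apply: eq_integral_mkcond => x Dx; first by rewrite iterated_sqE.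
by rewrite rown0// => y; rewrite supp_cut// => -[].
Qed.

Lemma iterated_sqn (q : T -> T -> R) : measurable_fun setT (cut q) ->
  (\int[mu]_(x in D) \int[mu]_(x' in D) ((q x x') ^+ 2)%:E = sqn pi (cut q))%E.
Proof.
move=> mq; rewrite (sqn_rowsq mu mq); apply: eq_integral_mkcond => x Dx.
  by rewrite iterated_sqE.
by apply: integral0_eq => y _; rewrite supp_cut ?expr0n// => -[].
Qed.

Lemma iterated_pairing (q g : T -> T -> R) :
  pi.-integrable setT (EFin \o (fun z => cut q z * cut g z)) ->
  (\int[mu]_(x in D) \int[mu]_(x' in D) (q x x' * g x x')%:E =
   (ip pi (cut q) (cut g))%:E)%E.
Proof.
move=> iqg; rewrite /ip /Rintegral fineK; last exact: integrable_fin_num iqg.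
rewrite -(integral12_prod_meas1 iqg).
apply: eq_integral_mkcond => x Dx.
  apply: eq_integral_mkcond => y Dy; first by rewrite /= !cut_in.
  by rewrite /= !supp_cut ?mul0r// => -[].
by apply: integral0_eq => y _; rewrite /= !supp_cut ?mul0r// => -[].
Qed.

Definition antisymmetrize (p : T * T -> R) (z : T * T) : R := (p z - p (z.2, z.1)) / 2.

Lemma N12_dist0 (p r : T * T -> R) : measurable_fun setT p -> measurable_fun setT r ->
  N12 mu (fun z => p z - r z) = 0%E -> N12 mu r = N12 mu p.
Proof.
move=> mp mr N0.
have md : measurable_fun setT (fun z => p z - r z) by meas.
have mNd : measurable_fun setT (fun z => - (p z - r z)) by meas.
have Er : r = fun z => p z + - (p z - r z).
  by apply/funext => z; rewrite opprB addrC subrK.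
have Ep : p = fun z => r z + (p z - r z) by apply/funext => z; rewrite addrC subrK.
apply/eqP; rewrite eq_le; apply/andP; split.
  by rewrite [in leLHS]Er; apply: le_trans (N12D mu mp mNd) _; rewrite N12N N0 adde0.
by rewrite [in leLHS]Ep; apply: le_trans (N12D mu mr md) _; rewrite N0 adde0.
Qed.

Lemma supp_antisymmetrize (p : T * T -> R) : supp D p -> supp D (antisymmetrize p).
Proof.
move=> sp x y nD; rewrite /antisymmetrize /= (sp x y)// (sp y x) ?subrr ?mul0r//.
by move=> [Dy Dx]; exact: nD.
Qed.

Lemma antisymmetrizeC (p : T * T -> R) x y :
  antisymmetrize p (x, y) = - antisymmetrize p (y, x).
Proof. by rewrite /antisymmetrize /= -mulNr opprB. Qed.

(** The given antisymmetry is a nested almost-everywhere statement, whereas [inQ] asks for it at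
    every pair. The antisymmetric part is an exact representative, since it differs from [q] only by
    null rows for almost every x. *)
Lemma antisymmetrize_row (q : T -> T -> R) : measurable_fun setT (cut q) ->
  {ae mu, forall x, D x -> {ae mu, forall x', D x' -> q x x' = - q x' x}} ->
  {ae mu, forall x, rown mu (fun z => cut q z - antisymmetrize (cut q) z)%R x = 0}%E.
Proof.
move=> mq; apply: filterS => x hx.
have [Dx|nD] := pselect (D x); last first.
  rewrite rown0// => y; rewrite /antisymmetrize /= !supp_cut ?subrr ?mul0r ?subrr//; by case.
have -> : (0 = 0 `^ (2^-1 : R))%E by rewrite poweR0r// invr_eq0.
congr (_ `^ _)%E; rewrite -(@integral0 _ _ _ mu setT).
have ma : measurable_fun setT (fun z => cut q z - antisymmetrize (cut q) z).
  rewrite /antisymmetrize; have := measurable_swap_fun mq => ?.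
  by apply: measurable_funB => //; apply: measurable_funM => //; apply: measurable_funB.
have mx := measurable_row x ma.
apply: ae_eq_integral => //.
  by apply: measurable_funEFin; apply: measurable_funX; exact: mx.
apply: filterS (hx Dx) => y hy _ /=.
have [Dy|nD] := pselect (D y).
  rewrite /antisymmetrize /= !cut_in// (hy Dy).
  by rewrite (_ : _ - _ = 0) ?expr0n//; field.
by rewrite /antisymmetrize /= !supp_cut ?subrr ?mul0r ?subrr ?expr0n//; case.
Qed.

End Cut.

(** * Reduction of the original problem to fluxes on the whole product *)

Section Interface.
Context (R : realType) (n : nat).
Local Notation T := (Rn R n).
Variable mu : {sigma_finite_measure set T -> \bar R}.
Local Notation pi := (mu \x mu)%E.
Variables (O : set 'rV[R]_n) (delta : R) (w : 'rV[R]_n -> R).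
Hypothesis n0 : (0 < n)%N.
Hypothesis lmu : is_lebesgue mu.
Hypothesis oO : open O.
Hypothesis bO : ebounded O.
Hypothesis d0 : 0 < delta.
Hypothesis kw : kernel_ok mu delta w.
Local Notation D := (Odelta O delta).
Local Notation K := (Kof (w : T -> R)).

Lemma domain_measurable : measurable (O : set T).
Proof. exact: measurable_open. Qed.
Let mO := domain_measurable.

Lemma Odelta_measurable : measurable D.
Proof. by apply: measurable_open; exact: open_Odelta. Qed.
Let mD := Odelta_measurable.

Lemma domain_sub : (O : set T) `<=` (D : set T).
Proof. exact: sub_Odelta. Qed.

Lemma kernel_measurable : measurable_fun setT K.
Proof. by apply: measurable_Kof; case: kw. Qed.
Let mK := kernel_measurable.

Lemma kernel_even (z : T) : w (- (z : 'rV[R]_n)) = w z.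
Proof. by have [_ _ h _ _] := kw; apply: h; exact: enormN. Qed.

Lemma kernel_sym (x y : T) : K (x, y) = K (y, x).
Proof. exact: (KofC kernel_even). Qed.

Lemma kernel_supp (x y : T) : O x -> ~ D y -> K (x, y) = 0.
Proof.
move=> Ox nD; have [_ _ _ h _] := kw; apply: h; rewrite leNgt; apply/negP => xy.
by apply: nD; exists x; split; rewrite // -enormN opprB.
Qed.

Lemma zext_in u (x : T) : O x -> zext O u x = u x.
Proof. by move=> Ox; rewrite /zext; case: asboolP. Qed.

Lemma zext_out u (x : T) : ~ O x -> zext O u x = 0.
Proof. by move=> Ox; rewrite /zext; case: asboolP. Qed.

Lemma zext_id (v : T -> R) : (forall x, ~ O x -> v x = 0) -> zext O v = v.
Proof.
move=> v0; apply/funext => x; have [Ox|nO] := pselect (O x); first by rewrite zext_in.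
by rewrite zext_out// v0.
Qed.

Lemma integral_zext_sq (u : T -> R) :
  (\int[mu]_(x in O) ((u x) ^+ 2)%:E = sqn mu (zext O u))%E.
Proof.
apply: eq_integral_mkcond => x Ox; first by rewrite zext_in.
by rewrite zext_out// expr0n.
Qed.

Lemma inL2_zext (u : T -> R) : inL2 mu O u <-> l2 mu (zext O u).
Proof.
rewrite /inL2 /l2 integral_zext_sq.
have -> : zext O u = u \_ O.
  apply/funext => x; rewrite patchE; case: ifPn => [/set_mem Ox|/negP nO].
    by rewrite zext_in.
  by rewrite zext_out// => /mem_set.
by have := measurable_restrictT u mO => H; split=> -[h1 h2]; split => //; apply/H.
Qed.

Lemma cut_Gd u : cut D (Gd O w u) = grad K (zext O u).
Proof.
apply/funext => -[x y]; rewrite /cut /=; case: ifPn => [//|h]; rewrite /grad /=.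
have [Ox|nOx] := pselect (O x); last first.
  have [Oy|nOy] := pselect (O y); last by rewrite !zext_out// subrr mul0r.
  rewrite kernel_sym kernel_supp ?mulr0// => Dx; move: h; rewrite !mem_set//.
  exact: sub_Odelta.
rewrite kernel_supp ?mulr0// => Dy; move: h; rewrite !mem_set//.
exact: sub_Odelta.
Qed.

Lemma inL2x2_cut (q : T -> T -> R) : inL2x2 mu D q <-> l2 pi (cut D q).
Proof.
rewrite /inL2x2 /l2; have H := measurable_cut mD q; split=> -[h1 h2].
  have mq : measurable_fun setT (cut D q) by apply/H.
  by split => //; rewrite -(iterated_sqn mu mq).
by split; [apply/H|rewrite (iterated_sqn mu h1)].
Qed.

Lemma Ud0_inU u : Ud0 mu O delta w u <-> inU mu O K (zext O u).
Proof.
split=> [[/inL2_zext h1 /inL2x2_cut]|[h1 _ h2]].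
  by rewrite cut_Gd => h2; split => // x; exact: zext_out.
by split; [apply/inL2_zext|apply/inL2x2_cut; rewrite cut_Gd].
Qed.

Lemma integral_zextM (g v : T -> R) : l2 mu (zext O g) -> l2 mu (zext O v) ->
  (\int[mu]_(x in O) (g x * v x)%:E = (ip mu (zext O g) (zext O v))%:E)%E.
Proof.
move=> lg lv; have igv := l2_integrableM lg lv.
rewrite /ip /Rintegral fineK; last exact: integrable_fin_num igv.
apply: eq_integral_mkcond => x Ox; first by rewrite /= !zext_in.
by rewrite /= !zext_out// mul0r.
Qed.

Lemma is_DdE (q : T -> T -> R) (g : T -> R) : is_Dd mu O delta w q g <->
  [/\ l2 pi (cut D q), l2 mu (zext O g) &
    forall v, inU mu O K v -> ip pi (cut D q) (grad K v) = - ip mu (zext O g) v].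
Proof.
have pair v : l2 pi (cut D q) -> l2 mu (zext O g) -> inU mu O K (zext O v) ->
  ((\int[mu]_(x in O) (g x * v x)%:E =
   - \int[mu]_(x in D) \int[mu]_(x' in D) (q x x' * Gd O w v x x')%:E)%E <->
   ip pi (cut D q) (grad K (zext O v)) = - ip mu (zext O g) (zext O v)).
  move=> lq lg [lv _ lgv].
  rewrite (integral_zextM lg lv) iterated_pairing ?cut_Gd; last exact: l2_integrableM.
  rewrite -EFinN; split=> [[->]|->]; by rewrite opprK.
split=> [[/inL2x2_cut lq /inL2_zext lg H]|[lq lg H]]; split; try exact/inL2x2_cut; try exact/inL2_zext; try by [].
  move=> v Uv; have [_ v0 _] := Uv; have vE := zext_id v0.
  rewrite -vE; apply/pair => //; rewrite ?vE//; apply: H.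
  by apply/Ud0_inU; rewrite vE.
by move=> v /Ud0_inU Uv; apply/pair => //; exact: H.
Qed.

Lemma Odelta_finite : exists2 m : R, 0 <= m & (mu D <= m%:E)%E.
Proof.
have [M DM] := bounded_Odelta delta bO.
have h := bounded_measure_lty lmu mD DM.
exists (fine (mu D)); first by rewrite fine_ge0.
by rewrite fineK// ge0_fin_numE.
Qed.

Lemma translation_invariance (a : T) (g : T -> \bar R) : measurable_fun setT g ->
  (forall x, 0 <= g x)%E ->
  (\int[mu]_x g ((x : 'rV[R]_n) + (a : 'rV[R]_n) : T)%R = \int[mu]_x g x)%E.
Proof. by move=> mg g0; exact: (@ge0_integral_translate R n mu lmu a g mg g0). Qed.

Lemma kernel_moment_gt0 : (0 < \int[mu]_z (enorm z ^+ 2 * w z ^+ 2)%:E)%E.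
Proof.
have [_ _ _ _ wI] := kw; rewrite lt0e integral_ge0 ?andbT; last first.
  by move=> z _; rewrite lee_fin mulr_ge0 ?sqr_ge0.
by rewrite wI eqe invr_eq0 (K2n_neq0 lmu n0).
Qed.

(** On the support of the kernel |z|^2 w^2 <= delta^2 w^2, so a null w^2 would force a null second
    moment. *)
Lemma kernel_sq_gt0 : (0 < \int[mu]_z (w z ^+ 2)%:E)%E.
Proof.
have [mw _ _ w0 _] := kw.
have I0 : (0 <= \int[mu]_z (w z ^+ 2)%:E)%E.
  by apply: integral_ge0 => z _; rewrite lee_fin sqr_ge0.
rewrite lt0e I0 andbT; apply/negP => /eqP IE.
have me := @measurable_enorm R n.
have := kernel_moment_gt0; rewrite ltNge => /negP; apply.
apply: (@le_trans _ _ (\int[mu]_z (delta ^+ 2 * w z ^+ 2)%:E)%E); last first.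
  rewrite ge0_integralZlR ?sqr_ge0 ?IE ?mule0//; first by meas.
  by move=> z; exact: sqr_ge0.
apply: ge0_le_integralR; [by meas|by meas|by move=> z; rewrite mulr_ge0 ?sqr_ge0|].
move=> z; have [zd|zd] := leP delta (enorm z); first by rewrite w0// expr0n !mulr0.
by apply: ler_wpM2r; [exact: sqr_ge0|apply: lerXn2r; rewrite ?nnegrE ?enorm_ge0 ?ltW].
Qed.

Lemma nonlocal_poincare : exists2 P : R, 0 <= P &
  forall u, inU mu O K u -> (sqn mu u <= P%:E * sqn pi (grad K u))%E.
Proof.
have [L HL] := bounded_diff bO; have [mw _ _ _ _] := kw.
exact: (poincare_inequality translation_invariance mw kernel_even HL kernel_moment_gt0).
Qed.

Variable f : 'rV[R]_n -> R.
Hypothesis f2 : inL2 mu O f.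
Local Notation F := (zext O f).

Let lF : l2 mu F. Proof. exact/inL2_zext. Qed.

(** Makes the admissible class nonempty, with a flux that is moreover square-integrable and
    satisfies the equation for all potentials, without a bound on rows. [c * grad K u] is
    antisymmetric because the kernel is even. *)
Lemma potential_inQ : exists q0, [/\ inQ mu O D K F q0, l2 pi q0 &
  forall v, inU mu O K v -> ip pi q0 (grad K v) = - ip mu F v].
Proof.
have [m m0 muDm] := Odelta_finite; have [P P0 HP] := nonlocal_poincare.
have OD := domain_sub.
have [u [c [Uu Hu]]] := exists_potential mK P0 HP lF.
have [_ u0 lgu] := Uu.
have lq := l2Z c lgu.
have sq : supp D (fun z => c * grad K u z).
  by move=> x y nD; rewrite (grad_supp OD kernel_sym kernel_supp Uu)// mulr0.
exists (fun z => c * grad K u z); split => //; split => //.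
- exact: lq.1.
- by move=> x y; rewrite /grad /= kernel_sym; ring.
- exact: (l2_N12_lty mD muDm lq sq).
- by move=> v C _ Uv _; exact: Hu.
Qed.

Lemma minimizer_inQ : exists q, inQ mu O D K F q /\
  forall p, inQ mu O D K F p -> (N12 mu q <= N12 mu p)%E.
Proof.
have [m m0 muDm] := Odelta_finite.
have OD := domain_sub.
have [mw w0 _ wd _] := kw.
have [q0 [Qq0 _ _]] := potential_inQ.
apply: (exists_minimizer mD m0 muDm); last by exists q0.
apply: (density_of_approx mD OD mK _ m0 muDm lF); first by move=> z; exact: w0.
have mS : measurable (eball 0 delta : set T) by apply: measurable_open; exact: open_eball.
apply: (exists_regular_approx translation_invariance mO mD mS mw w0 kernel_even OD kernel_supp muDm _ _ kernel_sq_gt0).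
  apply: (bounded_measure_lty (M := delta) lmu mS) => x.
  by rewrite /eball /= subr0 => /ltW.
by move=> z; rewrite /eball /= subr0 => /negP; rewrite -leNgt; exact: wd.
Qed.

(** Pairing with a bounded-row gradient is continuous for the L^{1,2} norm, so the equation passes
    from the approximants to [q]; antisymmetrising alters neither the norm nor these pairings. *)
Lemma Qbar_inQ q : Qbar_a mu O delta w f q ->
  inQ mu O D K F (antisymmetrize (cut D q)) /\
  N12 mu (antisymmetrize (cut D q)) = L12norm mu D q.
Proof.
move=> [aq [[mq Nq] [_ [qk [gk [Hk cq cg]]]]]].
have {}mq : measurable_fun setT (cut D q) by apply/measurable_cut.
have {}Nq : (N12 mu (cut D q) < +oo)%E by rewrite -L12normE.
have ma : measurable_fun setT (antisymmetrize (cut D q)).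
  have := measurable_swap_fun mq => ?; rewrite /antisymmetrize; meas.
have r0 := antisymmetrize_row mq aq.
have md : measurable_fun setT (fun z => cut D q z - antisymmetrize (cut D q) z) by meas.
have N0 : N12 mu (fun z => cut D q z - antisymmetrize (cut D q) z) = 0%E.
  rewrite /N12 -(@integral0 _ _ _ mu setT); apply: ae_eq_integral => //.
    exact: measurable_rown.
  by apply: filterS r0 => x h _.
have NE := N12_dist0 mq ma N0.
have Na : (N12 mu (antisymmetrize (cut D q)) < +oo)%E by rewrite NE.
split; last by rewrite NE /L12norm (L12normE mu D q).
split; [exact: ma|exact/supp_antisymmetrize/supp_cut|exact: antisymmetrizeC|exact: Na|].
move=> v C C0 Uv vC; have [lv v0 [mgv gv2]] := Uv.
have Nd : (N12 mu (fun z => cut D q z - antisymmetrize (cut D q) z)%R < +oo)%E by rewrite N0 ltry.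
have iq := pair_integrable C0 mq mgv Nq vC.
have ia := pair_integrable C0 ma mgv Na vC.
have -> : ip pi (antisymmetrize (cut D q)) (grad K v) = ip pi (cut D q) (grad K v).
  apply/esym/eqP; rewrite -subr_eq0 -normr_le0 -lee_fin.
  have := pair_abs_le C0 md mgv Nd vC; rewrite N0 mule0; congr (`|_|%:E <= _)%E.
  by rewrite /ip -RintegralB//; apply: eq_Rintegral => z _; rewrite mulrBl.
suff H : forall e : R, 0 < e -> `|ip pi (cut D q) (grad K v) + ip mu F v| <= e.
  apply/eqP; rewrite -subr_eq0 opprK -normr_le0; apply/ler_addgt0Pr => e e0.
  by rewrite add0r; exact: H.
move=> e e0; pose s := Num.sqrt (ip mu v v).
have s0 : 0 <= s by exact: sqrtr_ge0.
have c0 : 0 < C + s + 1 by rewrite ltr_wpDl ?addr_ge0.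
(* [C] multiplies the error of the flux, and [s], the norm of [v], that of the datum. *)
pose t := e / (C + s + 1); have t0 : 0 < t by rewrite divr_gt0.
have [j [Hj1 Hj2]] : exists j,
    (L12norm mu D (fun x x' => qk j x x' - q x x')%R <= t%:E)%E /\
    (L2norm mu O (fun x => gk j x - f x)%R <= t%:E)%E.
  have [j1 _ H1] := cvge0_near_le cq t0; have [j2 _ H2] := cvge0_near_le cg t0.
  by exists (maxn j1 j2); split; [apply: H1|apply: H2]; rewrite /= ?leq_maxl ?leq_maxr.
have /is_DdE[[mqj qj2] lgj Hqj] := Hk j.
have mdj : measurable_fun setT (fun z => cut D q z - cut D (qk j) z) by meas.
have Nj : (N12 mu (fun z => cut D q z - cut D (qk j) z)%R <= t%:E)%E.
  have E : (fun z => cut D q z - cut D (qk j) z) =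
      (fun z => - cut D (fun x x' => qk j x x' - q x x') z).
    by apply/funext => z; rewrite /cut; case: ifP => _; rewrite ?opprB ?subrr ?oppr0.
  by rewrite E (N12N mu (cut D _)) -(L12normE mu D).
have Njoo := le_lt_trans Nj (ltry t).
have ij := pair_integrable C0 mdj mgv Njoo vC.
have iqj := l2_integrableM (conj mqj qj2) (conj mgv gv2).
have E1 : ip pi (cut D q) (grad K v) = ip pi (fun z => cut D q z - cut D (qk j) z) (grad K v) +
    ip pi (cut D (qk j)) (grad K v).
  rewrite /ip -RintegralD//; apply: eq_Rintegral => z _.
  by rewrite -mulrDl subrK.
have B1 : `|ip pi (fun z => cut D q z - cut D (qk j) z) (grad K v)| <= C * t.
  rewrite -lee_fin; apply: (le_trans (pair_abs_le C0 mdj mgv Njoo vC)).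
  by rewrite EFinM; apply: lee_wpmul2l; rewrite ?lee_fin.
have lh : l2 mu (fun x => zext O (gk j) x - F x) by exact: l2B.
have sh : (sqn mu (fun x => zext O (gk j) x - F x)%R <= (t ^+ 2)%:E)%E.
  have I0 : (0 <= \int[mu]_(x in O) ((gk j x - f x) ^+ 2)%:E)%E.
    by apply: integral_ge0 => x _; rewrite lee_fin sqr_ge0.
  move: Hj2; rewrite /L2norm (poweR_half_le I0 (ltW t0)).
  congr (_ <= _)%E; apply: eq_integral_mkcond => x Ox; first by rewrite !zext_in.
  by rewrite !zext_out// subrr expr0n.
have B2 : `|ip mu (fun x => zext O (gk j) x - F x) v| <= s * t.
  have st0 : 0 <= s * t by rewrite mulr_ge0 ?(ltW t0).
  suff : `|ip mu (fun x => zext O (gk j) x - F x) v| ^+ 2 <= (s * t) ^+ 2.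
    by rewrite ler_sqr ?nnegrE.
  rewrite real_normK ?num_real//; apply: (le_trans (cauchy_schwarz_ip lh lv)).
  rewrite exprMn sqr_sqrtr ?ip_ge0// mulrC; apply: ler_wpM2l; first exact: ip_ge0.
  by rewrite -lee_fin (ipEFin lh).
have -> : ip pi (cut D q) (grad K v) + ip mu F v =
    ip pi (fun z => cut D q z - cut D (qk j) z) (grad K v) -
    ip mu (fun x => zext O (gk j) x - F x) v.
  by rewrite E1 (Hqj v Uv) (ipBl lgj lF lv); ring.
apply: le_trans (ler_normB _ _) _; apply: le_trans (lerD B1 B2) _.
by rewrite -mulrDl; exact: (mulr_frac_le (addr_ge0 C0 s0) (ltW e0)).
Qed.

(** The approximants [q0 + p k] have divergence exactly [f], so only the convergence of the fluxes
    remains, and [N12_closure] supplies it for [q - q0]. *)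
Lemma inQ_Qbar q : inQ mu O D K F q -> Qbar_a mu O delta w f (fun x y => q (x, y)).
Proof.
move=> [mq sq aq Nq Hq]; have cq := cut_curry sq.
have [m m0 muDm] := Odelta_finite; have [P P0 HP] := nonlocal_poincare.
have OD := domain_sub.
have [q0 [[mq0 sq0 _ Nq0 _] lq0 Hq0]] := potential_inQ.
have md : measurable_fun setT (fun z => q z - q0 z) by meas.
have sd : supp D (fun z => q z - q0 z) by move=> x y nD; rewrite sq// sq0// subrr.
have Nd : (N12 mu (fun z => q z - q0 z)%R < +oo)%E.
  have mN : measurable_fun setT (fun z => - q0 z) by meas.
  have NN : (N12 mu (fun z => - q0 z)%R < +oo)%E by rewrite N12N.
  exact: (le_lt_trans (N12D mu mq mN) (lte_add_pinfty Nq NN)).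
have Hd v C : 0 <= C -> inU mu O K v ->
    {ae mu, forall x, rown mu (grad K v) x <= C%:E}%E ->
    ip pi (fun z => q z - q0 z) (grad K v) = 0.
  move=> C0 Uv vC; have [lv v0 lgv] := Uv.
  have iq := pair_integrable C0 mq lgv.1 Nq vC.
  have iq0 := l2_integrableM lq0 lgv.
  have -> : ip pi (fun z => q z - q0 z) (grad K v) = ip pi q (grad K v) - ip pi q0 (grad K v).
    by rewrite /ip -RintegralB//; apply: eq_Rintegral => z _; rewrite mulrBl.
  by rewrite (Hq v C)// Hq0// subrr.
have ex k : exists p, inN mu O D K p /\ (N12 mu (fun z => q z - q0 z - p z)%R <= ((k.+1)%:R^-1)%:E)%E.
  by apply: (N12_closure mD mK OD kernel_sym kernel_supp P0 HP m0 muDm md sd Nd Hd).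
have [p Hp] := choice ex.
have lp k : l2 pi (p k) by have [[]] := Hp k.
have sp k : supp D (fun z => q0 z + p k z).
  by have [[_ s _] _] := Hp k; move=> x y nD; rewrite sq0// s// addr0.
have sqp k : supp D (fun z => q0 z + p k z - q z).
  by move=> x y nD; rewrite sp// sq// subr0.
split; first by apply: aeW => x Dx; apply: aeW => y Dy; exact: aq.
have mqc : measurable_fun setT (cut D (fun x y => q (x, y))) by rewrite cq.
split; first by split; [exact: (proj2 (measurable_cut mD _) mqc)|rewrite /L12norm L12normE cq].
split => //; exists (fun k x y => q0 (x, y) + p k (x, y)), (fun=> f); split.
- move=> k; apply/is_DdE.
  have -> : cut D (fun x y => q0 (x, y) + p k (x, y)) = (fun z => q0 z + p k z) := cut_curry (sp k).
  split => //; first exact: l2D.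
  move=> v Uv; have [_ _ lgv] := Uv; have [[_ _ Np] _] := Hp k.
  by rewrite (ipDl lq0 (lp k) lgv) Hq0// Np// addr0.
- apply: near_le_cvge0 => [k|e e0].
    by rewrite /L12norm L12normE; exact: N12_ge0.
  near=> k; rewrite /L12norm L12normE.
  have -> : cut D (fun x x' => q0 (x, x') + p k (x, x') - q (x, x')) =
    (fun z => q0 z + p k z - q z) := cut_curry (sqp k).
  rewrite -N12N (_ : (fun z => _) = (fun z => q z - q0 z - p k z)); last first.
    by apply/funext => z; rewrite opprB opprD addrA.
  have [_ h] := Hp k; apply: (le_trans h); rewrite lee_fin.
  rewrite -[leRHS]invrK lef_pV2 ?posrE ?invr_gt0//.
  apply: (@le_trans _ _ k%:R); last by rewrite ler_nat.
  by near: k; exact: nbhs_infty_ger.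
- rewrite (_ : (fun k => _) = fun=> 0%E); first exact: cvg_cst.
  apply/funext => k; rewrite /L2norm integral0_eq ?poweR0r ?invr_eq0//.
  by move=> x _; rewrite subrr expr0n.
Unshelve. all: by end_near. Qed.

Lemma exists_attained : exists qstar : T -> T -> R,
    Qbar_a mu O delta w f qstar /\
    L12norm mu D qstar = ereal_inf [set L12norm mu D q | q in Qbar_a mu O delta w f].
Proof.
have [q [Qq Hq]] := minimizer_inQ.
exists (fun x y => q (x, y)); split; first exact: inQ_Qbar.
have [_ sq _ _ _] := Qq.
apply/eqP; rewrite eq_le; apply/andP; split; last first.
  by apply: ereal_inf_lbound; exists (fun x y => q (x, y)) => //; exact: inQ_Qbar.
apply: le_ereal_inf_tmp => _ [p /Qbar_inQ[Qp <-] <-].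
by rewrite /L12norm L12normE cut_curry//; exact: Hq.
Qed.

End Interface.

Theorem theorem4p4 (R : realType) (n : nat) (mu : {measure set Rn R n -> \bar R})
  (O : set 'rV[R]_n) (f : 'rV[R]_n -> R) (delta : R) (w : 'rV[R]_n -> R) :
  (2 <= n)%N ->
  is_lebesgue mu ->
  lipschitz_domain O ->
  inL2 mu O f ->
  0 < delta ->
  kernel_ok mu delta w ->
  exists qstar : Rn R n -> Rn R n -> R,
    Qbar_a mu O delta w f qstar /\
    L12norm mu (Odelta O delta) qstar =
    ereal_inf [set L12norm mu (Odelta O delta) q | q in Qbar_a mu O delta w f].
Proof.
move=> n2 lmu [oO _ bO _] f2 d0 kw.
have sf := @lebesgue_sigma_finite R n mu lmu.
case: mu lmu f2 kw sf => m c lmu f2 kw sf.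
(* The cubes make [mu] sigma-finite; the structure is repacked so that the product of [mu] with
   itself is available. *)
pose smu : {sigma_finite_measure set Rn R n -> \bar R} := HB.pack m c
  (Measure_isSigmaFinite.Build _ _ _ _ sf).
exact: (@exists_attained R n smu O delta w (ltnW n2) lmu oO bO d0 kw f f2).
Qed.
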